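(* For $\lambda\in\mathbb Z_+^n$ we have $$\mathrm{ch}\,L(\Lambda(\lambda))=S^{\mathcal A/\mathcal B}_{\lambda},$$ where $\mathcal A=\frac12\mathbb Z_{>0}$ and $\mathcal B=\frac12\mathbb Z_{\le0}$ carry the usual linear orders and the $\mathbb Z_2$-grading in which elements of $\frac12+\mathbb Z$ have degree $0$ and elements of $\mathbb Z$ have degree $1$, and $x_k=e^{\omega_k}$ for $k\in\frac12\mathbb Z$.
   Context: $\frac12\mathbb Z=\{k/2:k\in\mathbb Z\}$. Lie superalgebra: index the basis of a superspace by $\frac12\mathbb Z$, with basis vectors indexed by $\mathbb Z$ even and by $\frac12+\mathbb Z$ odd. $\mathfrak{gl}_{\infty|\infty}$ is the Lie superalgebra (supercommutator) of complex matrices $(a_{ij})_{i,j\in\frac12\mathbb Z}$ with $a_{ij}=0$ for $|i-j|\gg0$; $e_{ij}$ are elementary matrices. $\widehat{\mathfrak{gl}}_{\infty|\infty}=\mathfrak{gl}_{\infty|\infty}\oplus\mathbb CK$ is the central extension by the two-cocycle $\alpha(A,B)=\mathrm{str}([J,A]B)$, $J=\sum_{r\le0}e_{rr}$, $\mathrm{str}(a_{ij})=\sum_i(-1)^{2i}a_{ii}$. It has a triangular decomposition $\mathfrak n_+\oplus\mathfrak h\oplus\mathfrak n_-$, with $\mathfrak h$ spanned by diagonal matrices and $K$, and $\mathfrak n_+$ (resp. $\mathfrak n_-$) the strictly upper (resp. lower) triangular matrices. $L(\Lambda)$ is the irreducible highest weight module with highest weight $\Lambda\in\mathfrak h^*$.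 $\mathbb Z_+^n=\{\lambda\in\mathbb Z^n:\lambda_1\ge\dots\ge\lambda_n\}$. Draw $\lambda\in\mathbb Z^n_+$ as a generalized Young diagram: fix a vertical line and put in row $k$ $|\lambda_k|$ boxes, immediately right of the line if $\lambda_k\ge0$, immediately left if $\lambda_k\le0$; columns to the right are indexed $1,2,\dots$ outward, to the left $-1,-2,\dots$ outward; $\lambda'_i$ is the number of boxes in column $i$, $i\in\mathbb Z\setminus\{0\}$. $\Lambda(\lambda)\in\mathfrak h^*$ is determined by $\Lambda(\lambda)(K)=n$ and $\Lambda(\lambda)(e_{kk})=\max\{\lambda'_k-k,0\}$ for $k\in\mathbb Z_{>0}$; $=-\max\{\lambda'_{k-1}+k,0\}$ for $k\in\mathbb Z_{\le0}$; $=\max\{\lambda_{k+\frac12}-k+\frac12,0\}$ for $k\in\frac12+\mathbb Z_{\ge0}$; $=-\max\{-\lambda_{n+k+\frac12}+k-\frac12,0\}$ for $k\in-\frac12-\mathbb Z_{\ge0}$ (with $\lambda_j=0$ for $j\notin\{1,\dots,n\}$); only finitely many values are nonzero and $\Lambda(\lambda)$ of a diagonal matrix is the corresponding finite sum. $\omega_k$ is the weight with $\omega_k(e_{ll})=\delta_{kl}$, $\omega_k(K)=0$. The character $\mathrm{ch}$ is taken with respect to the action of $\bigoplus_{k}\mathbb Ce_{kk}$. Tableaux: let $\mathcal A=\mathcal A_0\sqcup\mathcal A_1$, $\mathcal B=\mathcal B_0\sqcup\mathcal B_1$ be linearly ordered $\mathbb Z_2$-graded sets. $SST_{\mathcal A}(\alpha/\mu)$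 is the set of fillings of a skew Young diagram $\alpha/\mu$ by $\mathcal A$, weakly increasing along rows and columns, with entries of degree $0$ strictly increasing in columns and entries of degree $1$ strictly increasing in rows. $\mathscr P_n$ is the set of partitions of length at most $n$, $(d^n)=(d,\dots,d)$. $SST_{\mathcal A/\mathcal B}(\lambda)$ is the set of pairs $(T^+,T^-)$ with $T^+\in SST_{\mathcal A}((\lambda+(d^n))/\mu)$, $T^-\in SST_{\mathcal B}((d^n)/\mu)$ for some $d\ge0$, $\mu\in\mathscr P_n$ with $\lambda+(d^n)\in\mathscr P_n$, $\mu\subset(d^n)$, $\mu\subset\lambda+(d^n)$; pairs arising from $(d,\mu)$ and $(d+1,\mu+(1^n))$ with the same fillings are identified. $S^{\mathcal A/\mathcal B}_\lambda=\sum_{(T^+,T^-)\in SST_{\mathcal A/\mathcal B}(\lambda)}\mathbf x_{\mathcal A}^{T^+}(\mathbf x_{\mathcal B}^{T^-})^{-1}\in\mathbb Z[[\mathbf x_{\mathcal A},\mathbf x_{\mathcal B}^{-1}]]$, $\mathbf x^T=\prod_ax_a^{m_a}$, $m_a$ = number of occurrences of $a$ in $T$. *)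

(* Defs.v *)
From HB Require Import structures.
From mathcomp Require Import all_boot all_order all_algebra.
From mathcomp Require Import finmap complex.
From mathcomp Require Import all_classical reals.
Set Implicit Arguments. Unset Strict Implicit. Unset Printing Implicit Defensive.
Import Order.TTheory GRing.Theory Num.Theory.
Local Open Scope classical_set_scope.
Local Open Scope ring_scope.
Local Open Scope complex_scope.

(** Throughout, a half-integer [r] in (1/2)Z is encoded by the integer [k = 2r].
    So [k] even means [r] in Z (even basis vector), [k] odd means [r] in 1/2 + Z
    (odd basis vector), and the sign (-1)^(2r) is (-1)^k. *)
Definition halfZ := int.
HB.instance Definition _ := Order.Total.on halfZ.

Definition hodd (k : halfZ) : bool := odd `|k|%N.

Section LieSuperalgebra.
Variable R : realType.
Local Notation C := R[i].
Local Notation mat := (halfZ -> halfZ -> C).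

Definition banded (A : mat) : Prop :=
  exists N : nat, forall i j : halfZ, (N < `|i - j|)%N -> A i j = 0.

Definition banded_pred : {pred mat} := fun A => `[< banded A >].

Lemma banded_submod : submod_closed banded_pred.
Proof.
split; first by apply/asboolP; exists 0%N.
move=> a A B /asboolP[M hM] /asboolP[N hN]; apply/asboolP.
exists (maxn M N) => i j; rewrite gtn_max => /andP[hi hj].
have -> : (a *: A + B) i j = a * A i j + B i j by [].
by rewrite hM // hN // mulr0 addr0.
Qed.
HB.instance Definition _ :=
  GRing.isSubmodClosed.Build C mat banded_pred banded_submod.

Record glinf := GlInf { glmat :> mat; glinfP : glmat \in banded_pred }.
HB.instance Definition _ := [isSub for glmat].
HB.instance Definition _ := [Choice of glinf by <:].
HB.instance Definition _ := [SubChoice_isSubLmodule of glinf by <:].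

(* For banded matrices the sum has finite support. *)
Definition mulmat (A B : mat) : mat :=
  fun i j => \sum_(k \in [set: halfZ]) (A i k * B k j).

Definition mat_par (p : bool) (A : mat) : mat :=
  fun i j => if hodd (i - j) == p then A i j else 0.

Definition supercomm_mat (A B : mat) : mat :=
  \sum_(p : bool) \sum_(q : bool)
    (mulmat (mat_par p A) (mat_par q B)
     - (-1) ^+ (p && q) *: mulmat (mat_par q B) (mat_par p A)).

Lemma mulmat_banded A B : A \in banded_pred -> B \in banded_pred ->
  mulmat A B \in banded_pred.
Proof.
move=> /asboolP[M hM] /asboolP[N hN]; apply/asboolP.
exists (M + N)%N => i j hij; rewrite /mulmat fsbig1 // => k _.
case: (ltnP M `|i - k|%N) => [/hM ->|hik]; first by rewrite mul0r.
have [|hkj] := ltnP N `|k - j|%N; first by move/hN ->; rewrite mulr0.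
have := leq_trans hij (leq_trans (leqD_dist i k j) (leq_add hik hkj)).
by rewrite ltnn.
Qed.

Lemma mat_par_banded p A : A \in banded_pred -> mat_par p A \in banded_pred.
Proof.
move=> /asboolP[M hM]; apply/asboolP; exists M => i j /hM h.
by rewrite /mat_par h if_same.
Qed.

Lemma supercomm_banded A B : A \in banded_pred -> B \in banded_pred ->
  supercomm_mat A B \in banded_pred.
Proof.
move=> hA hB; apply: rpred_sum => p _; apply: rpred_sum => q _.
by rewrite rpredB ?rpredZ ?mulmat_banded ?mat_par_banded.
Qed.

Definition supercomm (A B : glinf) : glinf :=
  GlInf (supercomm_banded (glinfP A) (glinfP B)).

Definition Jmat : mat := fun i j => if (i == j) && (i <= 0) then 1 else 0.

(* The supertrace, for matrices with finitely many nonzero diagonal entries. *)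
Definition str (A : mat) : C :=
  \sum_(k \in [set: halfZ]) ((-1) ^+ `|k|%N * A k k).

Definition cocycle (A B : glinf) : C :=
  str (mulmat (supercomm_mat Jmat A) B).

(* The pair [(A, c)] is the element A + c K. *)
Definition glhat := (glinf * C^o)%type.
HB.instance Definition _ := GRing.Lmodule.on glhat.

Definition glhat_bracket (x y : glhat) : glhat :=
  (supercomm x.1 y.1, cocycle x.1 y.1).

Definition glhat_homog (p : bool) (x : glhat) : Prop :=
  (forall i j : halfZ, hodd (i - j) != p -> x.1 i j = 0) /\ (p -> x.2 = 0).

Definition cartan (x : glhat) : Prop :=
  forall i j : halfZ, i != j -> x.1 i j = 0.

Definition nplus (x : glhat) : Prop :=
  (forall i j : halfZ, ~~ (i < j) -> x.1 i j = 0) /\ x.2 = 0.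

Definition elem_mat (i j : halfZ) : mat :=
  fun k l => if (k == i) && (l == j) then 1 else 0.

Lemma elem_banded i j : elem_mat i j \in banded_pred.
Proof.
apply/asboolP; exists `|i - j|%N => k l; rewrite /elem_mat.
by case: eqP => //= ->; case: eqP => //= ->; rewrite ltnn.
Qed.

Definition elem (i j : halfZ) : glhat := (GlInf (elem_banded i j), 0).

(** [gpar false] and [gpar true] are the even and odd parts. *)
Record glhat_module := GlhatModule {
  gcarrier :> lmodType C;
  gpar : bool -> {pred gcarrier};
  gact : glhat -> gcarrier -> gcarrier;
  gpar_submod : forall p, submod_closed (gpar p);
  gpar_decomp : forall v : gcarrier, exists! w : gcarrier * gcarrier,
    [/\ w.1 \in gpar false, w.2 \in gpar true & v = w.1 + w.2];
  gact_linearr : forall x : glhat, linear (gact x);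
  gact_linearl : forall v : gcarrier, linear (gact^~ v);
  gact_par : forall p q x v, glhat_homog p x -> v \in gpar q ->
    gact x v \in gpar (p (+) q);
  gact_bracket : forall p q x y v, glhat_homog p x -> glhat_homog q y ->
    gact (glhat_bracket x y) v
    = gact x (gact y v) - (-1) ^+ (p && q) *: gact y (gact x v)
}.

(* Submodules are Z_2-graded. *)
Definition is_submodule (V : glhat_module) (W : {pred V}) : Prop :=
  [/\ submod_closed W,
      forall v w : V, v \in gpar false -> w \in gpar true ->
        v + w \in W -> v \in W /\ w \in W
    & forall (x : glhat) (v : V), v \in W -> gact x v \in W].

Definition is_irreducible (V : glhat_module) : Prop :=
  (exists v : V, v != 0) /\
  forall W : {pred V}, is_submodule W ->
    (forall v : V, v \in W -> v = 0) \/ (forall v : V, v \in W).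

(* Only the values of [Lam] on [cartan] matter. *)
Definition is_highest_weight_vector (V : glhat_module) (Lam : glhat -> C)
    (v : V) : Prop :=
  [/\ v != 0,
      exists p, v \in gpar p,
      forall x, nplus x -> gact x v = 0
    & forall x, cartan x -> gact x v = Lam x *: v].

Definition is_highest_weight_module (V : glhat_module) (Lam : glhat -> C) :
    Prop :=
  exists2 v : V, is_highest_weight_vector Lam v &
    forall W : {pred V}, is_submodule W -> v \in W -> forall w : V, w \in W.

(* V is (a model of) L(Lam). *)
Definition is_irr_hw_module (V : glhat_module) (Lam : glhat -> C) : Prop :=
  is_irreducible V /\ is_highest_weight_module V Lam.

(** A weight of the span of the e_kk is identified with the function
    [k |-> mu(e_kk)]; [omega k] is then the delta function at [k]. *)
Definition weight := halfZ -> C.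
HB.instance Definition _ := GRing.Lmodule.on weight.

Definition omega (k : halfZ) : weight := fun l => (l == k)%:R.

Definition weight_space (V : glhat_module) (mu : weight) : set V :=
  [set v | forall k, gact (elem k k) v = mu k *: v].

Definition has_dim (V : lmodType C) (W : set V) (d : nat) : Prop :=
  exists2 b : 'I_d -> V, forall i, W (b i) &
    forall v : V, W v -> exists! c : 'rV[C]_d, v = \sum_(i < d) c 0 i *: b i.

(** A formal sum [\sum_mu f mu * e^mu] is represented by [f]; [has_character V f]
    says that V is a weight module with finite-dimensional weight spaces and that
    ch V = [\sum_mu f mu * e^mu]. *)
Definition has_character (V : glhat_module) (f : weight -> nat) : Prop :=
  (forall v : V, exists s : seq V,
     (forall w, w \in s -> exists mu : weight, weight_space mu w) /\
     v = \sum_(w <- s) w) /\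
  (forall mu : weight, has_dim (weight_space (V := V) mu) (f mu)).

End LieSuperalgebra.

Definition dominant n (lam : 'I_n -> int) : Prop :=
  forall i j : 'I_n, (i <= j)%N -> lam j <= lam i.

(* lambda_j for j in {1..n}, and 0 for the other integers j *)
Definition row_len n (lam : 'I_n -> int) (j : int) : int :=
  \sum_(i < n | i.+1%:Z == j) lam i.

(* lambda'_i for i <> 0 *)
Definition col_len n (lam : 'I_n -> int) (i : int) : int :=
  #|[pred j : 'I_n | (0 < i <= lam j) || (lam j <= i < 0)]|%:Z.

(** The value of Lambda(lambda) on the diagonal elementary matrix of index k/2.
    For even k the index is the integer m = k/2; for odd k it is m + 1/2. *)
Definition Lambda_diag n (lam : 'I_n -> int) (k : halfZ) : int :=
  let m := (k %/ 2)%Z in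
  if hodd k then
    if 0 <= m then Num.max (row_len lam (m + 1) - m) 0
    else - Num.max (- row_len lam (n%:Z + m + 1) + m) 0
  else
    if 0 < m then Num.max (col_len lam m - m) 0
    else - Num.max (col_len lam (m - 1) + m) 0.

Definition Lambda (R : realType) n (lam : 'I_n -> int) (x : glhat R) : R[i] :=
  \sum_(k \in [set: halfZ]) (x.1 k k * (Lambda_diag lam k)%:~R) + x.2 * n%:R.

Definition is_part n (al : 'I_n -> nat) : Prop :=
  forall i j : 'I_n, (i <= j)%N -> (al j <= al i)%N.

Section Tableaux.
Variable n : nat.

(** A filling of the skew diagram [al/mu] is given by its rows: [T i] lists, from
    left to right, the entries in columns [mu i, ..., al i - 1] of row [i]. *)
Definition has_entry (A : Type) (mu : 'I_n -> nat) (T : {ffun 'I_n -> seq A})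
    (i : 'I_n) (j : nat) (a : A) : Prop :=
  (mu i <= j)%N /\ onth (T i) (j - mu i) = Some a.

Definition is_SST (d : Order.disp_t) (A : orderType d) (deg : A -> bool)
    (al mu : 'I_n -> nat) (T : {ffun 'I_n -> seq A}) : Prop :=
  [/\ forall i, size (T i) = (al i - mu i)%N,
      forall i j1 j2 a b, has_entry mu T i j1 a -> has_entry mu T i j2 b ->
        (j1 < j2)%N -> if deg a && deg b then (a < b)%O else (a <= b)%O
    & forall i1 i2 j a b, has_entry mu T i1 j a -> has_entry mu T i2 j b ->
        (i1 < i2)%N ->
        if ~~ deg a && ~~ deg b then (a < b)%O else (a <= b)%O].

Definition mult (X : eqType) (T : {ffun 'I_n -> seq X}) (x : X) : nat :=
  \sum_(i < n) count_mem x (T i).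

Lemma finite_mult (X : choiceType) (p : X -> nat) :
  finite_set [set T : {ffun 'I_n -> seq X} | mult T =1 p].
Proof.
case: (pselect (exists T : {ffun 'I_n -> seq X}, mult T =1 p)); last first.
  move=> h; rewrite (_ : mkset _ = set0) //.
  by apply/seteqP; split => // T hT; apply: h; exists T.
move=> [T0 hT0]; pose fl (T : {ffun 'I_n -> seq X}) := flatten (codom T).
have flE T x : count_mem x (fl T) = mult T x.
  by rewrite /fl count_flatten codomE -map_comp sumnE big_map big_enum.
pose s := fl T0; pose N := size s.
pose g (f : {ffun 'I_n -> N.-bseq (seq_sub s)}) : {ffun 'I_n -> seq X} :=
  [ffun i => map val (f i)].
apply: (@sub_finite_set _ _ (g @` setT)); last exact/finite_image/finite_finset.
move=> T hT.
have hp : perm_eq (fl T) s.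
  by apply/allP => x _ /=; rewrite !flE hT hT0.
have Tsub i x : x \in T i -> x \in s.
  move=> hx; rewrite -(perm_mem hp); apply/flattenP; exists (T i) => //.
  exact: codom_f.
have Tsz i : (size (T i) <= N)%N.
  rewrite /N -(perm_size hp) size_flatten sumnE big_map codomE big_map big_enum.
  by rewrite (bigD1 i) //= leq_addr.
have hb i : exists b : N.-bseq (seq_sub s), map val b = T i.
  have hsz : (size (pmap insub (T i) : seq (seq_sub s)) <= N)%N.
    by rewrite size_pmap_sub (leq_trans (count_size _ _)).
  exists (Bseq hsz) => /=; rewrite (pmap_filter (insubK _)).
  apply/all_filterP/allP => x /Tsub hx /=; by rewrite isSome_insub.
exists [ffun i => sval (cid (hb i))] => //.
by apply/ffunP => i; rewrite !ffunE; case: cid.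
Qed.

Variables (dA dB : Order.disp_t) (A : orderType dA) (B : orderType dB).
Variables (degA : A -> bool) (degB : B -> bool) (lam : 'I_n -> int).

Definition tab_pair : Type :=
  ({ffun 'I_n -> seq A} * {ffun 'I_n -> seq B})%type.
HB.instance Definition _ := Choice.on tab_pair.

(** The identification of (d, mu) with (d + 1, mu + (1^n)) is built in: rows do
    not record (d, mu), and [size (T.2 i) = d - mu i] recovers (d, mu) from [T]
    up to a simultaneous shift. *)
Definition SST_pairs : set tab_pair :=
  [set T | exists (d : nat) (mu al : 'I_n -> nat),
    [/\ is_part mu, is_part al, (forall i, (al i)%:Z = lam i + d%:Z),
        (forall i, (mu i <= d)%N /\ (mu i <= al i)%N)
      & is_SST degA al mu T.1 /\ is_SST degB (fun=> d) mu T.2]].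

Definition SST_pairs_of_content (p : A -> nat) (q : B -> nat) : set tab_pair :=
  [set T | SST_pairs T /\ mult T.1 =1 p /\ mult T.2 =1 q].

Lemma finite_SST_pairs_of_content p q : finite_set (SST_pairs_of_content p q).
Proof.
have h := finite_setX (finite_mult p) (finite_mult q).
by apply: (sub_finite_set _ h) => T [_ []].
Qed.

(* The coefficient of x_A^p (x_B^-1)^q in S_lambda. *)
Definition Sfun (p : A -> nat) (q : B -> nat) : nat :=
  #|` fset_set (SST_pairs_of_content p q)|%fset.

End Tableaux.

Definition halfZ_pos := {k : halfZ | 0 < k}.
HB.instance Definition _ := SubChoice.on halfZ_pos.
HB.instance Definition _ := [SubChoice_isSubOrder of halfZ_pos by <: with ring_display].

Definition halfZ_npos := {k : halfZ | k <= 0}.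
HB.instance Definition _ := SubChoice.on halfZ_npos.
HB.instance Definition _ := [SubChoice_isSubOrder of halfZ_npos by <: with ring_display].

(* 1/2 + Z has degree 0 and Z has degree 1. *)
Definition deg_pos (a : halfZ_pos) : bool := ~~ hodd (val a).
Definition deg_npos (b : halfZ_npos) : bool := ~~ hodd (val b).

(* x_A^p (x_B^-1)^q = e^(monomial_weight p q) under x_k = e^(omega_k) *)
Definition monomial_weight (R : realType)
    (p : halfZ_pos -> nat) (q : halfZ_npos -> nat) : weight R :=
  \sum_(a \in [set: halfZ_pos]) omega R (val a) *+ p a
  - \sum_(b \in [set: halfZ_npos]) omega R (val b) *+ q b.

(** S_lambda after the substitution x_k = e^(omega_k). Exponents with infinite
    support, where [monomial_weight] is meaningless, have coefficient 0. *)
Definition Sfun_exp (R : realType) n (lam : 'I_n -> int) (mu : weight R) : nat :=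
  \sum_(m \in [set m : (halfZ_pos -> nat) * (halfZ_npos -> nat)
                 | monomial_weight R m.1 m.2 = mu])
    Sfun deg_pos deg_npos lam m.1 m.2.

(* Main.v *)
(** The proof realises [L(Lambda(lam))] by Howe duality.  Take [n] copies of a
    system of oscillators psi+_r, psi-_r indexed by the half-integers, fermions
    for [r] in Z and bosons for [r] in 1/2 + Z.  On their Fock space the normally
    ordered sums over [k <= n] of psi+_(i,k) psi-_(j,k) represent the central
    extension of gl_(oo|oo) at level [n] and commute with a copy of gl_n acting
    on the colors [k].  Let H be the space of gl_n-singular vectors of weight
    [lam].

    Order the indices as 0, -1/2, -1, ..., -w, 1/2, 1, ..., w.  A configuration of
    particles is "good" if the partial sums of its gl_n-weight along this list are
    dominant and, at bosonic indices, change by a horizontal strip.  By sl_2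
    arguments a vector of H vanishing on all good configurations is zero;
    conversely, starting from a configuration which spells out the columns of the
    diagram [lam] by fermions far away, one reaches by suitable words in the e_ij
    vectors of H which are triangular on the good configurations.  So the weight
    spaces of H have dimension the number of good configurations of given content,
    and these are the pairs of tableaux: row [k] of (T+, T-) lists the particles
    of color [k], and the partial sums are the intermediate shapes.  Contravariance
    of the e_ij for a positive definite form makes H irreducible.

    Finally, if [v] and [v'] are highest weight vectors of [V] and of H, then the
    submodule of V x H generated by [(v, v')] is the graph of an isomorphism. *)

Require Import Defs.
From HB Require Import structures.
From mathcomp Require Import all_boot all_order all_algebra.
From mathcomp Require Import finmap complex.
From mathcomp Require Import all_classical reals.
From mathcomp Require Import zify ring.
Set Implicit Arguments. Unset Strict Implicit. Unset Printing Implicit Defensive.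
Import Order.TTheory GRing.Theory Num.Theory.
Local Open Scope classical_set_scope.
Local Open Scope ring_scope.

(** * Fock space *)

(** The obstacle is to exhibit enough vectors of H without knowing how the Fock space decomposes.
    The delta function at a configuration whose fermionic columns spell out [lam] is singular by the
    Pauli principle, and words in the e_ij keep it in H because they commute with gl_n; so
    singularity never has to be checked again and only leading terms are tracked. The columns are
    placed beyond the window so that they do not mix with the content to be produced, and every
    sufficiently remote position will do. This gives exact dimensions without a Cauchy identity or
    complete reducibility.

    Irreducibility comes from the same vector: it spans the part of H of its own content, and from
    any weight vector of H the adjoint of a suitable basis word leads back to it.

    Infinite rank is harmless since matrices are banded and vectors of H have finite support: every
    identity is proved in a finite window with some margin at its edges. H stays a predicate on
    functions, and the isomorphism with [V] stays a relation. *)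

Definition ferm (r : halfZ) : bool := ~~ hodd r.

Section Fock.
Variables (R : realType) (n : nat).
Local Notation C := R[i].

Definition mode := (halfZ * 'I_n)%type.

(* [c r k] is the number of particles of color [k] at the index [r / 2]. *)
Record conf := Conf {
  occ :> halfZ -> 'I_n -> nat;
  occP : `[< forall r k, ferm r -> (occ r k <= 1)%N >] }.
HB.instance Definition _ := [isSub for occ].
HB.instance Definition _ := [Choice of conf by <:].

Lemma conf_eq (c d : conf) : (forall r k, c r k = d r k) -> c = d.
Proof. by move=> h; apply: val_inj; apply/funext => r; apply/funext => k. Qed.

Lemma occ_ferm (c : conf) r k : ferm r -> (c r k <= 1)%N.
Proof. by case: c => c /= /asboolP; apply. Qed.

(** The truncation makes [upd] total; wherever an oscillator has a nonzero coefficient the new value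
    is admissible and nothing is cut off. *)
Definition clip (r : halfZ) (x : nat) := if ferm r then minn x 1 else x.

Lemma upd_subproof (c : conf) (m : mode) (x : nat) :
  {d : conf | forall r k, d r k = if (r, k) == m then clip r x else c r k}.
Proof.
suff h : `[< forall r k, ferm r ->
    ((if (r, k) == m then clip r x else c r k) <= 1)%N >] by exists (Conf h).
apply/asboolP => r k fr; case: ifP => _; last exact: occ_ferm.
by rewrite /clip fr geq_minr.
Qed.
Definition upd (c : conf) (m : mode) (x : nat) : conf := sval (upd_subproof c m x).

Lemma updE c m x r k :
  upd c m x r k = if (r, k) == m then clip r x else c r k.
Proof. exact: svalP (upd_subproof c m x) r k. Qed.

Lemma clip_occ (c : conf) r k : clip r (c r k) = c r k.
Proof. by rewrite /clip; case: ifP => // fr; apply/minn_idPl/occ_ferm. Qed.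

Lemma upd_id c (m : mode) : upd c m (c m.1 m.2) = c.
Proof.
apply: conf_eq => r k; rewrite updE; case: eqP => // <-; exact: clip_occ.
Qed.

Lemma upd_upd c m x y : upd (upd c m x) m y = upd c m y.
Proof. by apply: conf_eq => r k; rewrite !updE; case: eqP. Qed.

Lemma upd_comm c m m' x y : m != m' ->
  upd (upd c m x) m' y = upd (upd c m' y) m x.
Proof.
move=> ne; apply: conf_eq => r k; rewrite !updE.
by case: (altP (_ =P m')) => // ->; rewrite eq_sym (negbTE ne).
Qed.

Lemma upd_occ c (m : mode) x : upd c m x m.1 m.2 = clip m.1 x.
Proof. by rewrite updE; case: m => r k; rewrite eqxx. Qed.

Lemma upd_occ_neq c (m m' : mode) x : m' != m -> upd c m x m'.1 m'.2 = c m'.1 m'.2.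
Proof. by rewrite updE; case: m' => r k /= /negbTE ->. Qed.

(** [b = true] is creation: the value at [c] is read off the configuration with
    one particle less. *)
Definition osc_shift (b : bool) (c : conf) (m : mode) : conf :=
  upd c m (if b then (c m.1 m.2).-1 else (c m.1 m.2).+1).

(** The square of the matrix coefficient. It vanishes exactly where [osc_shift] is not invertible:
    creation read at an empty mode, annihilation read at a filled fermion. *)
Definition osc_weight (b : bool) (c : conf) (m : mode) : nat :=
  if b then c m.1 m.2
  else (if ferm m.1 then 1 - c m.1 m.2 else (c m.1 m.2).+1)%N.

Definition fcount (c : conf) (N : nat) : nat :=
  (\sum_(q < N) oapp (fun m : mode => if ferm m.1 then c m.1 m.2 else 0)
                     0 (pickle_inv q))%N.

(* The order of the Jordan-Wigner sign is that of [pickle]: every mode has only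
   finitely many predecessors, so no support condition is needed. *)
Definition jw (c : conf) (m : mode) : C :=
  if ferm m.1 then (-1) ^+ fcount c (choice.pickle m) else 1.

(* No finiteness is imposed: the operators below read off each value from finitely
   many values of [f], so they act on arbitrary functions. *)
Definition fock := conf -> C.
HB.instance Definition _ := GRing.Lmodule.on fock.

(* With the square root, creation and annihilation are adjoint for [dot]. *)
Definition osc (b : bool) (m : mode) (f : fock) : fock :=
  fun c => jw c m * sqrtC (osc_weight b c m)%:R * f (osc_shift b c m).

Lemma osc_linear b m : linear (osc b m).
Proof.
move=> a f g; apply/funext => c; rewrite /osc /=.
have -> : (a *: f + g) (osc_shift b c m) = a * f (osc_shift b c m) + g (osc_shift b c m) by [].
by rewrite mulrDr mulrCA.
Qed.
HB.instance Definition _ b m := GRing.isLinear.Build C fock fock *:%R (osc b m)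
  (osc_linear b m).

Lemma osc_weight_ferm (b : bool) c m : ferm m.1 ->
  osc_weight b c m = (if b then c m.1 m.2 else 1 - c m.1 m.2)%N.
Proof. by rewrite /osc_weight => ->. Qed.

Lemma osc_shift_occ b c m m' : osc_weight b c m != 0%N ->
  osc_shift b c m m'.1 m'.2 = if m' == m then (if b then (c m.1 m.2).-1 else (c m.1 m.2).+1)
               else c m'.1 m'.2.
Proof.
move=> hk; rewrite /osc_shift updE; case: m' => r k /=; case: eqP => [em|] //=.
move: hk; rewrite -em /=.
rewrite /osc_weight /clip; case: b => //=; case: ifP => //= fr.
  by have := occ_ferm c k fr; case: (c r k) => [|[]].
by have := occ_ferm c k fr; case: (c r k) => [|[]].
Qed.

Lemma osc_weight_osc_shift_neq b b' c m m' : m' != m -> osc_weight b (osc_shift b' c m) m' = osc_weight b c m'.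
Proof. by move=> ne; rewrite /osc_weight /osc_shift !upd_occ_neq. Qed.

Lemma osc_shift_osc_shift b b' c m m' : m != m' -> osc_shift b (osc_shift b' c m) m' = osc_shift b' (osc_shift b c m') m.
Proof.
move=> ne; have ne' : m' != m by rewrite eq_sym.
by rewrite /osc_shift (upd_occ_neq _ _ ne) (upd_occ_neq _ _ ne') upd_comm.
Qed.

Lemma fcount_upd c m x N : (ferm m.1 -> N <= choice.pickle m)%N ->
  fcount (upd c m x) N = fcount c N.
Proof.
move=> hN; apply: eq_bigr => q _; have := ltn_ord q.
case E: (pickle_inv _) => [m'|] //= hq; case: ifP => // fm'.
rewrite upd_occ_neq //; apply/eqP => em.
have := @pickle_invK mode q; rewrite E /= em => eq_q; rewrite em in fm'.
by move: (hN fm'); rewrite eq_q leqNgt hq.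
Qed.

Lemma fcountE c m N : ferm m.1 -> (choice.pickle m < N)%N ->
  fcount c N = (c m.1 m.2 + fcount (upd c m 0) N)%N.
Proof.
move=> fm hN; rewrite /fcount (bigD1 (Ordinal hN)) //= pickleK_inv /= fm.
congr (_ + _)%N; rewrite [RHS](bigD1 (Ordinal hN)) //= pickleK_inv /= fm.
rewrite upd_occ /clip fm add0n; apply: eq_bigr => q nq.
case E: (pickle_inv _) => [m'|] //=; case: ifP => // fm'.
rewrite upd_occ_neq //; apply: contraNneq nq => em.
have := @pickle_invK mode q; rewrite E /= em => eq_q.
by apply/eqP/val_inj.
Qed.

Lemma osc_shift_fcount b c m N : ferm m.1 -> (choice.pickle m < N)%N -> osc_weight b c m != 0%N ->
  odd (fcount (osc_shift b c m) N) = ~~ odd (fcount c N).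
Proof.
move=> fm hN hk; rewrite (fcountE (osc_shift b c m) fm hN) (fcountE c fm hN).
rewrite {2}/osc_shift upd_upd !oddD osc_shift_occ // eqxx.
have := occ_ferm c m.2 fm; move: hk; rewrite osc_weight_ferm //.
by case: b; case: (c m.1 m.2) => [|[|]] //= _ _; case: odd.
Qed.

(** Only a fermion strictly earlier for [pickle] changes the parity counted at [m']. Of two distinct
    fermions exactly one is earlier, which produces the single sign of [osc_osc]. *)
Lemma jw_osc_shift b c m m' : osc_weight b c m != 0%N ->
  jw (osc_shift b c m) m' =
  (-1) ^+ [&& ferm m.1, ferm m'.1 & (choice.pickle m < choice.pickle m')%N] * jw c m'.
Proof.
move=> hk; rewrite /jw; case fm': (ferm m'.1); rewrite /= ?andbF ?mul1r //.
have [/andP[fm lt]|h] := boolP (ferm m.1 && _).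
  by rewrite -signr_odd osc_shift_fcount // signrN mulN1r signr_odd.
rewrite mul1r fcount_upd // => fm.
by move: h; rewrite fm /= -leqNgt.
Qed.

Definition sgm (m m' : mode) : C := (-1) ^+ (ferm m.1 && ferm m'.1).

Lemma sgmC m m' : sgm m m' = sgm m' m.
Proof. by rewrite /sgm andbC. Qed.

Lemma sgm2 m m' : sgm m m' * sgm m m' = 1.
Proof. by rewrite -signr_addb addbb. Qed.

Lemma osc_osc b b' m m' f : m != m' ->
  osc b m (osc b' m' f) = sgm m m' *: osc b' m' (osc b m f).
Proof.
move=> ne; apply/funext => c; rewrite /osc.
have -> (a : C) (g : fock) : (a *: g) c = a * g c by [].
rewrite !osc_weight_osc_shift_neq // 1?eq_sym // osc_shift_osc_shift //.
have [k0|k0] := eqVneq (osc_weight b c m) 0%N; first by rewrite k0 sqrtC0; ring.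
have [k1|k1] := eqVneq (osc_weight b' c m') 0%N; first by rewrite k1 sqrtC0; ring.
rewrite !jw_osc_shift // /sgm.
case fm: (ferm m.1); case fm': (ferm m'.1); rewrite /= ?expr0; try ring.
have : choice.pickle m != choice.pickle m' by apply: contra_neq ne => /(pcan_inj pickleK_inv).
by case: ltngtP => //= _ _; rewrite ?expr0 ?expr1; ring.
Qed.

Lemma jw2 c m : jw c m * jw c m = 1.
Proof. by rewrite /jw; case: ifP => _; rewrite ?mulr1 // -signr_odd -expr2 sqrr_sign. Qed.

Lemma jw_osc_shift_same b c m : jw (osc_shift b c m) m = jw c m.
Proof. by rewrite /jw; case: ifP => // fm; rewrite fcount_upd. Qed.

Lemma kapC_osc_shift (b : bool) (c : conf) m :
  osc_weight b c m != 0%N -> osc_weight (~~ b) (osc_shift b c m) m = osc_weight b c m.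
Proof.
move=> hk; rewrite {1}/osc_weight osc_shift_occ // eqxx; move: hk; rewrite /osc_weight; case: b => /=.
  by case fm: (ferm m.1) => //; [have := occ_ferm c m.2 fm|];
    case: (c m.1 m.2) => [|[]].
case fm: (ferm m.1) => //; have := occ_ferm c m.2 fm.
by case: (c m.1 m.2) => [|[]].
Qed.

Lemma osc_shiftK (b : bool) (c : conf) m : osc_weight b c m != 0%N -> osc_shift (~~ b) (osc_shift b c m) m = c.
Proof.
move=> hk; rewrite /osc_shift upd_upd -[RHS](upd_id c m); congr upd.
have := osc_shift_occ m hk; rewrite /osc_shift eqxx => ->.
by move: hk; rewrite /osc_weight; case: b => //=; case: (c m.1 m.2).
Qed.

Lemma oscN (b : bool) m f :
  osc b m (osc (~~ b) m f) = (fun c => (osc_weight b c m)%:R * f c) :> fock.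
Proof.
apply/funext => c; rewrite /osc.
have [k0|k0] := eqVneq (osc_weight b c m) 0%N; first by rewrite k0 sqrtC0; ring.
rewrite jw_osc_shift_same kapC_osc_shift // osc_shiftK //.
rewrite [LHS](_ : _ = jw c m * jw c m * (sqrtC (osc_weight b c m)%:R ^+ 2) * f c); last by ring.
by rewrite jw2 sqrtCK mul1r.
Qed.

Lemma osc_ferm0 (b : bool) m f : ferm m.1 -> osc b m (osc b m f) = 0.
Proof.
move=> fm; apply/funext => c; rewrite /osc.
have [k0|k0] := eqVneq (osc_weight b c m) 0%N; first by rewrite k0 sqrtC0 !(mulr0, mul0r).
suff -> : osc_weight b (osc_shift b c m) m = 0%N by rewrite sqrtC0 !(mulr0, mul0r).
rewrite osc_weight_ferm // osc_shift_occ // eqxx; move: k0; rewrite osc_weight_ferm //.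
by have := occ_ferm c m.2 fm; case: b; case: (c m.1 m.2) => [|[]].
Qed.

Lemma osc_same b m f : osc b m (osc b m f) = sgm m m *: osc b m (osc b m f).
Proof.
rewrite /sgm andbb; case fm: (ferm m.1); last by rewrite expr0 scale1r.
by rewrite osc_ferm0 // scaler0.
Qed.

Lemma osc_ccr m f :
  osc false m (osc true m f) = sgm m m *: osc true m (osc false m f) + f.
Proof.
rewrite (oscN false) (oscN true) /=; apply/funext => c.
have -> (a : C) (g h : fock) : (a *: g + h) c = a * g c + h c by [].
rewrite /sgm andbb /osc_weight; case fm: (ferm m.1).
  have := occ_ferm c m.2 fm; case: (c m.1 m.2) => [|[]] //= _.
  - by rewrite expr1 !mul0r mulr0 add0r mul1r.
  - by rewrite expr1 mul0r mul1r mulN1r addNr.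
by rewrite expr0 mul1r -natr1 mulrDl mul1r.
Qed.

(** The creation and annihilation parts are exchanged on the negative half; the
    sign makes the (anti)commutation relations uniform. *)
Definition eps (r : halfZ) : C := (-1) ^+ hodd r.

Definition psip (m : mode) (f : fock) : fock :=
  if 0 < m.1 then osc true m f else eps m.1 *: osc false m f.
Definition psim (m : mode) (f : fock) : fock := osc (m.1 <= 0) m f.

Lemma psip_linear m : linear (psip m).
Proof.
move=> a f g; rewrite /psip; case: ifP => _; first exact: linearP.
by rewrite linearP scalerDr !scalerA mulrC.
Qed.
HB.instance Definition _ m := GRing.isLinear.Build C fock fock *:%R (psip m)
  (psip_linear m).
Lemma psim_linear m : linear (psim m).
Proof. by move=> a f g; rewrite /psim linearP. Qed.
HB.instance Definition _ m := GRing.isLinear.Build C fock fock *:%R (psim m)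
  (psim_linear m).

Lemma eps2 r : eps r * eps r = 1.
Proof. by rewrite -expr2 sqrr_sign. Qed.

Lemma psip_osc m f : psip m f =
  (if 0 < m.1 then 1 else eps m.1) *: osc (0 < m.1) m f.
Proof. by rewrite /psip; case: ifP => // _; rewrite scale1r. Qed.

Lemma psip_psip m m' f : psip m (psip m' f) = sgm m m' *: psip m' (psip m f).
Proof.
have [<-|ne] := eqVneq m m'.
  by rewrite !psip_osc !linearZ /= [in LHS]osc_same !scalerA; congr (_ *: _); ring.
by rewrite !psip_osc !linearZ /= [in LHS]osc_osc // !scalerA; congr (_ *: _); ring.
Qed.

Lemma psim_psim m m' f : psim m (psim m' f) = sgm m m' *: psim m' (psim m f).
Proof.
rewrite /psim; have [<-|ne] := eqVneq m m'; first exact: osc_same.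
exact: osc_osc.
Qed.

Lemma psim_psip m m' f : psim m (psip m' f) =
  sgm m m' *: psip m' (psim m f) + (m == m')%:R *: f.
Proof.
have [<-|ne] := eqVneq m m'; last first.
  by rewrite !psip_osc /psim !linearZ /= osc_osc // scale0r addr0 !scalerA mulrC.
rewrite scale1r /psip /psim; case: ltP => h; first exact: osc_ccr.
rewrite linearZ /= osc_ccr scalerDr.
rewrite !scalerA /sgm andbb /eps /ferm.
case: hodd; rewrite /= ?expr0 ?expr1 !(mulr1, mul1r, mulrNN) ?scale1r //.
  by rewrite !scaleN1r addrNK.
by rewrite scalerDr scalerA mulrNN mulr1 scale1r scaleN1r addrNK.
Qed.
End Fock.

(** * Quadratic elements and the charges they move *)

Section Bilinear.
Variables (R : realType) (n : nat).
Local Notation C := R[i].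
Local Notation fock := (fock R n).
Local Notation conf := (conf n).
Local Notation mode := (mode n).

Lemma fockE (a : C) (f g : fock) c : (a *: f + g) c = a * f c + g c.
Proof. by []. Qed.
Lemma fockZ (a : C) (f : fock) c : (a *: f) c = a * f c.
Proof. by []. Qed.
Lemma fockD (f g : fock) c : (f + g) c = f c + g c.
Proof. by []. Qed.
Lemma fockN (f : fock) c : (- f) c = - f c.
Proof. by []. Qed.
Lemma fock0 c : (0 : fock) c = 0.
Proof. by []. Qed.
Lemma fock_sum I (s : seq I) (P : pred I) (F : I -> fock) c :
  (\sum_(i <- s | P i) F i) c = \sum_(i <- s | P i) F i c.
Proof. by elim/big_rec2: _ => [|i y1 y2 _ <-]. Qed.

(* Particles at nonpositive indices are antiparticles and count negatively. *)
Definition charge (c : conf) (r : halfZ) (k : 'I_n) : int :=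
  if 0 < r then (c r k)%:Z else - (c r k)%:Z.

Lemma charge_inj c c' : (forall r k, charge c r k = charge c' r k) -> c = c'.
Proof.
move=> h; apply: conf_eq => r k; have := h r k; rewrite /charge.
by case: ifP => _ => [[]|/oppr_inj[]].
Qed.

Definition shifts (c c' : conf) (m : mode) (z : int) :=
  forall r k, charge c r k = charge c' r k + (if (r, k) == m then z else 0).

Lemma osc_val (b : bool) m (c c' : conf) :
  (forall r k, (c r k : int) =
     (c' r k)%:Z + (if (r, k) == m then (if b then 1 else -1) else 0)) ->
  exists2 x : C, x != 0 & forall f : fock, osc b m f c = x * f c'.
Proof.
case: m => r0 k0 h; have := h r0 k0; rewrite eqxx => h0.
have hk : osc_weight b c (r0, k0) != 0%N.
  rewrite /osc_weight /=; case: b h h0 => h h0; first by lia.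
  case fr: (ferm r0) => //; have := occ_ferm c' k0 fr; lia.
have -> : c' = osc_shift b c (r0, k0).
  apply: conf_eq => r k; have /= := osc_shift_occ (r, k) hk => ->.
  by have := h r k; case: eqP => [[-> ->]|_]; case: b h h0 hk => /= *; lia.
exists (jw R c (r0, k0) * sqrtC (osc_weight b c (r0, k0))%:R) => [|f //].
rewrite mulf_neq0 // ?sqrtC_eq0 ?pnatr_eq0 //.
by have := jw2 R c (r0, k0); case: eqP => // ->; rewrite mul0r => /eqP; rewrite eq_sym oner_eq0.
Qed.

Lemma osc_supp (b : bool) m (f : fock) c : osc b m f c != 0 ->
  exists2 c', f c' != 0 & forall r k, (c r k : int) =
     (c' r k)%:Z + (if (r, k) == m then (if b then 1 else -1) else 0).
Proof.
rewrite /osc mulf_eq0 negb_or mulf_eq0 negb_or sqrtC_eq0 pnatr_eq0.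
move=> /andP[/andP[_ hk] hf]; exists (osc_shift b c m) => // r k.
have /= := osc_shift_occ (r, k) hk => ->; case: eqP => [em|_]; last by rewrite addr0.
move: hk; rewrite /osc_weight -em /=; case: b {hf}; lia.
Qed.

Lemma psip_val m c c' : shifts c c' m 1 ->
  exists2 x : C, x != 0 & forall f : fock, psip m f c = x * f c'.
Proof.
case: m => r0 k0 h; rewrite /psip /=.
have [|x x0 hx] := @osc_val (0 < r0) (r0, k0) c c'.
  move=> r k; have := h r k; rewrite /charge; case: eqP => [[-> _]|_].
    by case: ifP; lia.
  by case: ifP; lia.
case: (0 < r0) hx => hx; first by exists x.
exists (eps R r0 * x) => [|f]; last by rewrite fockZ hx mulrA.
by rewrite mulf_neq0 // signr_eq0.
Qed.

Lemma psim_val m c c' : shifts c c' m (-1) ->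
  exists2 x : C, x != 0 & forall f : fock, psim m f c = x * f c'.
Proof.
case: m => r0 k0 h; apply: osc_val => r k; have /= := h r k; rewrite /charge.
by case: eqP => [[-> _]|_]; do ?case: ifP; lia.
Qed.

Lemma psip_supp m (f : fock) c : psip m f c != 0 ->
  exists2 c', f c' != 0 & shifts c c' m 1.
Proof.
case: m => r0 k0; rewrite psip_osc fockZ mulf_eq0 negb_or => /andP[_].
case/osc_supp => c' fc' h; exists c' => // r k.
have := h r k; rewrite /charge; case: eqP => [[-> _]|_]; last by case: ifP; lia.
by case: ifP => /=; lia.
Qed.

Lemma psim_supp m (f : fock) c : psim m f c != 0 ->
  exists2 c', f c' != 0 & shifts c c' m (-1).
Proof.
case: m => r0 k0; case/osc_supp => c' fc' h; exists c' => // r k.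
have := h r k; rewrite /charge /=; case: eqP => [[-> _]|_]; last by case: ifP; lia.
by do ?case: ifP => /=; lia.
Qed.

Definition X (m m' : mode) (f : fock) : fock := psip m (psim m' f).

Lemma X_linear m m' : linear (X m m').
Proof. by move=> a f g; rewrite /X !linearP. Qed.
HB.instance Definition _ m m' := GRing.isLinear.Build C fock fock *:%R (X m m')
  (X_linear m m').

Definition moved (c c' : conf) (m m' : mode) :=
  forall r k, charge c r k = charge c' r k + ((r, k) == m)%:Z - ((r, k) == m')%:Z.

Lemma X_supp m m' f c : X m m' f c != 0 ->
  exists2 c', f c' != 0 & moved c c' m m'.
Proof.
case/psip_supp => c1 /psim_supp[c2 f2 h2] h1; exists c2 => // r k.
by have := h1 r k; have := h2 r k; do 2![case: ifP => _]; lia.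
Qed.

(** Arguments about supports only use that the coefficient is nonzero, so its sign and square roots
    stay hidden in [x]. *)
Lemma X_val m m' c c' : m != m' -> moved c c' m m' ->
  exists2 x : C, x != 0 & forall f : fock, X m m' f c = x * f c'.
Proof.
case: m m' => r1 k1 [r2 k2] ne h.
have h1 := h r1 k1; have h2 := h r2 k2.
have ne' : ((r2, k2) == (r1, k1)) = false by rewrite eq_sym; exact/negbTE.
(* The configuration between [psim m'] and [psip m]: the unit of charge at [m] is undone, which
   means one particle less at a positive index and one antiparticle more otherwise. *)
pose b := 0 < r1; pose c1 := upd c (r1, k1) (if b then (c r1 k1).-1 else (c r1 k1).+1).
have s1 : shifts c c1 (r1, k1) 1.
  move=> r k; rewrite /c1 /charge updE; case: eqP => [[-> ->]|_]; last by lia.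
  move: h1; rewrite /charge /clip eqxx (negbTE ne) /b; case: ifP => h0 h1.
    by case: ifP => fr; [have := occ_ferm c k1 fr|]; lia.
  by case: ifP => fr; [have := occ_ferm c' k1 fr|]; lia.
have s2 : shifts c1 c' (r2, k2) (-1).
  move=> r k; have := h r k; rewrite (s1 r k).
  by do 2![case: ifP => _]; lia.
have [x x0 hx] := psip_val s1; have [y y0 hy] := psim_val s2.
exists (x * y) => [|f]; first exact: mulf_neq0.
by rewrite /X hx hy mulrA.
Qed.

(** The Koszul sign for exchanging [X i j] with [X k l], one factor for each pair that is
    crossed. *)
Definition sg4 (i j k l : mode) : C := sgm R i k * sgm R i l * sgm R j k * sgm R j l.

Lemma X_X i j k l f : X i j (X k l f) =
  sg4 i j k l *: X k l (X i j f) + (j == k)%:R *: X i l f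
  - (sg4 i j k l * (l == i)%:R) *: X k j f.
Proof.
rewrite /X (psim_psip j k) (psim_psip l i) !linearD !linearZ /=.
rewrite ?scalerDr !scalerA scalerN.
rewrite [(l == i)%:R * _]mulrC [in RHS]addrAC addrK; congr (_ + _).
rewrite psip_psip (psim_psim j l) !linearZ /= !scalerA.
congr (_ *: _); rewrite /sg4 (sgmC _ l i).
rewrite [RHS](_ : _ = sgm R i k * sgm R j k * sgm R j l * (sgm R i l * sgm R i l)); last by ring.
by rewrite sgm2; ring.
Qed.

(** At a nonpositive index [psip] annihilates and [psim] creates, so the product is not normally
    ordered; [eps] is its value on the vacuum. *)
Lemma X_diag m f : X m m f =
  (fun c => ((charge c m.1 m.2)%:~R + (if m.1 <= 0 then eps R m.1 else 0)) * f c) :> fock.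
Proof.
apply/funext => c; case: m => r k; rewrite /X /psip /psim /charge /=.
have [h|h] := ltP 0 r.
  by rewrite (oscN true) addr0.
rewrite fockZ (oscN false) /osc_weight /= /eps /ferm.
case: (boolP (hodd r)) => fr /=; rewrite ?expr0 ?expr1 mulrA; congr (_ * _).
  by rewrite -natr1 mulN1r opprD rmorphN.
have := occ_ferm c k (fr : ferm r).
by case: (c r k) => [|[]] //= _; rewrite mul1r ?subr0 ?add0r // rmorphN /= addrC subrr.
Qed.
End Bilinear.

(** * The Hermitian form and adjoints *)

Section Form.
Variables (R : realType) (n : nat).
Local Notation C := R[i].
Local Notation fock := (fock R n).
Local Notation conf := (conf n).
Local Notation mode := (mode n).

Definition fin (f : fock) := exists A : {fset conf}, forall c, f c != 0 -> c \in A.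

Lemma fin0 : fin 0.
Proof. by exists fset0 => c; rewrite fock0 eqxx. Qed.

Lemma finP a f g : fin f -> fin g -> fin (a *: f + g).
Proof.
move=> [A hA] [B hB]; exists (A `|` B)%fset => c; rewrite inE fockE.
apply: contraNT; rewrite negb_or => /andP[cA cB].
move/contraNeq: (hA c) => /(_ cA) ->; move/contraNeq: (hB c) => /(_ cB) ->.
by rewrite mulr0 addr0.
Qed.

Lemma finZ a f : fin f -> fin (a *: f).
Proof. by move=> h; rewrite -[_ *: _]addr0; apply: finP h fin0. Qed.

Lemma finD f g : fin f -> fin g -> fin (f + g).
Proof. by move=> hf hg; rewrite -[f]scale1r; apply: finP. Qed.

Lemma fin_sum I (s : seq I) (P : pred I) (F : I -> fock) :
  (forall i, P i -> fin (F i)) -> fin (\sum_(i <- s | P i) F i).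
Proof. by move=> h; elim/big_ind: _ => //; [exact: fin0|exact: finD]. Qed.

Lemma fin_osc b m f : fin f -> fin (osc b m f).
Proof.
move=> [A hA]; exists [fset osc_shift (~~ b) c m | c in A]%fset => c; rewrite /osc.
rewrite mulf_eq0 negb_or mulf_eq0 negb_or sqrtC_eq0 pnatr_eq0.
move=> /andP[/andP[_ hk] hf]; apply/imfsetP; exists (osc_shift b c m); first exact: hA.
by rewrite osc_shiftK.
Qed.

Lemma fin_X m m' f : fin f -> fin (X m m' f).
Proof. by move=> h; rewrite /X psip_osc; apply/finZ/fin_osc/fin_osc. Qed.

Lemma fin_restrict (f : fock) (P : conf -> bool) : fin f ->
  fin (fun c => if P c then f c else 0).
Proof. by move=> [A hA]; exists A => c; case: ifP => [_ /hA|]; rewrite ?eqxx. Qed.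

Definition dot (f g : fock) : C := \sum_(c \in [set: conf]) (f c * (g c)^*).

Lemma dotE (A : {fset conf}) f g : (forall c, f c != 0 -> c \in A) ->
  dot f g = \sum_(c <- A) f c * (g c)^*.
Proof.
move=> hA; apply: fsbigTE => c; move/contraNeq: (hA c) => h /h ->.
by rewrite mul0r.
Qed.

Lemma dotC f g : fin f -> fin g -> dot g f = (dot f g)^*.
Proof.
move=> [A hA] [B hB].
have hAB c : f c != 0 -> c \in (A `|` B)%fset by rewrite inE => /hA ->.
have hBA c : g c != 0 -> c \in (A `|` B)%fset by rewrite inE orbC => /hB ->.
rewrite (dotE _ hAB) (dotE _ hBA) rmorph_sum /=; apply: eq_bigr => c _.
by rewrite rmorphM /= conjCK mulrC.
Qed.

Lemma dotl a f g h : fin f -> fin g -> dot (a *: f + g) h = a * dot f h + dot g h.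
Proof.
move=> [A hA] [B hB].
have hAB c : f c != 0 -> c \in (A `|` B)%fset by rewrite inE => /hA ->.
have hBA c : g c != 0 -> c \in (A `|` B)%fset by rewrite inE orbC => /hB ->.
rewrite (dotE _ hAB) (dotE _ hBA) (dotE (A := A `|` B)%fset); last first.
  move=> c; apply: contraNT => cAB; rewrite fockE.
  move/contraNeq: (hAB c) => /(_ cAB) ->; move/contraNeq: (hBA c) => /(_ cAB) ->.
  by rewrite mulr0 addr0.
rewrite mulr_sumr -big_split /=; apply: eq_bigr => c _.
by rewrite fockE mulrDl mulrA.
Qed.

Lemma dotZl a f h : dot (a *: f) h = a * dot f h.
Proof. by rewrite /dot mulr_fsumr; apply: eq_fsbigr => c _; rewrite fockZ mulrA. Qed.

Lemma dotZr a f h : dot f (a *: h) = a^* * dot f h.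
Proof.
by rewrite /dot mulr_fsumr; apply: eq_fsbigr => c _; rewrite fockZ rmorphM /=; ring.
Qed.

Lemma dot0r f : dot f 0 = 0.
Proof. by rewrite /dot fsbig1 // => c _; rewrite fock0 conjC0 mulr0. Qed.
Lemma dot0l f : dot 0 f = 0.
Proof. by rewrite /dot fsbig1 // => c _; rewrite fock0 mul0r. Qed.

Lemma dot_suml I (s : seq I) (F : I -> fock) h : (forall i, fin (F i)) ->
  dot (\sum_(i <- s) F i) h = \sum_(i <- s) dot (F i) h.
Proof.
move=> hF; elim: s => [|i s IH]; first by rewrite !big_nil dot0l.
rewrite !big_cons -[F i]scale1r dotl //; last exact: fin_sum.
by rewrite IH scale1r mul1r.
Qed.

Lemma dot_sumr I (s : seq I) (F : I -> fock) h : fin h -> (forall i, fin (F i)) ->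
  dot h (\sum_(i <- s) F i) = \sum_(i <- s) dot h (F i).
Proof.
move=> hh hF; rewrite dotC //; last exact: fin_sum.
rewrite dot_suml // rmorph_sum /=; apply: eq_bigr => i _.
by rewrite [RHS]dotC.
Qed.

Lemma dot_ge0 f : 0 <= dot f f.
Proof. by apply: fsumr_ge0 => c _; apply: mul_conjC_ge0. Qed.

Lemma dot_eq0 f : fin f -> dot f f = 0 -> f = 0.
Proof.
move=> [A hA]; rewrite (dotE _ hA) => /eqP.
rewrite psumr_eq0 => [/allP h|c _]; last exact: mul_conjC_ge0.
apply/funext => c; apply/eqP; apply: contraT => fc; have := h c (hA c fc).
by rewrite /= mul_conjC_eq0 => /eqP fc0; rewrite fc0 fock0 eqxx in fc.
Qed.

Lemma jw_conj (c : conf) m : (jw R c m)^* = jw R c m.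
Proof. by rewrite /jw; case: ifP => _; rewrite ?rmorph1 // rmorphXn /= rmorphN1. Qed.

(** [osc_shift b] is a bijection from the configurations of nonzero weight for [b] to those for
    [~~ b]. It preserves the weight and the Jordan-Wigner sign, so reindexing along it exchanges the
    two sides. *)
Lemma dot_osc b m f g : dot (osc b m f) g = dot f (osc (~~ b) m g).
Proof.
pose K b := [set c : conf | osc_weight b c m != 0%N].
have kapN c b' : K b' c -> K (~~ b') (osc_shift b' c m) by rewrite /K /= => h; rewrite kapC_osc_shift.
rewrite {1}/dot -(@fsbig_widen _ _ _ _ (K b)) //; last first.
  move=> c [_] /negP; rewrite negbK => /eqP k0 /=; rewrite /osc k0 sqrtC0.
  by rewrite mulr0 !mul0r.
rewrite [RHS]/dot -[RHS](@fsbig_widen _ _ _ _ (K (~~ b))) //; last first.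
  move=> c [_] /negP; rewrite negbK => /eqP k0 /=; rewrite /osc k0 sqrtC0.
  by rewrite mulr0 !mul0r conjC0 mulr0.
rewrite [RHS](@reindex_fsbig _ _ _ _ _ (fun c => osc_shift b c m) (K b)); last first.
  split.
  - by move=> c; apply: kapN.
  - move=> c d; rewrite !inE => hc hd e.
    by rewrite -(osc_shiftK hc) -(osc_shiftK hd) e.
  - move=> c hc; exists (osc_shift (~~ b) c m); first by have := kapN _ _ hc; rewrite negbK.
    by have := osc_shiftK hc; rewrite negbK.
apply: eq_fsbigr => c; rewrite inE => hc; rewrite /osc jw_osc_shift_same kapC_osc_shift // osc_shiftK //.
rewrite !rmorphM /= jw_conj.
have -> : (sqrtC (osc_weight b c m)%:R)^* = sqrtC (osc_weight b c m)%:R :> C.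
  by apply/CrealP/ger0_real; rewrite sqrtC_ge0 ler0n.
by ring.
Qed.

(** The sign between [psip] and the adjoint of [psim]: it is -1 exactly at the nonpositive bosonic
    indices. *)
Definition ksgn (r : halfZ) : C := if 0 < r then 1 else eps R r.

Lemma ksgn_conj r : (ksgn r)^* = ksgn r.
Proof. by rewrite /ksgn; case: ifP => _; rewrite ?rmorph1 // /eps rmorphXn /= rmorphN1. Qed.

Lemma ksgn2 r : ksgn r * ksgn r = 1.
Proof. by rewrite /ksgn; case: ifP => _; rewrite ?mulr1 // eps2. Qed.

Lemma psip_psim m (f : fock) : psip m f = ksgn m.1 *: osc (0 < m.1) m f.
Proof. exact: psip_osc. Qed.

Lemma dot_X m m' f g :
  dot (X m m' f) g = ksgn m.1 * ksgn m'.1 * dot f (X m' m g).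
Proof.
rewrite /X !psip_psim /psim dotZl dot_osc dot_osc dotZr ksgn_conj.
by rewrite !leNgt negbK -!mulrA (mulrA (ksgn m'.1)) ksgn2 mul1r.
Qed.
End Form.

(** * The dual pair *)

Section GlOps.
Variables (R : realType) (n : nat).
Local Notation C := R[i].
Local Notation fock := (fock R n).
Local Notation conf := (conf n).

(** A product of two oscillators at the same index is even. *)
Lemma sg4_color r r' (k l p q : 'I_n) : sg4 R (r, k) (r, l) (r', p) (r', q) = 1.
Proof.
rewrite /sg4 /sgm /=; case: (_ && _); rewrite ?expr0 ?expr1; ring.
Qed.

Lemma sg4_index i j r (p k l : 'I_n) : sg4 R (r, k) (r, l) (i, p) (j, p) = 1.
Proof.
by rewrite /sg4 /sgm /=; do 2!case: (_ && _); rewrite ?expr0 ?expr1; ring.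
Qed.

(* The elementary matrix of index [(k, l)] of the gl_n acting on the colors, seen
   by the modes with index in [S] only. *)
Definition gl (S : seq halfZ) (k l : 'I_n) (f : fock) : fock :=
  \sum_(r <- S) X (r, k) (r, l) f.

Lemma gl_linear S k l : linear (gl S k l).
Proof.
move=> a f g; rewrite /gl scaler_sumr -big_split /=; apply: eq_bigr => r _.
exact: linearP.
Qed.
HB.instance Definition _ S k l := GRing.isLinear.Build C fock fock *:%R (gl S k l)
  (gl_linear S k l).

Lemma gl1 r k l f : gl [:: r] k l f = X (r, k) (r, l) f.
Proof. by rewrite /gl big_seq1. Qed.

Lemma gl_cat S S' k l f : gl (S ++ S') k l f = gl S k l f + gl S' k l f.
Proof. exact: big_cat. Qed.

(** The two lists may differ so that a single index can be separated from those before it; only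
    common indices contribute to the commutator. *)
Lemma gl_gl S S' k l k' l' f : uniq S ->
  gl S k l (gl S' k' l' f) = gl S' k' l' (gl S k l f) +
   ((l == k')%:R *: gl [seq r <- S' | r \in S] k l' f
    - (l' == k)%:R *: gl [seq r <- S' | r \in S] k' l f).
Proof.
move=> uS; rewrite /gl; under eq_bigr do rewrite linear_sum /=.
under [X in _ = X + _]eq_bigr do rewrite linear_sum /=.
rewrite exchange_big /= !big_filter !scaler_sumr -sumrB.
rewrite [X in _ = _ + X]big_mkcond -big_split /=; apply: eq_bigr => r' _.
under eq_bigr do rewrite X_X sg4_color !mul1r scale1r !xpair_eqE -addrA.
rewrite big_split /=; congr (_ + _); rewrite sumrB.
have [rS|rS] := ifPn; last first.
  rewrite !big_seq !big1 ?subrr // => r hr.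
    by case: eqP => [e|_]; [rewrite e hr in rS|rewrite scale0r].
  by case: eqP => [e|_]; [rewrite -e hr in rS|rewrite scale0r].
congr (_ - _); rewrite (bigD1_seq r') //= eqxx big1 ?addr0 // => r.
  by move=> /negbTE ->; exact: scale0r.
by rewrite eq_sym => /negbTE ->; exact: scale0r.
Qed.

Definition nu (S : seq halfZ) (k : 'I_n) (c : conf) : int := \sum_(r <- S) charge c r k.

Lemma nu_cat S S' k c : nu (S ++ S') k c = nu S k c + nu S' k c.
Proof. exact: big_cat. Qed.

(** The vacuum constants of [X_diag] depend on the index only and cancel in the difference, so a
    coroot needs no normal ordering. *)
Lemma gl_diag S k l (f : fock) :
  gl S k k f - gl S l l f = (fun c => (nu S k c - nu S l c)%:~R * f c) :> fock.
Proof.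
rewrite /gl -sumrB; apply/funext => c.
rewrite fock_sum /nu -sumrB rmorph_sum /= mulr_suml; apply: eq_bigr => r _.
rewrite fockD fockN !X_diag /=; case: ifP => _; rewrite rmorphB /=; ring.
Qed.

Lemma gl_supp S k l (f : fock) c : gl S k l f c != 0 ->
  exists2 r, r \in S & exists2 c', f c' != 0 & moved c c' (r, k) (r, l).
Proof.
rewrite /gl fock_sum => h.
have /hasP[r rS hr] : has (fun r => X (r, k) (r, l) f c != 0) S.
  apply: contraTT h => /hasPn h; rewrite negbK big_seq big1 // => r rS.
  by apply/eqP; rewrite -[_ == _]negbK h.
by exists r => //; apply: X_supp hr.
Qed.

Lemma moved_nu S c c' r k l j : moved c c' (r, k) (r, l) -> uniq S -> r \in S ->
  nu S j c = nu S j c' + (j == k)%:Z - (j == l)%:Z.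
Proof.
move=> h uS rS; rewrite /nu !(bigD1_seq r) //= h !xpair_eqE eqxx /=.
rewrite [X in _ + X = _](_ : _ = \sum_(i <- S | i != r) charge c' i j); last first.
  apply: eq_bigr => i /negbTE ne; rewrite h !xpair_eqE ne /=; lia.
ring.
Qed.

Lemma fin_gl S k l (f : fock) : fin f -> fin (gl S k l f).
Proof. by move=> h; apply: fin_sum => r _; apply: fin_X. Qed.

Lemma dot_gl S k l (f g : fock) : fin f -> fin g ->
  dot (gl S k l f) g = dot f (gl S l k g).
Proof.
move=> hf hg; rewrite /gl dot_suml => [|r]; last exact: fin_X.
rewrite dot_sumr // => [|r]; last exact: fin_X.
by apply: eq_bigr => r _; rewrite dot_X /= ksgn2 mul1r.
Qed.

(** * The sl_2-triples of two colors *)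

Section SL2.
Variables (S : seq halfZ) (k l : 'I_n).
Hypotheses (uS : uniq S) (nkl : k != l).
Local Notation E := (gl S k l).
Local Notation F := (gl S l k).

Lemma gl_EF (f : fock) :
  E (F f) = F (E f) + ((fun c => (nu S k c - nu S l c)%:~R * f c) : fock).
Proof.
rewrite gl_gl // -gl_diag !eqxx !scale1r.
by have -> : [seq r <- S | r \in S] = S by apply/all_filterP/allP.
Qed.

Variables (u : fock) (a : int).
Hypotheses (Eu : E u = 0) (fu : fin u)
  (wu : forall c, u c != 0 -> nu S k c - nu S l c = a).

Lemma wt_iterF j c : iter j F u c != 0 -> nu S k c - nu S l c = a - j%:Z * 2%:Z.
Proof.
elim: j c => [|j IH] c /=; first by move/wu; lia.
case/gl_supp => r rS [c' /IH h mv].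
rewrite !(moved_nu _ mv uS rS) !eqxx (negbTE nkl) eq_sym (negbTE nkl); lia.
Qed.

Lemma E_iterF j : E (iter j.+1 F u) = ((j.+1%:Z * (a - j%:Z))%:~R : C) *: iter j F u.
Proof.
elim: j => [|j IH].
  rewrite /= gl_EF Eu linear0 add0r; apply/funext => c; rewrite fockZ.
  have [->|uc] := eqVneq (u c) 0; first by rewrite !mulr0.
  by rewrite wu // mul1r subr0.
rewrite [iter j.+2 _ _]iterS gl_EF IH linearZ /= -iterS; apply/funext => c.
rewrite fockE fockZ; have [->|uc] := eqVneq (iter j.+1 F u c) 0; first by rewrite !mulr0 addr0.
rewrite (wt_iterF uc) -mulrDl; congr (_ * _); rewrite -rmorphD /=; congr (_%:~R); lia.
Qed.

Lemma fin_iterF j : fin (iter j F u).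
Proof. by elim: j => //= j IH; apply: fin_gl. Qed.

(** Since [E] and [F] are adjoint, the squared norm of [F u] is [a] times that of [u]. *)
Lemma singular_wt_ge0 : u != 0 -> 0 <= a.
Proof.
move=> u0; have h : dot (F u) (F u) = a%:~R * dot u u.
  rewrite dot_gl //; last exact: fin_gl.
  have /= -> := E_iterF 0; rewrite dotZr mul1r subr0; congr (_ * _); exact: rmorph_int.
have u2 : 0 < dot u u.
  by rewrite lt0r dot_ge0 andbT; apply: contra_neq u0; exact: dot_eq0.
by have := dot_ge0 (F u); rewrite h pmulr_lge0 // ler0z.
Qed.

(** For [a = b] the vector [F^(b+1) u] is killed by [E], hence orthogonal to the image of [F], in
    which it lies. *)
Lemma iterF_eq0 (b j : nat) : a = b%:Z -> (b < j)%N -> iter j F u = 0.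
Proof.
move=> ab bj; have h : iter b.+1 F u = 0.
  apply: dot_eq0; first exact: fin_iterF.
  rewrite [X in dot X _]iterS dot_gl; try exact: fin_iterF.
  by rewrite E_iterF ab subrr mulr0 scale0r dot0r.
have -> : j = (j - b.+1 + b.+1)%N by rewrite subnK.
rewrite iterD h; elim: (_ - _)%N => //= i ->; exact: linear0.
Qed.

Lemma dot_iter (j : nat) m : fin m -> dot u (iter j E m) = dot (iter j F u) m.
Proof.
elim: j m => // j IH m fm; rewrite iterSr IH; last exact: fin_gl.
by rewrite -dot_gl // ; exact: fin_iterF.
Qed.

(** The squared norm of [u = E^j m] is the pairing of [F^j u] with [m], and [F^j u] vanishes once
    [j] exceeds the weight. This inequality is the source of the horizontal strips. *)
Lemma singular_in_image (j : nat) m : fin m -> u = iter j E m -> u != 0 -> j%:Z <= a.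
Proof.
move=> fm e u0; have a0 := singular_wt_ge0 u0.
rewrite leNgt; apply/negP => ja.
have ab : a = `|a|%N%:Z by lia.
have bj : (`|a| < j)%N by lia.
move: u0; rewrite (dot_eq0 fu) ?eqxx // [X in dot _ X]e dot_iter //.
by rewrite (iterF_eq0 ab bj) dot0l.
Qed.
End SL2.

(** * The operators e_ij and their normal ordering *)

Definition Eh i j (f : fock) : fock := \sum_(p < n) X (i, p) (j, p) f.

Lemma Eh_linear i j : linear (Eh i j).
Proof.
move=> a f g; rewrite /Eh scaler_sumr -big_split /=; apply: eq_bigr => r _.
exact: linearP.
Qed.
HB.instance Definition _ i j := GRing.isLinear.Build C fock fock *:%R (Eh i j)
  (Eh_linear i j).

(** Both correction terms of the commutator collapse to [X (i, k) (j, l)], one because [i] lies in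
    [S] and the other because [j] does. *)
Lemma gl_Eh S k l i j (f : fock) : uniq S -> i \in S -> j \in S ->
  gl S k l (Eh i j f) = Eh i j (gl S k l f).
Proof.
move=> uS iS jS; rewrite /gl /Eh.
under eq_bigr do rewrite linear_sum /=.
under [RHS]eq_bigr do rewrite linear_sum /=.
rewrite [RHS]exchange_big /=; apply/eqP; rewrite -subr_eq0 -sumrB.
under eq_bigr do rewrite -sumrB.
rewrite [X in X == _](_ : _ = \sum_(r <- S) \sum_(p < n)
   (((r, l) == (i, p))%:R *: X (r, k) (j, p) f
      - ((j, p) == (r, k))%:R *: X (i, p) (r, l) f)); last first.
  apply: eq_bigr => r _; apply: eq_bigr => p _.
  by rewrite X_X sg4_index scale1r !mul1r addrC !addrA addNr add0r.
under eq_bigr do rewrite sumrB.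
rewrite sumrB subr_eq0; apply/eqP.
transitivity (X (i, k) (j, l) f).
  rewrite (bigD1_seq i) //= (bigD1 l) //= eqxx scale1r.
  rewrite !big1 ?addr0 //.
    move=> r /negbTE ne; rewrite big1 // => p _; rewrite xpair_eqE ne /=; exact: scale0r.
  by move=> p; rewrite xpair_eqE eq_sym => /negbTE ->; rewrite andbF scale0r.
rewrite (bigD1_seq j) //= (bigD1 k) //= eqxx scale1r.
rewrite !big1 ?addr0 //.
  move=> r; rewrite eq_sym => /negbTE ne; rewrite big1 // => p _.
  rewrite xpair_eqE ne /=; exact: scale0r.
by move=> p; rewrite xpair_eqE => /negbTE ->; rewrite andbF scale0r.
Qed.

Definition sgE (i j k l : halfZ) : C := (-1) ^+ (hodd (i - j) && hodd (k - l)).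

Lemma hoddD (a b : halfZ) : hodd (a - b) = hodd a (+) hodd b.
Proof. by rewrite /hodd; lia. Qed.

Lemma sg4E i j k l (p q : 'I_n) : sg4 R (i, p) (j, p) (k, q) (l, q) = sgE i j k l.
Proof.
rewrite /sg4 /sgm /sgE !hoddD /= /ferm.
by do 4!case: hodd; rewrite /= ?expr0 ?expr1; ring.
Qed.

Lemma Eh_Eh i j k l (f : fock) : Eh i j (Eh k l f) =
  sgE i j k l *: Eh k l (Eh i j f) + (j == k)%:R *: Eh i l f
  - (sgE i j k l * (l == i)%:R) *: Eh k j f.
Proof.
rewrite {1 2}/Eh.
under eq_bigr do rewrite linear_sum /=.
rewrite /Eh; under [X in _ = _ *: X + _ - _]eq_bigr do rewrite linear_sum /=.
rewrite [X in _ = _ *: X + _ - _]exchange_big /= !scaler_sumr -big_split -sumrB /=.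
apply: eq_bigr => p _.
under eq_bigr do rewrite X_X sg4E.
rewrite sumrB big_split /= -scaler_sumr.
rewrite [X in _ + X - _](bigD1 p) //= [X in _ + (_ + X) - _]big1 ?addr0; last first.
  move=> q; rewrite eq_sym xpair_eqE => /negbTE ->; rewrite andbF; exact: scale0r.
rewrite [X in _ - X](bigD1 p) //= [X in _ - (_ + X)]big1 ?addr0; last first.
  move=> q; rewrite xpair_eqE => /negbTE ->; rewrite andbF mulr0; exact: scale0r.
by rewrite !xpair_eqE eqxx !andbT.
Qed.

(* Normal ordering subtracts this vacuum expectation value. *)
Definition vac (i j : halfZ) : C := if (i == j) && (i <= 0) then eps R i * n%:R else 0.

Definition E i j (f : fock) : fock := Eh i j f - vac i j *: f.

Lemma E_linear i j : linear (E i j).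
Proof.
move=> a f g; rewrite /E linearP scalerDr scalerBr !scalerA [vac _ _ * a]mulrC.
by rewrite opprD addrACA.
Qed.
HB.instance Definition _ i j := GRing.isLinear.Build C fock fock *:%R (E i j)
  (E_linear i j).

Lemma gl_E S k l i j (f : fock) : uniq S -> i \in S -> j \in S ->
  gl S k l (E i j f) = E i j (gl S k l f).
Proof. by move=> uS iS jS; rewrite /E linearB linearZ /= gl_Eh. Qed.

Lemma fin_E i j (f : fock) : fin f -> fin (E i j f).
Proof.
move=> h; rewrite /E -scaleNr; apply: finD; last exact: finZ.
by apply: fin_sum => p _; apply: fin_X.
Qed.

Definition wt (r : halfZ) (c : conf) : int := \sum_(k < n) charge c r k.

Lemma E_diag i (f : fock) : E i i f = (fun c => (wt i c)%:~R * f c) :> fock.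
Proof.
apply/funext => c; rewrite /E /Eh fockD fockN fockZ fock_sum /wt rmorph_sum /=.
under eq_bigr do rewrite X_diag mulrDl.
have -> : vac i i = (if i <= 0 then eps R i else 0) *+ n.
  by rewrite /vac eqxx /=; case: ifP => _; rewrite ?mulr_natr ?mul0rn.
by rewrite big_split /= -mulr_suml sumr_const card_ord mulrnAl addrK.
Qed.

Lemma E_offdiag i j (f : fock) : i != j -> E i j f = Eh i j f.
Proof. by rewrite /E /vac => /negbTE ->; rewrite scale0r subr0. Qed.

Lemma E_supp i j (f : fock) c : E i j f c != 0 ->
  exists k, exists2 c', f c' != 0 & moved c c' (i, k) (j, k).
Proof.
have [<-|ne] := eqVneq i j.
  rewrite E_diag mulf_eq0 negb_or => /andP[hw fc].
  have [k hk] : exists k, charge c i k != 0.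
    apply/existsP; apply: contraNT hw; rewrite negb_exists => /forallP h.
    by rewrite /wt big1 // => k _; apply/eqP; rewrite -[_ == _]negbK h.
  by exists k, c => // r p; rewrite addrK.
rewrite E_offdiag // /Eh fock_sum => h.
have /existsP[k hk] : [exists k, X (i, k) (j, k) f c != 0].
  apply: contraNT h; rewrite negb_exists => /forallP h.
  by rewrite big1 // => k _; apply/eqP; rewrite -[_ == _]negbK h.
by exists k; apply: X_supp hk.
Qed.

Lemma moved_wt r c c' i j k : moved c c' (i, k) (j, k) ->
  wt r c = wt r c' + (r == i)%:Z - (r == j)%:Z.
Proof.
move=> h; rewrite /wt (bigD1 k) //= [in RHS](bigD1 k) //= h !xpair_eqE eqxx !andbT.
rewrite [X in _ + X = _](_ : _ = \sum_(p < n | p != k) charge c' r p); last first.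
  by apply: eq_bigr => p /negbTE ne; rewrite h !xpair_eqE ne !andbF addr0 subr0.
by ring.
Qed.

Lemma dot_E i j (f g : fock) : i != j -> fin f -> fin g ->
  dot (E i j f) g = ksgn R i * ksgn R j * dot f (E j i g).
Proof.
move=> ne hf hg; rewrite !E_offdiag // 1?eq_sym // /Eh.
rewrite dot_suml => [|r]; last exact: fin_X.
rewrite dot_sumr // => [|r]; last exact: fin_X.
by rewrite mulr_sumr; apply: eq_bigr => r _; rewrite dot_X.
Qed.

End GlOps.

(** * Singular vectors and good configurations *)

Section Leading.
Variables (R : realType) (n : nat).
Local Notation C := R[i].
Local Notation fock := (fock R n).
Local Notation conf := (conf n).

Lemma fset_min (T : choiceType) (A : {fset T}) (x0 : T) (F : T -> int) : x0 \in A ->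
  exists2 x, x \in A & forall y, y \in A -> F x <= F y.
Proof.
move=> x0A; case: (@arg_minP _ _ _ [` x0A]%fset xpredT (fun a => F (val a))) => // a _ h.
by exists (val a) => [|y yA]; [exact: valP|exact: h [` yA]%fset isT].
Qed.

(* Leading terms are those minimising [phi r] at the last index where it varies. *)
Definition phi (r : halfZ) (c : conf) : int := - \sum_(k < n) k%:Z * charge c r k.

(* From [v] to [v'] boxes are added if [0 < r] and removed if [r <= 0]; at a bosonic
   index they form a horizontal strip. *)
Definition step_ok (r : halfZ) (v v' : 'I_n -> int) :=
  forall k l : 'I_n, (k < l)%N ->
    v' l <= v' k /\ (hodd r -> if 0 < r then v' l <= v k else v l <= v' k).

Definition good_upto (xs : seq halfZ) (c : conf) :=
  forall ys r zs, xs = ys ++ r :: zs ->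
    step_ok r (fun k => nu ys k c) (fun k => nu (rcons ys r) k c).

Section Restrict.
Variable r : halfZ.
Implicit Type (g : 'I_n -> int) (f : fock).

Definition restr g f : fock := fun c => if [forall k, charge c r k == g k] then f c else 0.

Lemma restrP g f c : (forall k, charge c r k = g k) -> restr g f c = f c.
Proof. by move=> h; rewrite /restr ifT //; apply/forallP => k; rewrite h. Qed.

Lemma restr_neq g f c : restr g f c != 0 -> f c != 0 /\ forall k, charge c r k = g k.
Proof. by rewrite /restr; case: forallP => [h fc|]; [split=> // k; apply/eqP|rewrite eqxx]. Qed.

Lemma restr_supp_eq (T : fock -> fock) g g' f :
  linear T ->
  (forall (h : fock) c, T h c != 0 -> exists2 c', h c' != 0 &
     (forall k, charge c r k = g' k) <-> (forall k, charge c' r k = g k)) ->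
  T (restr g f) = restr g' (T f).
Proof.
move=> linT suppT; apply/funext => c; rewrite [RHS]/restr.
case: forallP => [h|h].
  have e : T f = T (restr g f) + T (f - restr g f).
    by have := linT 1 (f - restr g f) (restr g f); rewrite !scale1r subrK addrC.
  have [e0|] := eqVneq (T (f - restr g f) c) 0; first by rewrite e fockD e0 addr0.
  case/suppT => c' + [/(_ (fun k => eqP (h k))) hc' _].
  by rewrite fockD fockN restrP // subrr eqxx.
apply/eqP; apply: contraT => /suppT[c' /restr_neq[_ hc'] [_ /(_ hc') hg]].
by case: h => k; apply/eqP.
Qed.

Lemma restr_gl ys k l g f : r \notin ys ->
  gl ys k l (restr g f) = restr g (gl ys k l f).
Proof.
move=> ry; apply: restr_supp_eq => [|h c /gl_supp[r' r'y [c' hc' mv]]]; first exact: gl_linear.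
exists c' => //; have e j : charge c r j = charge c' r j.
  have ne : (r == r') = false by apply/negbTE; apply: contraNneq ry => ->.
  by rewrite mv !xpair_eqE ne /= addr0 subr0.
by split=> hh j; rewrite -?hh ?e.
Qed.

Lemma restr_X k l g f :
  X (r, k) (r, l) (restr g f) =
  restr (fun j => g j + (j == k)%:Z - (j == l)%:Z) (X (r, k) (r, l) f).
Proof.
apply: restr_supp_eq => [|h c /X_supp[c' hc' mv]]; first exact: X_linear.
exists c' => //; have e j : charge c r j = charge c' r j + (j == k)%:Z - (j == l)%:Z.
  by rewrite mv !xpair_eqE eqxx.
by split=> hh j; [move: (hh j); rewrite e => /addIr/addIr|rewrite e hh].
Qed.

Lemma fin_restr g f : fin f -> fin (restr g f).
Proof. exact: fin_restrict. Qed.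

Lemma X_glC ys k l f : r \notin ys -> uniq ys ->
  gl ys k l (X (r, k) (r, l) f) = X (r, k) (r, l) (gl ys k l f).
Proof.
move=> ry uy; rewrite -!gl1 gl_gl //= (negbTE ry) /gl !big_nil.
by rewrite !scaler0 subrr addr0.
Qed.

(** At a positive index particles move from color [l] to [k]; at a nonpositive one antiparticles
    move from [k] to [l]. Each target has a single source, so nothing cancels while any are left to
    move. *)
Lemma iterX_neq0 k l f c j : hodd r -> k != l -> f c != 0 ->
  (j <= (if (0 < r)%R then c r l else c r k))%N ->
  iter j (X (r, k) (r, l)) f != 0.
Proof.
move=> hr kl fc.
suff : (j <= (if (0 < r)%R then c r l else c r k))%N ->
    exists2 c', iter j (X (r, k) (r, l)) f c' != 0 &
      forall r' p, charge c' r' p = charge c r' p + (if (r', p) == (r, k) then j%:Z else 0)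
          - (if (r', p) == (r, l) then j%:Z else 0).
  move=> h /h[c' h' _]; apply: contraNneq h' => ->; by rewrite fock0.
have clipE x : clip r x = x by rewrite /clip /ferm hr.
elim: j => [_|j IH lej].
  by exists c => // r' p; do 2!case: ifP; rewrite addr0 subr0.
have [|c' hc' ec'] := IH; first exact: ltnW.
pose m1 : mode n := (r, k); pose m2 : mode n := (r, l).
have ne : m1 != m2 by rewrite xpair_eqE eqxx.
pose c2 := if (0 < r)%R then upd (upd c' m1 (c' r k).+1) m2 (c' r l).-1
  else upd (upd c' m1 (c' r k).-1) m2 (c' r l).+1.
have mv : moved c2 c' m1 m2.
  have ek := ec' r k; have el := ec' r l.
  have klf : ((r, k) == (r, l)) = false by apply/negbTE; rewrite xpair_eqE eqxx.
  have lkf : ((r, l) == (r, k)) = false by rewrite eq_sym.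
  rewrite !eqxx klf in ek; rewrite !eqxx lkf in el.
  move=> r' p; rewrite /c2 /m1 /m2 /charge.
  have [[-> ->]|n2] := eqVneq (r', p) (r, l).
    rewrite lkf; move: lej el; rewrite /charge; case: ifP => h0 lej el;
    rewrite updE eqxx clipE; lia.
  have [[-> ->]|n1] := eqVneq (r', p) (r, k).
    move: lej ek; rewrite /charge; case: ifP => h0 lej ek;
    rewrite !updE klf eqxx clipE; lia.
  by case: (0 < r); rewrite !updE (negbTE n1) (negbTE n2) addr0 subr0.
have [x x0 hx] := X_val R ne mv; exists c2.
  by rewrite /= hx mulf_neq0.
move=> r' p; rewrite mv ec' /m1 /m2; case: eqP => _; case: eqP => _ /=; lia.
Qed.
End Restrict.

(* Moving all the particles of [c] at [r] turns the part of [f] minimal for [phi r]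
   into a nonzero vector [u] killed by [gl ys k l] and in the image of a power of
   it, which bounds the sl_2-weight of [u] from below. *)
Lemma singular_strip ys r (f : fock) c (k l : 'I_n) :
  uniq (rcons ys r) -> fin f -> (k < l)%N -> hodd r ->
  gl (rcons ys r) k l f = 0 ->
  (forall c', f c' != 0 -> nu (rcons ys r) k c' - nu (rcons ys r) l c' =
                          nu (rcons ys r) k c - nu (rcons ys r) l c) ->
  f c != 0 -> (forall c', f c' != 0 -> phi r c <= phi r c') ->
  (if (0 < r)%R then c r l else c r k)%:Z <= nu ys k c - nu ys l c.
Proof.
move=> urc ff kl hr sf wf fc minc; set j := (X in X%:Z <= _).
have [ry uy] : r \notin ys /\ uniq ys by move: urc; rewrite rcons_uniq => /andP.
have kl' : k != l by apply: contraTneq kl => ->; rewrite ltnn.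
pose g (i : nat) (p : 'I_n) := charge c r p + (p == k)%:Z * i%:Z - (p == l)%:Z * i%:Z.
have glf : gl ys k l f = - X (r, k) (r, l) f.
  by apply/eqP; rewrite -addr_eq0 -gl1 -gl_cat cats1 sf.
(* The component of [glf] with prescribed charges at [r]: [gl ys] does not change them, while [X]
   moves one unit from [l] to [k]. *)
have rec g' : gl ys k l (restr r (fun p => g' p + (p == k)%:Z - (p == l)%:Z) f) =
    - X (r, k) (r, l) (restr r g' f).
  rewrite restr_gl // glf restr_X; apply/funext => c'; rewrite fockN /restr.
  by case: ifP => _; rewrite ?oppr0.
have rec' i : gl ys k l (restr r (g i.+1) f) = - X (r, k) (r, l) (restr r (g i) f).
  rewrite -rec; congr (gl _ _ _ (restr _ _ _)); apply/funext => p; rewrite /g -addn1 PoszD; ring.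
have rec0 : gl ys k l (restr r (g 0%N) f) = 0.
  pose g' p := charge c r p - (p == k)%:Z + (p == l)%:Z.
  have -> : g 0%N = (fun p => g' p + (p == k)%:Z - (p == l)%:Z).
    by apply/funext => p; rewrite /g /g'; ring.
  rewrite rec (_ : restr r g' f = 0) ?linear0 ?oppr0 //; apply/funext => c'.
  apply/eqP; apply: contraT => /restr_neq[/minc + hc'].
  rewrite /phi lerN2; under eq_bigr do rewrite hc' /g' mulrDr mulrBr.
  rewrite big_split sumrB /= -[X in _ <= X]addr0 -addrA lerD2l.
  have sumd (q : 'I_n) : \sum_(i < n) (i%:Z * (i == q)%:Z) = q%:Z.
    rewrite (bigD1 q) //= eqxx mulr1 big1 ?addr0 // => i /negbTE ->; exact: mulr0.
  by rewrite !sumd; lia.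
pose u := iter j (X (r, k) (r, l)) (restr r (g 0%N) f).
have Eu : gl ys k l u = 0.
  rewrite /u; elim: (j) => //= i IH; by rewrite X_glC // IH linear0.
have fu : fin u.
  by rewrite /u; elim: (j) => [|i IH]; [exact: fin_restr|exact: fin_X].
have u0 : u != 0.
  apply: (iterX_neq0 (c := c)) => //; rewrite restrP // => p; rewrite /g; ring.
(* Each [gl ys k l] replaces one step of [g] by one application of [X], up to a sign, and [X]
   commutes with [gl ys]. *)
have um : u = iter j (gl ys k l) ((-1) ^+ j *: restr r (g j) f).
  rewrite /u; elim: (j) => [|i IH]; first by rewrite expr0 scale1r.
  rewrite [RHS]iterSr linearZ /= rec' exprS mulN1r scaleNr scalerN opprK.
  rewrite -linearZ /= IH.
  elim: (i) ((-1) ^+ i *: _) => //= q IH' h; by rewrite -X_glC // IH'.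
apply: (singular_in_image uy kl' Eu fu _ _ um u0); last exact/finZ/fin_restr.
have : forall c', restr r (g 0%N) f c' != 0 -> nu ys k c' - nu ys l c' =
    nu ys k c - nu ys l c.
  move=> c' /restr_neq[/wf + hc']; rewrite -!cats1 !nu_cat /nu !big_seq1 !hc' /g.
  rewrite !mulr0; lia.
rewrite /u; elim: (j) => // i IH h c' /X_supp[c2 /(IH h) <- mv].
have nue p : nu ys p c' = nu ys p c2; last by rewrite !nue.
rewrite /nu !big_seq; apply: eq_bigr => r' r'y.
have ne : (r' == r) = false by apply/negbTE; apply: contraNneq ry => <-.
by rewrite mv !xpair_eqE ne /= addr0 subr0.
Qed.

(** Peel off the last index. On the part of [f] minimal for [phi r] the raising operators at [r]
    have no source, so this part is singular for the shorter list and induction applies to it; the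
    last step is then controlled by [singular_wt_ge0] and [singular_strip]. *)
Lemma singular_good xs (f : fock) : uniq xs -> fin f -> f != 0 ->
  (forall k l : 'I_n, (k < l)%N -> gl xs k l f = 0) ->
  (forall c c' k, f c != 0 -> f c' != 0 -> nu xs k c = nu xs k c') ->
  exists2 c, f c != 0 & good_upto xs c.
Proof.
elim/last_ind: xs f => [|ys r IH] f uxs ff f0 sf wf.
  have [c fc] : exists c, f c != 0.
    apply: contrapT => h; move/eqP: f0; apply; apply/funext => c.
    by apply/eqP; apply: contrapT => /negP hc; apply: h; exists c.
  by exists c => // ys r zs; case: ys.
have [ry uy] : r \notin ys /\ uniq ys by move: uxs; rewrite rcons_uniq => /andP.
have [c1 fc1 minc] : exists2 c1, f c1 != 0 & forall c, f c != 0 -> phi r c1 <= phi r c.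
  case: (ff) => A hA.
  have [c fc] : exists c, f c != 0.
    apply: contrapT => h; move/eqP: f0; apply; apply/funext => c.
    by apply/eqP; apply: contrapT => /negP hc; apply: h; exists c.
  have cB : c \in [fset c in A | f c != 0]%fset by rewrite !inE hA.
  have [c1 + h1] := fset_min (phi r) cB; rewrite !inE /= => /andP[_ fc1].
  by exists c1 => // c' fc'; apply: h1; rewrite !inE /= hA.
pose g := restr r (charge c1 r) f.
have gphi c : g c != 0 -> phi r c = phi r c1.
  by move/restr_neq=> [_ e]; rewrite /phi; congr (- _); apply: eq_bigr => k _; rewrite e.
have [||||c gc hc] := IH g uy.
- exact: fin_restr.
- apply/eqP => /(congr1 (fun h : fock => h c1)); rewrite /= /g restrP // fock0.
  by move/eqP; exact/negP.
- move=> k l kl; rewrite /g restr_gl //.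
  have -> : gl ys k l f = - X (r, k) (r, l) f.
    by apply/eqP; rewrite -addr_eq0 -gl1 -gl_cat cats1 sf.
  apply/funext => c; apply/eqP; apply: contraT => /restr_neq[].
  rewrite fockN oppr_eq0 => /X_supp[c' /minc + mv] hc; rewrite /phi lerN2.
  have e p : charge c' r p = charge c1 r p - (p == k)%:Z + (p == l)%:Z.
    by rewrite -hc mv !xpair_eqE eqxx /=; ring.
  under eq_bigr do rewrite e mulrDr mulrBr.
  rewrite big_split sumrB /= -[X in _ <= X]addr0 -addrA lerD2l.
  have sumd (q : 'I_n) : \sum_(i < n) (i%:Z * (i == q)%:Z) = q%:Z.
    rewrite (bigD1 q) //= eqxx mulr1 big1 ?addr0 // => i /negbTE ->; exact: mulr0.
  by rewrite !sumd; lia.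
- move=> c c' k /restr_neq[fc hc] /restr_neq[fc' hc'].
  have := wf c c' k fc fc'; rewrite -!cats1 !nu_cat /nu !big_seq1 hc hc'; exact: addIr.
have [fc hcr] := restr_neq gc; exists c => //.
move=> ys' r' zs; case/lastP: zs => [|zs r''].
  rewrite cats1 => /rcons_inj[<- <-] k l kl.
  have kl' : k != l by apply: contraTneq kl => ->; rewrite ltnn.
  split.
    rewrite -subr_ge0; apply: (singular_wt_ge0 uxs kl' (sf _ _ kl) ff _ f0).
    by move=> c' fc'; rewrite (wf c' c k fc' fc) (wf c' c l fc' fc).
  move=> hr; have := singular_strip uxs ff kl hr (sf _ _ kl) _ fc _.
  have w1 c' : f c' != 0 -> nu (rcons ys r) k c' - nu (rcons ys r) l c' =
                          nu (rcons ys r) k c - nu (rcons ys r) l c.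
    by move=> fc'; rewrite (wf c' c k fc' fc) (wf c' c l fc' fc).
  have w2 c' : f c' != 0 -> phi r c <= phi r c' by rewrite (gphi c gc); exact: minc.
  move=> /(_ w1 w2); rewrite -!cats1 !nu_cat /nu !big_seq1 /charge; case: ifP => _; lia.
rewrite -rcons_cons -rcons_cat => /rcons_inj[e _]; exact: hc e.
Qed.
End Leading.

(** * Moving several fermions at once *)

Section MultiMove.
Variables (R : realType) (n : nat).
Local Notation C := R[i].
Local Notation fock := (fock R n).
Local Notation conf := (conf n).

Definition delta (d : conf) : fock := fun c => (c == d)%:R.

Lemma delta_supp d c : delta d c != 0 -> c = d.
Proof. by rewrite /delta pnatr_eq0 eqb0 negbK => /eqP. Qed.

Lemma fin_delta d : fin (delta d).
Proof. by exists [fset d]%fset => c /delta_supp ->; rewrite inE. Qed.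

Definition movedK (c c' : conf) (i j : halfZ) (K : {set 'I_n}) :=
  forall r k, charge c r k =
    charge c' r k + ((r == i) && (k \in K))%:Z - ((r == j) && (k \in K))%:Z.

Variables (i j : halfZ).
Hypothesis nij : i != j.

Definition ES (S : {set 'I_n}) (f : fock) : fock := \sum_(k in S) X (i, k) (j, k) f.

Lemma ES_linear S : linear (ES S).
Proof.
move=> a f g; rewrite /ES scaler_sumr -big_split /=; apply: eq_bigr => r _.
exact: linearP.
Qed.
HB.instance Definition _ S := GRing.isLinear.Build C fock fock *:%R (ES S)
  (ES_linear S).

Lemma E_ES f : E i j f = ES [set: 'I_n] f.
Proof. by rewrite E_offdiag // /Eh /ES; apply: eq_bigl => k; rewrite inE. Qed.

Lemma ES_supp S f c : ES S f c != 0 ->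
  exists2 k, k \in S & exists2 c', f c' != 0 & moved c c' (i, k) (j, k).
Proof.
rewrite /ES fock_sum => h.
have /existsP[k /andP[kS hk]] : [exists k, (k \in S) && (X (i, k) (j, k) f c != 0)].
  apply: contraNT h; rewrite negb_exists => /forallP h.
  rewrite big1 // => k kS; apply/eqP; move: (h k).
  by rewrite kS /= negbK.
by exists k => //; apply: X_supp hk.
Qed.

Lemma iterES_rows S f q c : iter q (ES S) f c != 0 ->
  exists2 c', f c' != 0 & forall r k, k \notin S -> charge c r k = charge c' r k.
Proof.
elim: q c => [|q IH] c /=; first by exists c.
case/ES_supp => k kS [c1 /IH[c2 f2 e2] mv]; exists c2 => // r p pS.
have ne : (p == k) = false by apply: contraNF pS => /eqP ->.
by rewrite mv !xpair_eqE ne !andbF addr0 subr0 e2.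
Qed.

Hypothesis fj : ferm i && ferm j.

Lemma X_comm k l (f : fock) :
  X (i, k) (j, k) (X (i, l) (j, l) f) = X (i, l) (j, l) (X (i, k) (j, k) f).
Proof.
rewrite X_X sg4E.
have -> : sgE R i j i j = 1.
  by case/andP: fj; rewrite /sgE !hoddD /ferm; do 2!case: hodd.
by rewrite !xpair_eqE [j == i]eq_sym (negbTE nij) /= mulr0 !scale0r scale1r addr0 subr0.
Qed.

Lemma X_sq k (f : fock) : X (i, k) (j, k) (X (i, k) (j, k) f) = 0.
Proof.
rewrite /X psim_psip xpair_eqE eq_sym (negbTE nij) scale0r addr0 linearZ /=.
by rewrite /psim osc_ferm0 ?linear0 ?scaler0 //; case/andP: fj.
Qed.

Lemma ES_split (S : {set 'I_n}) k (f : fock) : k \in S -> ES S f = X (i, k) (j, k) f + ES (S :\ k) f.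
Proof.
move=> kS; rewrite /ES (bigD1 k) //=; congr (_ + _); apply: eq_bigl => l.
by rewrite !inE andbC.
Qed.

Lemma ES_X (S : {set 'I_n}) k (f : fock) : ES (S :\ k) (X (i, k) (j, k) f) = X (i, k) (j, k) (ES (S :\ k) f).
Proof.
rewrite /ES linear_sum /=; apply: eq_bigr => l _; exact: X_comm.
Qed.

(** The binomial expansion stops at the linear term in the move of color [k], which squares to zero
    by the Pauli principle. *)
Lemma iterES_split (S : {set 'I_n}) k (f : fock) q : k \in S ->
  iter q.+1 (ES S) f = iter q.+1 (ES (S :\ k)) f +
    q.+1%:R *: X (i, k) (j, k) (iter q (ES (S :\ k)) f).
Proof.
move=> kS; elim: q => [|q IH]; first by rewrite /= (ES_split _ kS) scale1r addrC.
rewrite [LHS]iterS IH (ES_split _ kS) !linearD !linearZ /= X_sq scaler0 addr0.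
rewrite ES_X -[in RHS]natr1 scalerDl scale1r; set a := X (n := n) _ _ _; set b := ES _ _.
set cc := q.+1%:R *: _; rewrite [in RHS]addrA addrC addrA addrAC.
by rewrite -!addrA; congr (_ + _); rewrite addrC.
Qed.

(** Only the colors of [K], in any order, lead from [c'] to [c]. The moves commute, so the
    coefficient is [#|K|] factorial times a product of nonzero numbers. *)
Lemma iterES_val (S K : {set 'I_n}) c c' : K \subset S -> movedK c c' i j K ->
  iter #|K| (ES S) (delta c') c != 0.
Proof.
move: {2}#|K| (erefl #|K|) => q; elim: q S K c => [|q IH] S K c cK KS mv.
  rewrite cK /=; have -> : c = c'.
    apply: charge_inj => r k; rewrite mv.
    by rewrite (cards0_eq cK) inE !andbF addr0 subr0.
  by rewrite /delta eqxx oner_eq0.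
have /card_gt0P[k kK] : (0 < #|K|)%N by rewrite cK.
have cK' : #|K :\ k| = q by have := cardsD1 k K; rewrite kK cK => -[].
have kS : k \in S by exact: (fintype.subsetP KS).
have ji : (j == i) = false by rewrite eq_sym; apply/negbTE.
case/andP: fj => fi fjj.
have [c1 mv1] : exists c1 : conf, moved c c1 (i, k) (j, k).
  pose b := 0 < i; pose b' := 0 < j.
  exists (upd (upd c (i, k) (if b then 0%N else 1%N)) (j, k) (if b' then 1%N else 0%N)).
  have hi := mv i k; have hj := mv j k.
  rewrite kK !eqxx (negbTE nij) ji in hi hj; rewrite /charge in hi hj.
  have c1 := occ_ferm c k fi; have c2 := occ_ferm c' k fi.
  have c3 := occ_ferm c k fjj; have c4 := occ_ferm c' k fjj.
  move=> r p; rewrite /charge !updE /b /b'.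
  have [[-> ->]|n2] := eqVneq (r, p) (j, k).
    rewrite xpair_eqE ji /clip fjj; move: hj; case: ifP => _ /=; lia.
  have [[-> ->]|n1] := eqVneq (r, p) (i, k).
    rewrite /clip fi; move: hi; case: ifP => _ /=; lia.
  by rewrite addr0 subr0.
have [|x x0 hx] := X_val R (m := (i, k)) (m' := (j, k)) _ mv1.
  by rewrite xpair_eqE (negbTE nij).
have mvK : movedK c1 c' i j (K :\ k).
  move=> r p; have := mv r p; rewrite mv1 !xpair_eqE !inE.
  have [->|] := eqVneq p k; last by rewrite !andbF addr0 subr0.
  rewrite kK !andbT !andbF; lia.
rewrite cK (iterES_split _ _ kS) fockD fockZ hx.
(* This term leaves color [k] alone, whereas [c] and [c'] differ there. *)
suff -> : iter q.+1 (ES (S :\ k)) (delta c') c = 0.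
  rewrite add0r mulf_neq0 ?pnatr_eq0 // mulf_neq0 //.
  by have := IH (S :\ k) (K :\ k) c1 cK' (finset.setSD _ KS) mvK; rewrite cK'.
apply/eqP; apply: contraT => /iterES_rows[c2 /delta_supp -> /(_ i k)].
rewrite !inE eqxx => /(_ isT); rewrite mv eqxx kK (negbTE nij) /=; lia.
Qed.
End MultiMove.

(** * Leading terms of powers of e_ij *)

Section ColumnStep.
Variables (R : realType) (n : nat).
Local Notation C := R[i].
Local Notation fock := (fock R n).
Local Notation conf := (conf n).

Definition sumk (K : {set 'I_n}) : int := \sum_(k in K) k%:Z.

(** Used to compare an extremal set of rows with any other admissible set of the same size. *)
Lemma sumk_le (A B : {set 'I_n}) : #|A| = #|B| ->
  (forall a b, a \in A :\: B -> b \in B :\: A -> (a < b)%N) ->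
  A = B \/ sumk A < sumk B.
Proof.
move=> cAB lt.
have cD : #|A :\: B| = #|B :\: A|.
  by have := cardsID B A; have := cardsID A B; rewrite finset.setIC; lia.
have [A0|[a0 ha0]] := set_0Vmem (A :\: B).
  left; have B0 : B :\: A = finset.set0.
    by apply/cards0_eq; rewrite -cD A0 cards0.
  by apply/eqP; rewrite finset.eqEsubset -!finset.setD_eq0 A0 B0 !eqxx.
right; have [b0 hb0] : exists b, b \in B :\: A.
  by apply/card_gt0P; rewrite -cD; apply/card_gt0P; exists a0.
case: (@arg_minnP _ b0 (mem (B :\: A)) val hb0) => /= m hm minm.
rewrite /sumk (big_setID B) [X in _ < X](big_setID A) /= finset.setIC ltrD2l.
apply: (@lt_le_trans _ _ (\sum_(k in A :\: B) m%:Z)).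
  by apply: ltr_sum; [apply/hasP; exists a0; rewrite ?mem_index_enum|move=> k hk; rewrite ltz_nat lt].
rewrite sumr_const cD -sumr_const; apply: ler_sum => k hk; rewrite lez_nat; exact: minm.
Qed.

(** One fermionic end is enough: it forbids the same color from moving twice. *)
Lemma ES_movedK S i j q (f : fock) d : i != j -> ferm i || ferm j ->
  iter q (ES i j S) f d != 0 ->
  exists2 d', f d' != 0 & exists2 K : {set 'I_n}, #|K| = q & movedK d d' i j K.
Proof.
move=> nij fij; elim: q d => [|q IH] d /=.
  by exists d => //; exists finset.set0; rewrite ?cards0 // => r k; rewrite inE !andbF addr0 subr0.
case/ES_supp => k _ [d1 /IH[d' fd' [K cK mK]] mv].
have ji : (j == i) = false by rewrite eq_sym; apply/negbTE.
have kK : k \notin K.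
  apply/negP => kK; have := mv i k; have := mv j k.
  rewrite !(mK _ k) kK !xpair_eqE !eqxx (negbTE nij) ji /charge /=.
  case/orP: fij => fr.
    have := occ_ferm d k fr; have := occ_ferm d' k fr; case: (0 < i); lia.
  have := occ_ferm d k fr; have := occ_ferm d' k fr; case: (0 < j); lia.
exists d' => //; exists (k |: K)%SET; first by rewrite cardsU1 kK cK.
move=> r p; rewrite mv mK !xpair_eqE !inE; have [->|_] := eqVneq p k.
  by rewrite (negbTE kK) !andbT !andbF /= addr0 subr0.
by rewrite !andbF /= addr0 subr0.
Qed.

Lemma iterE_ES i j q (f : fock) : i != j ->
  iter q (E i j) f = iter q (ES i j [set: 'I_n]%SET) f.
Proof. by move=> nij; elim: q => //= q ->; rewrite E_ES. Qed.

Lemma iterE_val i j (K : {set 'I_n}) d d' : i != j ->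
  ferm i && ferm j \/ (#|K| <= 1)%N ->
  movedK d d' i j K -> iter #|K| (E i j) (delta R d') d != 0.
Proof.
move=> nij [fij|cK] mv; rewrite iterE_ES //.
  by apply: iterES_val => //; apply/fintype.subsetP => k; rewrite inE.
have /orP[c0|/cards1P[k Kk]] : (#|K| == 0)%N || (#|K| == 1)%N by case: #|K| cK => [|[]].
  have -> : d = d'.
    apply: charge_inj => r k; rewrite mv; move: c0; rewrite cards_eq0 => /eqP ->.
    by rewrite inE !andbF addr0 subr0.
  by rewrite (eqP c0) /= /delta eqxx oner_eq0.
have mv1 : moved d d' (i, k) (j, k).
  by move=> r p; rewrite mv Kk inE !xpair_eqE.
rewrite Kk cards1 /= /ES fock_sum (bigD1 k) ?inE //= big1 ?addr0 => [|l /andP[_ lk]].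
  have [|x x0 hx] := X_val R _ mv1; first by rewrite xpair_eqE (negbTE nij).
  by rewrite hx /delta eqxx mulr1.
apply/eqP; apply: contraT => /X_supp[c /delta_supp -> /(_ i k)].
have ji : (j == i) = false by rewrite eq_sym; apply/negbTE.
rewrite mv1 !xpair_eqE !eqxx (negbTE nij) eq_sym (negbTE lk) !andbF /=; lia.
Qed.

Lemma phi_movedK r d d' i j K : movedK d d' i j K ->
  phi r d = phi r d' - (r == i)%:Z * sumk K + (r == j)%:Z * sumk K.
Proof.
move=> mv; rewrite /phi; under eq_bigr do rewrite mv mulrBr mulrDr.
have sm (b : bool) : \sum_(p < n) (p%:Z * (b && (p \in K))%:Z) = b%:Z * sumk K.
  rewrite /sumk mulr_sumr [RHS]big_mkcond; apply: eq_bigr => p _ /=.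
  by case: (p \in K); rewrite ?andbT ?andbF ?mulr0 // mulrC.
rewrite sumrB big_split /= !sm; ring.
Qed.

Definition lead r (f : fock) d := f d != 0 /\
  forall d', f d' != 0 -> d' = d \/ phi r d < phi r d'.

Lemma iterE_linear i j q : linear (iter q (E (n := n) (R := R) i j)).
Proof. by elim: q => // q IH a f g; rewrite !iterS IH linearP. Qed.

(** The change of [phi r] depends only on the set of colors moved. If [K0] is strictly optimal, the
    value [phi r d2] is attained only by moving [K0] in the leading term [d1], so nothing can cancel
    it. *)
Lemma lead_step r i j (f : fock) d1 d2 (K0 : {set 'I_n}) : i != j ->
  ferm i && ferm j \/ (ferm i || ferm j) && (#|K0| <= 1)%N ->
  lead r f d1 -> movedK d2 d1 i j K0 ->
  (forall d d' K, f d != 0 -> movedK d' d i j K -> #|K| = #|K0| ->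
     K = K0 \/ phi r d2 - phi r d1 < phi r d' - phi r d) ->
  lead r (iter #|K0| (E i j) f) d2.
Proof.
move=> nij fij [fd1 ld] mv minK.
have fij1 : ferm i || ferm j by case: fij => [/andP[-> ->]|/andP[]].
have fij2 : ferm i && ferm j \/ (#|K0| <= 1)%N by case: fij => [|/andP[]]; [left|right].
have supp (g : fock) d' : iter #|K0| (E i j) g d' != 0 -> (forall d, g d != 0 -> f d != 0) ->
    exists2 d, g d != 0 & d = d1 /\ d' = d2 \/ phi r d2 < phi r d'.
  move=> hd' gf; move: hd'; rewrite iterE_ES // => /ES_movedK[//|//|d gd [K cK mK]].
  exists d => //; have fd := gf _ gd.
  case: (minK d d' K fd mK cK) => [eK|lt]; last first.
    by right; case: (ld d fd) => [e|]; [move: lt; rewrite e|]; lia.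
  case: (ld d fd) => [e|lt]; last by right; move: (phi_movedK r mK) (phi_movedK r mv); rewrite eK; lia.
  left; split=> //; apply: charge_inj => p k; rewrite (mK p k) (mv p k) e eK //.
split; last first.
  by move=> d' /supp[//|d _ [[_ ->]|]]; [left|right].
(* Split off the leading term; the remainder cannot reach [d2]. *)
have ef : f = f d1 *: delta R d1 + (f - f d1 *: delta R d1) by rewrite addrC subrK.
rewrite ef iterE_linear fockE.
suff -> : iter #|K0| (E i j) (f - f d1 *: delta R d1) d2 = 0.
  by rewrite addr0 mulf_neq0 // iterE_val.
apply/eqP; apply: contraT => /supp[d|d].
  rewrite fockD fockN fockZ /delta; case: (eqVneq d d1) => [-> _|_] //.
  by rewrite mulr0 subr0.
rewrite fockD fockN fockZ /delta => h [[e _]|]; last by rewrite ltxx.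
by move: h; rewrite e eqxx mulr1 subrr eqxx.
Qed.
End ColumnStep.

(** * Vectors with a prescribed leading configuration *)

Section Words.
Variables (R : realType) (n : nat).
Local Notation C := R[i].
Local Notation fock := (fock R n).
Local Notation conf := (conf n).

Definition gvalid (g : halfZ -> 'I_n -> int) := forall r k,
  [/\ 0 < r -> 0 <= g r k, r <= 0 -> g r k <= 0 & ferm r -> (`|g r k| <= 1)%N].

Lemma conf_of_subproof (g : halfZ -> 'I_n -> int) :
  {c : conf | gvalid g -> forall r k, charge c r k = g r k}.
Proof.
have h : `[< forall r k, ferm r -> (clip r `|g r k|%N <= 1)%N >].
  by apply/asboolP => r k fr; rewrite /clip fr geq_minr.
exists (Conf h) => vg r k; have [h1 h2 h3] := vg r k; rewrite /charge /=.
have -> : clip r `|g r k|%N = `|g r k|%N.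
  by rewrite /clip; case: ifP => // /h3; move/minn_idPl.
case: ifP => h0; first by have := h1 h0; lia.
by have := h2; lia.
Qed.
Definition conf_of g := sval (conf_of_subproof g).
Lemma charge_conf_of g r k : gvalid g -> charge (conf_of g) r k = g r k.
Proof. by move=> h; apply: (svalP (conf_of_subproof g)). Qed.

Lemma gvalid_charge (c : conf) : gvalid (charge c).
Proof.
move=> r k; rewrite /charge; split => [->//|h|fr]; first by case: ifP; lia.
by have := occ_ferm c k fr; case: ifP; lia.
Qed.

Definition applyw (W : seq (halfZ * halfZ)) (f : fock) : fock :=
  foldr (fun p g => E p.1 p.2 g) f W.

Lemma applyw_cat W W' f : applyw (W ++ W') f = applyw W (applyw W' f).
Proof. exact: foldr_cat. Qed.

Lemma applyw_linear W : linear (applyw W).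
Proof.
elim: W => [|p W IH] a f g //; have := IH a f g.
by rewrite /applyw /= => ->; rewrite linearP.
Qed.
HB.instance Definition _ W := GRing.isLinear.Build C fock fock *:%R (applyw W)
  (applyw_linear W).

Lemma applyw_nseq q i j f : applyw (nseq q (i, j)) f = iter q (E i j) f.
Proof. by elim: q => //= q ->. Qed.

Definition touched (W : seq (halfZ * halfZ)) r := has (fun p => (p.1 == r) || (p.2 == r)) W.

Lemma applyw_supp W f d : applyw W f d != 0 ->
  exists2 d', f d' != 0 & forall r k, ~~ touched W r -> charge d r k = charge d' r k.
Proof.
elim: W d => [|p W IH] d /=; first by exists d.
case/E_supp => k [d1 /IH[d2 fd2 h] mv]; exists d2 => // r q.
rewrite negb_or => /andP[/norP[n1 n2] /h <-]; rewrite mv !xpair_eqE.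
by rewrite ![r == _]eq_sym (negbTE n1) (negbTE n2) /= addr0 subr0.
Qed.

Lemma fin_applyw W f : fin f -> fin (applyw W f).
Proof. by move=> ff; elim: W => //= p W IH; apply: fin_E. Qed.

Variable M : nat.

(* Column [z] of a generalized diagram lives on a fermionic index beyond [M]. *)
Definition scol (z : int) : halfZ :=
  if 0 < z then 2 * (z + M%:Z) else 2 * (z - M%:Z - 1).

Definition uncol (r : halfZ) : option int :=
  if hodd r then None
  else if 2 * M%:Z < r then Some ((r %/ 2)%Z - M%:Z)
  else if r < - (2 * M%:Z) then Some ((r %/ 2)%Z + M%:Z + 1) else None.

Lemma scol_gt0 z : (0 < scol z) = (0 < z).
Proof. by rewrite /scol; case: ifP; lia. Qed.

Lemma ferm_scol z : ferm (scol z).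
Proof. by rewrite /ferm /hodd /scol; case: ifP; lia. Qed.

Lemma uncol_scol z : uncol (scol z) = Some z.
Proof.
rewrite /uncol; have := ferm_scol z; rewrite /ferm => /negbTE ->.
rewrite /scol; case h: (0 < z).
  by rewrite ifT; [congr Some; lia|lia].
by rewrite ifF; [rewrite ifT; [congr Some; lia|lia]|lia].
Qed.

Lemma scolK r z : uncol r = Some z -> r = scol z.
Proof.
rewrite /uncol; case: ifP => // e; case: ifP => h.
  by case=> <-; rewrite /scol /hodd in e *; case: ifP; lia.
by case: ifP => // h' [<-]; rewrite /scol /hodd in e *; case: ifP; lia.
Qed.

Lemma scol_inj : injective scol.
Proof. by move=> z z' e; have := uncol_scol z; rewrite e uncol_scol => -[]. Qed.

Lemma uncol_window r : (`|r| <= M)%N -> uncol r = None.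
Proof. by rewrite /uncol => h; case: ifP => // _; rewrite !ifF //; lia. Qed.

(* The charges [T] inside the window; outside it, column [z] of the diagram [V] is
   spelled out by fermions, the columns [z <= 0] by the missing boxes. *)
Definition baseg (V : int -> 'I_n -> int) (T : halfZ -> 'I_n -> int) r k : int :=
  if uncol r is Some z then (z <= V z k)%R%:Z - (z <= 0)%R%:Z else T r k.

Lemma baseg_valid V T : gvalid T -> gvalid (baseg V T).
Proof.
move=> vT r k; rewrite /baseg; case E: (uncol r) => [z|]; last exact: vT.
rewrite (scolK E) scol_gt0 [scol z <= 0]leNgt scol_gt0.
by split; case: (z <= V z k); lia.
Qed.

Lemma baseg_scol V T z k : baseg V T (scol z) k = (z <= V z k)%R%:Z - (z <= 0)%R%:Z.
Proof. by rewrite /baseg uncol_scol. Qed.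

Section Stage.
Variables (r : halfZ) (v v' : 'I_n -> int) (T : halfZ -> 'I_n -> int) (L : nat).
Hypotheses (rc : uncol r = None)
  (vpos : 0 < r -> forall k, v' k <= v k) (vneg : r <= 0 -> forall k, v k <= v' k)
  (vferm : ferm r -> forall k, (`|v k - v' k| <= 1)%N)
  (dom : forall k l : 'I_n, (k < l)%N -> v' l <= v' k)
  (strip : hodd r -> forall k l : 'I_n, (k < l)%N ->
     if 0 < r then v l <= v' k else v' l <= v k)
  (vT : gvalid T).

(* Intermediate stages, in which the columns up to [t] have been cut from [v] to
   [v'] and the corresponding particles moved to the index [r]. *)
Definition midT (t : int) r' k : int :=
  if r' == r then Num.min t (v k) - Num.min t (v' k) else T r' k.
Definition mid (t : int) : conf :=
  conf_of (baseg (fun z => if z <= t then v' else v) (midT t)).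

Lemma midT_valid t : gvalid (midT t).
Proof.
move=> r' k; rewrite /midT; case: eqP => [->|_]; last exact: vT.
split=> [/vpos/(_ k)|/vneg/(_ k)|/vferm/(_ k)]; lia.
Qed.

Lemma charge_mid t r' k : charge (mid t) r' k =
  baseg (fun z => if z <= t then v' else v) (midT t) r' k.
Proof. by rewrite charge_conf_of //; apply/baseg_valid/midT_valid. Qed.

Definition K0 (z : int) : {set 'I_n} :=
  if 0 < r then [set k | v' k < z <= v k]%SET else [set k | v k < z <= v' k]%SET.
(** Charge flows from the column to a positive [r], which gains particles, and from a nonpositive
    [r] to the column, so that [r] gains antiparticles. *)
Definition ij (z : int) : halfZ * halfZ := if 0 < r then (r, scol z) else (scol z, r).

Lemma r_scol z : r != scol z.
Proof. by apply/eqP => e; move: rc; rewrite e uncol_scol. Qed.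

Lemma mid_step (t : int) : movedK (mid (t + 1)) (mid t) (ij (t + 1)).1 (ij (t + 1)).2 (K0 (t + 1)).
Proof.
move=> r' k; rewrite !charge_mid /K0 /ij.
have r0 : (0 < r) = false -> r <= 0 by move=> h; rewrite leNgt h.
case E: (uncol r') => [z|].
  have er : r' = scol z := scolK E.
  have nr : (r' == r) = false by rewrite er eq_sym; apply/negbTE/r_scol.
  have es : (r' == scol (t + 1)) = (z == t + 1).
    by rewrite er (inj_eq scol_inj).
  rewrite /baseg E; case h0: (0 < r); rewrite /=; rewrite nr es inE /=.
    have := vpos h0 k; have [->|ne] := eqVneq z (t + 1).
      rewrite lexx ifF; lia.
    have -> : (z <= t + 1) = (z <= t) by lia.
    by case: (z <= t); lia.
  have := vneg (r0 h0) k; have [->|ne] := eqVneq z (t + 1).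
    rewrite lexx ifF; lia.
  have -> : (z <= t + 1) = (z <= t) by lia.
  by case: (z <= t); lia.
have es z : (r' == scol z) = false.
  by apply/negbTE/eqP => e; move: E; rewrite e uncol_scol.
rewrite /baseg E /midT; have [->|ne] := eqVneq r' r.
  have rs z : (r == scol z) = false by apply/negbTE/r_scol.
  case h0: (0 < r); rewrite /=; rewrite ?eqxx rs inE /=.
    by have := vpos h0 k; lia.
  by have := vneg (r0 h0) k; lia.
by case h0: (0 < r); rewrite /=; rewrite (negbTE ne) es /= addr0 subr0.
Qed.

(** A horizontal strip has at most one box in each column. *)
Lemma K0_card z : ferm r \/ (#|K0 z| <= 1)%N.
Proof.
case fr: (ferm r); [by left|right]; have hr : hodd r by move: fr; rewrite /ferm; case: hodd.
apply/card_le1_eqP => k l; rewrite /K0.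
have st := strip hr; move: st; case h0: (0 < r) => st; rewrite !inE => hk hl.
  case: (ltngtP k l) => [kl|kl|/val_inj //]; have := st _ _ kl; lia.
case: (ltngtP k l) => [kl|kl|/val_inj //]; have := st _ _ kl; lia.
Qed.

(** The leading term alone would not suffice: in every term the columns still to be cut must look as
    they do in [v], since this limits which colors can move next. *)
Definition untouched (t : int) (f : fock) := forall d, f d != 0 -> forall r' k, r' != r ->
  (forall z, r' = scol z -> t < z) -> charge d r' k = charge (mid t) r' k.

(** The colors that can move out of column [z] are those with [z <= v k] if [r] is positive, and
    those with [v k < z] can move into it otherwise. By dominance of [v'], the set [K0] consists of
    the last of these colors in the first case and of the first in the second; either choice
    strictly minimises [phi r] among sets of its size. *)
Lemma stage_step t f : lead r f (mid t) -> untouched t f ->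
  let f' := iter #|K0 (t + 1)| (E (ij (t + 1)).1 (ij (t + 1)).2) f in
  lead r f' (mid (t + 1)) /\ untouched (t + 1) f'.
Proof.
move=> lf uf f'; set z := t + 1 in f' *.
have rs : r != scol z := r_scol z.
have sr : scol z != r by rewrite eq_sym.
have nij : (ij z).1 != (ij z).2 by rewrite /ij; case: ifP.
have fij : ferm (ij z).1 && ferm (ij z).2 \/
    (ferm (ij z).1 || ferm (ij z).2) && (#|K0 z| <= 1)%N.
  rewrite /ij; case: (K0_card z) => h; [left|right]; case: (0 < r); rewrite /=;
  by rewrite ferm_scol ?h ?orbT.
have fij1 : ferm (ij z).1 || ferm (ij z).2 by case: fij => [/andP[-> ->]|/andP[]].
split.
  apply: (lead_step nij fij lf (mid_step t)) => d d' K fd mK cK.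
  have zK k : k \in K -> if 0 < r then z <= v k else v k < z.
    move=> kK; have := uf d fd (scol z) k sr; rewrite charge_mid baseg_scol ifF; last by rewrite /z; lia.
    have hz z' : scol z = scol z' -> t < z' by move=> /scol_inj <-; rewrite /z; lia.
    move=> /(_ hz); have := mK (scol z) k.
    have [h1 h2 h3] := gvalid_charge d' (scol z) k.
    move: h1 h2 (h3 (ferm_scol z)); rewrite [scol z <= 0]leNgt scol_gt0 /ij.
    case h0: (0 < r); rewrite /=; rewrite kK eqxx (negbTE sr) /=; lia.
  have := phi_movedK r mK; have := phi_movedK r (mid_step t); rewrite -/z /ij.
  have K0P k : k \in K0 z = if 0 < r then v' k < z <= v k else v k < z <= v' k.
    by rewrite /K0; case: ifP; rewrite inE.
  move: zK K0P; case h0: (0 < r) => zK K0P /=; rewrite eqxx (negbTE rs) => e1 e2.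
    case: (@sumk_le _ K (K0 z) cK) => [a b| |]; [|by left|right; lia].
    rewrite !inE !K0P => /andP[a1 a2] /andP[b1 b2].
    have := zK _ a2; case: (ltngtP a b) => [//|/dom|/val_inj ab]; first lia.
    by rewrite -ab a2 in b1.
  case: (@sumk_le _ (K0 z) K (esym cK)) => [b a| |]; [|by left|right; lia].
  rewrite !inE !K0P => /andP[b1 b2] /andP[a1 a2].
  have := zK _ a2; case: (ltngtP b a) => [//|/dom|/val_inj ba]; first lia.
  by rewrite ba a2 in b1.
move=> d; rewrite /f' iterE_ES // => /ES_movedK[//|//|d1 fd1 [K cK mK]] r' k rr hz.
have hz' z' : r' = scol z' -> t < z' by move/hz; rewrite /z; lia.
have rz : r' != scol z.
  by apply/eqP => /hz; rewrite ltxx.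
rewrite mK (uf _ fd1 _ _ rr hz') (mid_step t) -/z /ij.
by case: (0 < r); rewrite /=; rewrite (negbTE rr) (negbTE rz) /=; lia.
Qed.

Lemma stage_words (q : nat) : exists W,
  [/\ all (fun p => p.1 != p.2) W,
      forall r', touched W r' -> r' = r \/ exists z, r' = scol z,
      lead r (applyw W (delta R (mid (- L%:Z)))) (mid (- L%:Z + q%:Z)) &
      untouched (- L%:Z + q%:Z) (applyw W (delta R (mid (- L%:Z))))].
Proof.
elim: q => [|q [W [W1 W2 W3 W4]]].
  exists [::]; rewrite /= addr0; split=> //.
    by split; [rewrite /delta eqxx oner_eq0|move=> d /delta_supp ->; left].
  by move=> d /delta_supp ->.
have -> : - L%:Z + q.+1%:Z = - L%:Z + q%:Z + 1 by lia.
set t := - L%:Z + q%:Z in W3 W4 *.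
exists (nseq #|K0 (t + 1)| (ij (t + 1)) ++ W).
have [s1 s2] := stage_step W3 W4.
have e g : applyw (nseq #|K0 (t + 1)| (ij (t + 1))) g =
    iter #|K0 (t + 1)| (E (ij (t + 1)).1 (ij (t + 1)).2) g.
  by rewrite -applyw_nseq; case: ij.
split; rewrite ?applyw_cat ?e //.
  rewrite all_cat W1 andbT; apply/allP => p /nseqP[-> _].
  by rewrite /ij; case: (0 < r); rewrite /= ?r_scol // eq_sym r_scol.
move=> r'; rewrite /touched has_cat => /orP[|/W2 //].
case/hasP => p /nseqP[-> _]; rewrite /ij.
by case: (0 < r) => /= /orP[] /eqP <-; [left|right; eexists|right; eexists|left].
Qed.
End Stage.
End Words.

(** * Unpacking the columns into a good configuration *)

Section LeadWords.
Variables (R : realType) (n M : nat).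
Local Notation C := R[i].
Local Notation fock := (fock R n).
Local Notation conf := (conf n).

Lemma nu_rcons xs r k (c : conf) : nu (rcons xs r) k c = nu xs k c + charge c r k.
Proof. by rewrite -cats1 nu_cat /nu big_seq1. Qed.

(** The last index is served first: its particles are cut out of the columns, which shrinks the
    diagram from [nu (rcons ys r)] to [nu ys], and the rest of the word never touches [r] again.
    This is why terms are compared lexicographically from the end of the list. *)
Lemma lead_words (c : conf) (xs : seq halfZ) (T : halfZ -> 'I_n -> int) :
  uniq xs -> (forall r, r \in xs -> uncol M r = None) -> good_upto xs c ->
  gvalid T -> (forall r k, r \in xs -> T r k = 0) ->
  exists W,
  [/\ all (fun p => p.1 != p.2) W,
      forall r, touched W r -> r \in xs \/ exists z, r = scol M z &
      let f := applyw W (delta R (conf_of (baseg M (fun _ k => nu xs k c) T))) in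
      let tg := conf_of (baseg M (fun _ _ => 0) (fun r k => if r \in xs then charge c r k else T r k)) in
      f tg != 0 /\ forall d, f d != 0 -> d = tg \/ exists ys r zs,
        [/\ xs = ys ++ r :: zs, forall r' k, r' \in zs -> charge d r' k = charge c r' k
          & phi r c < phi r d]].
Proof.
elim/last_ind: xs T => [|ys r IH] T uxs cxs gxs vT T0.
  exists [::]; split=> //=; set b := conf_of _; set tg := conf_of _.
  have -> : b = tg.
    rewrite /b /tg; congr (conf_of _); apply/funext => r; apply/funext => k.
    by rewrite /baseg; case: uncol => // z; rewrite /nu big_nil.
  by split; [rewrite /delta eqxx oner_eq0|move=> d /delta_supp ->; left].
have [ry uy] : r \notin ys /\ uniq ys by move: uxs; rewrite rcons_uniq => /andP.
have memxs r' : (r' \in rcons ys r) = (r' == r) || (r' \in ys) by rewrite mem_rcons inE.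
pose v k := nu (rcons ys r) k c; pose v' k := nu ys k c.
have vE k : v k = v' k + charge c r k by rewrite /v nu_rcons.
have st : step_ok r v' v by apply: (gxs ys r [::]); rewrite cats1.
have dom' (k l : 'I_n) : (k < l)%N -> v' l <= v' k.
  move=> kl; rewrite /v'; case/lastP: (ys) gxs => [|ys' r'] g.
    by rewrite /nu !big_nil.
  have e : rcons (rcons ys' r') r = ys' ++ [:: r'; r] by rewrite -!cats1 -catA.
  by case: (g _ _ _ e k l kl).
(* Outside the columns between [-L] and [L] the diagrams [v] and [v'] agree, so finitely many column
   steps suffice. *)
have [L [vL vL']] : exists L : nat, (forall k, (`|v k| <= L)%N) /\ forall k, (`|v' k| <= L)%N.
  exists (\sum_k (`|v k| + `|v' k|))%N; split=> k; rewrite (bigD1 k) //=; lia.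
have gT : gvalid (fun r' k => if r' == r then charge c r k else T r' k).
  by move=> r' k; case: eqP => [->|_]; [apply: gvalid_charge|apply: vT].
set T' := (fun _ _ => _) in gT.
have vpos : 0 < r -> forall k, v' k <= v k.
  by move=> h k; rewrite vE; have [/(_ h)] := gvalid_charge c r k; lia.
have vneg : r <= 0 -> forall k, v k <= v' k.
  by move=> h k; rewrite vE; have [_ /(_ h)] := gvalid_charge c r k; lia.
have vferm : ferm r -> forall k, (`|v k - v' k| <= 1)%N.
  by move=> h k; rewrite vE; have [_ _ /(_ h)] := gvalid_charge c r k; lia.
have strip : hodd r -> forall k l : 'I_n, (k < l)%N ->
     if 0 < r then v l <= v' k else v' l <= v k.
  by move=> h k l kl; have [_ /(_ h)] := st k l kl.
have rc : uncol M r = None by apply: cxs; rewrite memxs eqxx.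
have [W1 [W1a W1b W1c W1d]] := stage_words R L rc vpos vneg vferm dom' strip vT (L + L).
rewrite (_ : - L%:Z + (L + L)%:Z = L%:Z) in W1c W1d; last by lia.
have midL k t : t = L%:Z -> Num.min t (v k) - Num.min t (v' k) = charge c r k.
  by move=> ->; have := vL k; have := vL' k; have := vE k; lia.
have midE : mid M r v v' T L%:Z = conf_of (baseg M (fun _ => v') T').
  apply: charge_inj => r' k; rewrite charge_mid // charge_conf_of; last exact: baseg_valid.
  rewrite /baseg; case E: (uncol _ _) => [z|].
    by case: ifP => // hz; have := vL k; have := vL' k; lia.
  by rewrite /midT /T'; case: eqP => // _; exact: midL.
have midE0 : mid M r v v' T (- L%:Z) = conf_of (baseg M (fun _ => v) T).
  apply: charge_inj => r' k; rewrite charge_mid // charge_conf_of; last exact: baseg_valid.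
  rewrite /baseg; case E: (uncol _ _) => [z|].
    by case: ifP => // hz; have := vL k; have := vL' k; lia.
  rewrite /midT; case: eqP => // ->; rewrite T0 ?memxs ?eqxx //.
  by have := vL k; have := vL' k; lia.
rewrite midE0 midE in W1c; rewrite midE0 in W1d.
have [|||W2 [W2a W2b /=]] := IH T' uy _ _ gT.
- by move=> r' h; apply: cxs; rewrite memxs h orbT.
- by move=> ys1 r1 zs1 e; apply: (gxs ys1 r1 (rcons zs1 r)); rewrite e rcons_cat.
- move=> r' k h; rewrite /T' ifF; last by apply: contraNF ry => /eqP <-.
  by apply: T0; rewrite memxs h orbT.
set b' := conf_of (baseg M (fun _ => v') T') in W1c *.
rewrite (_ : (fun r0 k => if r0 \in ys then _ else T' r0 k) =
  (fun r0 k => if r0 \in rcons ys r then charge c r0 k else T r0 k)); last first.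
  apply/funext => r0; apply/funext => k; rewrite memxs /T'.
  by case: eqP => [->|_] //=; rewrite (negbTE ry).
set tg := conf_of (baseg M _ _) => -[W2c W2d].
have gtg : gvalid (fun r0 k => if r0 \in rcons ys r then charge c r0 k else T r0 k).
  by move=> r0 k; case: ifP => _; [apply: gvalid_charge|apply: vT].
have gamb' k : charge b' r k = charge c r k.
  by rewrite charge_conf_of; [rewrite /baseg rc /T' eqxx|exact: baseg_valid].
have gamtg r0 k : r0 \in rcons ys r -> charge tg r0 k = charge c r0 k.
  move=> h; rewrite charge_conf_of; last exact: baseg_valid.
  by rewrite /baseg cxs // h.
have W2r : ~~ touched W2 r.
  apply/negP => /W2b[h|[z e]]; first by rewrite h in ry.
  by move: rc; rewrite e uncol_scol.
exists (W2 ++ W1); split.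
- by rewrite all_cat W2a.
- move=> r0; rewrite /touched has_cat => /orP[/W2b|/W1b] [h|h]; try by right.
    by left; rewrite memxs h orbT.
  by left; rewrite memxs h eqxx.
rewrite /= applyw_cat; set g := applyw W1 _ in W1c W1d *.
have ge : g = g b' *: delta R b' + (g - g b' *: delta R b') by rewrite addrC subrK.
(* These terms already have a larger [phi r], and [W2] does not change the charges at [r]. *)
have rest d : applyw W2 (g - g b' *: delta R b') d != 0 -> phi r c < phi r d.
  case/applyw_supp => d1 hd1 /(_ r) e.
  have phid : phi r d = phi r d1.
    by rewrite /phi; congr (- _); apply: eq_bigr => k _; rewrite e.
  have phib : phi r b' = phi r c.
    by rewrite /phi; congr (- _); apply: eq_bigr => k _; rewrite gamb'.
  rewrite phid -phib; move: hd1; rewrite fockD fockN fockZ /delta.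
  have [->|ne] := eqVneq d1 b'; first by rewrite mulr1 subrr eqxx.
  by rewrite mulr0 subr0; case: W1c => _ h /h[e1|//]; rewrite e1 eqxx in ne.
have fE d : applyw W2 g d = g b' * applyw W2 (delta R b') d
     + applyw W2 (g - g b' *: delta R b') d.
  by rewrite {1}ge linearP fockE.
split.
  rewrite fE; have [->|/rest] := eqVneq (applyw W2 (g - g b' *: delta R b') tg) 0.
    by rewrite addr0 mulf_neq0 //; case: W1c.
  have -> : phi r tg = phi r c; last by rewrite ltxx.
  by rewrite /phi; congr (- _); apply: eq_bigr => k _; rewrite gamtg // memxs eqxx.
move=> d; rewrite fE.
have [->|/rest lt _] := eqVneq (applyw W2 (g - g b' *: delta R b') d) 0; last first.
  by right; exists ys, r, [::]; rewrite cats1.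
rewrite addr0 mulf_eq0 negb_or => /andP[_ hd].
case: (W2d d hd) => [|[ys1 [r1 [zs1 [e h1 h2]]]]]; [by left|right].
exists ys1, r1, (rcons zs1 r); split=> //; first by rewrite e rcons_cat.
move=> r' k; rewrite mem_rcons inE => /orP[/eqP ->|]; last exact: h1.
by case/applyw_supp: hd => d1 /delta_supp -> ->.
Qed.
End LeadWords.

(** * The space of singular vectors *)

(* The order of the indices is that of successively removing the letters of T- and
   adding those of T+. *)
Definition chain (w : nat) : seq halfZ :=
  [seq (- (i%:Z) : halfZ) | i <- iota 0 w.+1] ++ [seq (i%:Z : halfZ) | i <- iota 1 w].

Lemma mem_chain w r : (r \in chain w) = (`|r| <= w)%N.
Proof.
rewrite mem_cat; apply/orP/idP => [h|h].
  by case: h => h; case/seq.mapP: h => i; rewrite mem_iota => hi ->; lia.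
case: (lerP r 0) => h0; [left|right]; apply/seq.mapP; exists `|r|%N; rewrite ?mem_iota; lia.
Qed.

Lemma chain_uniq w : uniq (chain w).
Proof.
rewrite cat_uniq !map_inj_uniq ?iota_uniq ?andbT ?andTb; first last.
- by move=> i j; lia.
- by move=> i j; lia.
apply/hasPn => r h; have r0 : 0 < r by case/seq.mapP: h => i; rewrite mem_iota => hi ->; lia.
apply/negP => h'; have : r <= 0 by case/seq.mapP: h' => i; rewrite mem_iota => hi ->; lia.
by rewrite leNgt r0.
Qed.
#[export] Hint Resolve chain_uniq : core.

Lemma big_chain_widen (V : nmodType) (F : halfZ -> V) w w' : (w <= w')%N ->
  (forall r : halfZ, (w < `|r|)%N -> F r = 0) ->
  \sum_(r <- chain w') F r = \sum_(r <- chain w) F r.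
Proof.
move=> ww F0; rewrite (bigID (fun r : halfZ => (`|r| <= w)%N)) /=.
rewrite [X in _ + X]big1 ?addr0 => [|r]; last by rewrite -ltnNge; exact: F0.
rewrite -big_filter; apply: perm_big; apply: uniq_perm => //; first exact: filter_uniq.
by move=> r; rewrite mem_filter !mem_chain; lia.
Qed.

Section Singular.
Variables (R : realType) (n : nat).
Local Notation C := R[i].
Local Notation fock := (fock R n).
Local Notation conf := (conf n).
Implicit Types (f g : fock) (c d : conf) (lam : 'I_n -> int).

Definition inW (w : nat) (c : conf) := forall r k, (w < `|r|)%N -> charge c r k = 0.

Lemma inW_le w w' c : (w <= w')%N -> inW w c -> inW w' c.
Proof. by move=> ww h r k hr; apply: h; apply: leq_ltn_trans hr. Qed.

Lemma moved_inW w c c' m m' : moved c c' m m' -> (`|m.1| <= w)%N -> (`|m'.1| <= w)%N ->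
  inW w c' -> inW w c.
Proof.
case: m m' => [r1 k1] [r2 k2] mv /= h1 h2 hc r k hr; rewrite mv hc // !xpair_eqE.
have -> : (r == r1) = false by apply/negbTE/eqP => e; move: hr; rewrite e; lia.
have -> : (r == r2) = false by apply/negbTE/eqP => e; move: hr; rewrite e; lia.
by rewrite subr0.
Qed.

Lemma moved_nuE S c c' i j k p : moved c c' (i, k) (j, k) -> uniq S ->
  i \in S -> j \in S -> nu S p c = nu S p c'.
Proof.
move=> mv uS iS jS; rewrite /nu; under eq_bigr do rewrite mv !xpair_eqE.
rewrite sumrB big_split /=.
have s (q : halfZ) (b : bool) : q \in S -> \sum_(r <- S) ((r == q) && b)%:Z = b%:Z.
  by move=> qS; rewrite (bigD1_seq q) //= eqxx big1 ?addr0 // => r /negbTE ->.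
by rewrite !s // addrK.
Qed.

Lemma nu_widen w w' k c : (w <= w')%N -> inW w c -> nu (chain w') k c = nu (chain w) k c.
Proof. by move=> ww hc; apply: big_chain_widen => // r; exact: hc. Qed.

(** Beyond the window all charges vanish, and moving a unit between two colors there would give
    charges of opposite signs at one index. *)
Lemma gl_widen w w' (k l : 'I_n) f : (w <= w')%N -> k != l -> (forall c, f c != 0 -> inW w c) ->
  gl (chain w') k l f = gl (chain w) k l f.
Proof.
move=> ww kl hf; apply: big_chain_widen => // r hr; apply/funext => c.
apply/eqP; apply: contraT => /X_supp[c' /hf hc' mv].
have kl1 : ((r, k) == (r, l)) = false by rewrite xpair_eqE eqxx; exact/negbTE.
have lk1 : ((r, l) == (r, k)) = false by rewrite eq_sym.
have := mv r k; have := mv r l; rewrite !hc' // !eqxx kl1 lk1.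
have [] := gvalid_charge c r k; have [] := gvalid_charge c r l.
case: (ltP 0 r) => _; lia.
Qed.

(** The window replaces the infinite sums of gl_n; by [Hw_change] its size is immaterial once it
    contains the support. *)
Definition Hw lam w f := [/\ fin f, forall c, f c != 0 -> inW w c,
  forall k l : 'I_n, (k < l)%N -> gl (chain w) k l f = 0 &
  forall c, f c != 0 -> forall k, nu (chain w) k c = lam k].

Definition H lam f := exists w, Hw lam w f.

Lemma ord_neq (k l : 'I_n) : (k < l)%N -> k != l.
Proof. by apply: contraTneq => ->; rewrite ltnn. Qed.

Lemma Hw_change lam w w' f : (w <= w')%N -> (forall c, f c != 0 -> inW w c) ->
  Hw lam w f <-> Hw lam w' f.
Proof.
move=> ww hf; split=> -[h1 h2 h3 h4]; split=> //.
- by move=> c /hf; exact: inW_le.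
- by move=> k l kl; rewrite (gl_widen ww) ?ord_neq // h3.
- by move=> c fc k; rewrite (nu_widen k ww (hf c fc)) h4.
- by move=> k l kl; rewrite -(gl_widen ww) ?ord_neq // h3.
- by move=> c fc k; rewrite -(nu_widen k ww (hf c fc)) h4.
Qed.

Lemma Hw_widen lam w w' f : (w <= w')%N -> Hw lam w f -> Hw lam w' f.
Proof. by move=> ww hf; apply/(Hw_change _ ww); case: hf. Qed.

Lemma H_Hw lam w f : (forall c, f c != 0 -> inW w c) -> H lam f -> Hw lam w f.
Proof.
move=> hf [w' h]; case: (leqP w w') => ww; first exact/(Hw_change _ ww hf).
by apply: Hw_widen h; exact: ltnW.
Qed.

Lemma Hw0 lam w : Hw lam w 0.
Proof.
split; first exact: fin0.
- by move=> c; rewrite fock0 eqxx.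
- by move=> k l _; rewrite linear0.
- by move=> c; rewrite fock0 eqxx.
Qed.

Lemma HwP lam w a f g : Hw lam w f -> Hw lam w g -> Hw lam w (a *: f + g).
Proof.
move=> [f1 f2 f3 f4] [g1 g2 g3 g4].
have supp c : (a *: f + g) c != 0 -> f c != 0 \/ g c != 0.
  rewrite fockE; have [->|] := eqVneq (f c) 0; last by left.
  by rewrite mulr0 add0r; right.
split; first exact: finP.
- by move=> c /supp[/f2|/g2].
- by move=> k l kl; rewrite linearP /= f3 // g3 // scaler0 addr0.
- by move=> c /supp[/f4|/g4].
Qed.

Lemma HP lam a f g : H lam f -> H lam g -> H lam (a *: f + g).
Proof.
move=> [w hf] [w' hg]; exists (maxn w w').
by apply: HwP; [apply: Hw_widen hf|apply: Hw_widen hg]; rewrite ?leq_maxl ?leq_maxr.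
Qed.

Lemma H0 lam : H lam 0.
Proof. by exists 0%N; exact: Hw0. Qed.

Lemma HZ lam a f : H lam f -> H lam (a *: f).
Proof. by move=> h; rewrite -[_ *: _]addr0; apply: HP => //; exact: H0. Qed.

Lemma H_sum lam I (s : seq I) (P : pred I) (F : I -> fock) :
  (forall i, P i -> H lam (F i)) -> H lam (\sum_(i <- s | P i) F i).
Proof.
move=> h; elim/big_ind: _ => //; first exact: H0.
by move=> f g hf hg; rewrite -[f]scale1r; exact: HP.
Qed.

Lemma Hw_E lam w i j f : (`|i| <= w)%N -> (`|j| <= w)%N -> Hw lam w f -> Hw lam w (E i j f).
Proof.
move=> iw jw [f1 f2 f3 f4]; have [iC jC] : i \in chain w /\ j \in chain w by rewrite !mem_chain.
split; first exact: fin_E.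
- by move=> c /E_supp[k [c' /f2 hc' mv]]; apply: moved_inW mv _ _ hc'.
- by move=> k l kl; rewrite gl_E // f3 // linear0.
- by move=> c /E_supp[k [c' /f4 hc' mv]] p; rewrite (moved_nuE p mv).
Qed.

Lemma H_E lam i j f : H lam f -> H lam (E i j f).
Proof.
move=> [w hf]; exists (maxn w (maxn `|i| `|j|)).
apply: Hw_E; [lia|lia|]; apply: Hw_widen hf; lia.
Qed.

Lemma H_applyw lam W f : H lam f -> H lam (applyw W f).
Proof. by move=> hf; elim: W => //= p W; exact: H_E. Qed.

Definition hascontent (eta : halfZ -> int) f := forall c, f c != 0 -> forall r, wt r c = eta r.

Lemma wt_eq0 r c : wt r c = 0 -> forall k, charge c r k = 0.
Proof.
move=> h k; have [r0|r0] := ltP 0 r.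
  move/eqP: h; rewrite /wt psumr_eq0 => [/allP/(_ k)|p _]; last by case: (gvalid_charge c r p) => /(_ r0).
  by rewrite mem_index_enum => /(_ isT)/eqP.
move/eqP: h; rewrite /wt -oppr_eq0 -sumrN psumr_eq0 => [/allP/(_ k)|p _].
  by rewrite mem_index_enum => /(_ isT); rewrite oppr_eq0 => /eqP.
by rewrite oppr_ge0; case: (gvalid_charge c r p) => _ /(_ r0).
Qed.

Lemma content_inW w (eta : halfZ -> int) c : (forall r : halfZ, (w < `|r|)%N -> eta r = 0) ->
  (forall r, wt r c = eta r) -> inW w c.
Proof. by move=> h hc r k hr; apply: wt_eq0; rewrite hc h. Qed.

(** The charges at one index all have the same sign, so the content bounds each of them. *)
Lemma finite_content w (eta : halfZ -> int) :
  finite_set [set c : conf | inW w c /\ forall r, wt r c = eta r].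
Proof.
pose B := (\sum_(r <- chain w) `|eta r|)%N.
pose T := {ffun 'I_(size (chain w)) * 'I_n -> 'I_B.+1}.
pose g (t : T) := conf_of (fun r k =>
   if insub (index r (chain w)) is Some i then
     (if 0 < r then (t (i, k))%:Z else - (t (i, k))%:Z) else 0).
apply: (@sub_finite_set _ _ (g @` setT)); last exact/finite_image/finite_finset.
move=> c [cW hc] /=.
have cB r k : r \in chain w -> (c r k < B.+1)%N.
  move=> rC; rewrite ltnS /B (bigD1_seq r rC (chain_uniq w)) -(hc r) /=.
  apply: (@leq_trans `|wt r c|%N); last exact: leq_addr.
  have sum_le (F : 'I_n -> int) : (forall p, 0 <= F p) -> F k <= \sum_p F p.
    by move=> F0; rewrite (bigD1 k) //= lerDl sumr_ge0.
  have [r0|r0] := ltP 0 r.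
    have := sum_le (charge c r); rewrite -/(wt r c) => h.
    have /h : forall p, 0 <= charge c r p by move=> p; case: (gvalid_charge c r p) => /(_ r0).
    by rewrite /charge r0; lia.
  have := sum_le (fun p => - charge c r p); rewrite sumrN -/(wt r c) => h.
  have /h : forall p, 0 <= - charge c r p.
    by move=> p; rewrite oppr_ge0; case: (gvalid_charge c r p) => _ /(_ r0).
  by rewrite /charge ltNge r0 /=; lia.
pose t : T := [ffun ik : 'I_(size (chain w)) * 'I_n =>
  inord (c (nth (0 : halfZ) (chain w) ik.1) ik.2)].
exists t => //.
have e r k : (if insub (index r (chain w)) is Some i then
     (if 0 < r then (t (i, k))%:Z else - (t (i, k))%:Z) else 0) = charge c r k.
  case: insubP => [i|].
    by rewrite index_mem => rC ei; rewrite ffunE /= ei nth_index // inordK ?cB.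
  by rewrite index_mem mem_chain -ltnNge => hr; rewrite cW.
apply: charge_inj => r k; rewrite charge_conf_of; first exact: e.
by move=> r' k'; rewrite e; exact: gvalid_charge.
Qed.
End Singular.

Lemma lexlt_cat (s : seq int) a b (u u' : seq int) : a < b ->
  ((s ++ a :: u : seqlexi int) < s ++ b :: u')%O.
Proof.
move=> ab; elim: s => [|x s IH] /=; first by rewrite ltxi_cons (ltW ab) leNgt ab.
by rewrite ltxi_cons !lexx.
Qed.

(** * Words applied to the packed configuration *)

Section Basis.
Variables (R : realType) (n : nat) (lam : 'I_n -> int).
Local Notation C := R[i].
Local Notation fock := (fock R n).
Local Notation conf := (conf n).
Implicit Types (f g : fock) (c d : conf).
Hypothesis domlam : forall k l : 'I_n, (k < l)%N -> lam l <= lam k.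

Definition good w c := [/\ inW w c, forall k, nu (chain w) k c = lam k
  & good_upto (chain w) c].

Lemma Hw_good w f : Hw lam w f -> f != 0 -> exists2 c, f c != 0 & good w c.
Proof.
move=> [f1 f2 f3 f4] f0; have [|c fc gc] := singular_good (chain_uniq w) f1 f0 f3.
  by move=> c c' k fc fc'; rewrite !f4.
by exists c => //; split; [exact: f2|exact: f4|].
Qed.

(* No particle in the window: the fermions beyond [M] carry the whole diagram. *)
Definition cfg0 (M : nat) : conf := conf_of (baseg M (fun _ k => lam k) (fun _ _ => 0)).

Lemma gvalid0 : gvalid (fun (_ : halfZ) (_ : 'I_n) => 0).
Proof. by move=> r k. Qed.

Lemma charge_cfg0 M r k : charge (cfg0 M) r k =
  if uncol M r is Some z then (z <= lam k)%R%:Z - (z <= 0)%R%:Z else 0.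
Proof. by rewrite charge_conf_of //; exact/baseg_valid/gvalid0. Qed.

Definition prec w c d := exists ys r zs,
  [/\ chain w = ys ++ r :: zs, forall r' k, r' \in zs -> charge d r' k = charge c r' k
    & phi r c < phi r d].

(** A key in a total order, turning [prec] into a strict inequality so that a minimum can be taken
    in [content_basis]. *)
Definition key w c : seqlexi int := [seq phi r c | r <- rev (chain w)].

Lemma prec_key w c d : prec w c d -> (key w c < key w d)%O.
Proof.
move=> [ys [r [zs [e h lt]]]]; rewrite /key e rev_cat rev_cons cat_rcons !map_cat /=.
have -> : [seq phi r' d | r' <- rev zs] = [seq phi r' c | r' <- rev zs].
  apply/eq_in_map => r'; rewrite mem_rev => hr'.
  by rewrite /phi; congr (- _); apply: eq_bigr => k _; rewrite h.
exact: lexlt_cat.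
Qed.

Definition leading w M c W :=
  [/\ all (fun p => p.1 != p.2) W, applyw W (delta R (cfg0 M)) c != 0 &
   forall d, applyw W (delta R (cfg0 M)) d != 0 -> d = c \/ prec w c d].

Lemma good_leading w M c : (w <= M)%N -> good w c -> exists W, leading w M c W.
Proof.
move=> wM [cW cnu cg].
have [|W [W1 _ /=]] := lead_words (M := M) R (chain_uniq w) _ cg gvalid0 (fun _ _ _ => erefl).
  by move=> r; rewrite mem_chain => hr; apply: uncol_window; exact: leq_trans wM.
rewrite (_ : (fun _ k => nu (chain w) k c) = (fun _ k => lam k)); last first.
  by apply/funext => z; apply/funext => k.
set tg := conf_of (baseg M (fun _ _ => 0) _); have -> : tg = c.
  apply: charge_inj => r k; rewrite charge_conf_of; last first.
    by apply: baseg_valid => r' k'; case: ifP => _; [apply: gvalid_charge|apply: gvalid0].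
  rewrite /baseg mem_chain; case E: (uncol M r) => [z|].
    by rewrite subrr cW // ltnNge; apply/negP => hr; rewrite uncol_window // in E; exact: leq_trans wM.
  by case: leqP => // hr; rewrite cW.
by move=> [h1 h2]; exists W.
Qed.

Lemma cfg0_inW M : exists w, inW w (cfg0 M).
Proof.
exists (\sum_k `|lam k| + M + 1 + \sum_k `|lam k| + M + 1)%N => r k hr.
rewrite charge_cfg0; case E: (uncol M r) => [z|] //.
have : (`|lam k| <= \sum_k `|lam k|)%N by rewrite (bigD1 k) //= leq_addr.
move: hr; rewrite (scolK E) /scol; case: ifP; lia.
Qed.

(** By dominance the colors whose row reaches a given column form an initial segment, so a raising
    move meets a fermion already in place, or a missing antiparticle. *)
Lemma gl_cfg0 M S (k l : 'I_n) : (k < l)%N -> gl S k l (delta R (cfg0 M)) = 0.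
Proof.
move=> kl; apply/funext => c; apply/eqP; apply: contraT => /gl_supp[r _ [c' /delta_supp -> mv]].
have kl1 : ((r, k) == (r, l)) = false by rewrite xpair_eqE eqxx; exact/negbTE/ord_neq.
have lk1 : ((r, l) == (r, k)) = false by rewrite eq_sym.
have := mv r k; have := mv r l; rewrite !eqxx kl1 lk1 !charge_cfg0.
have := domlam kl; have [h1 h2 h3] := gvalid_charge c r k; have [h4 h5 h6] := gvalid_charge c r l.
move: h1 h2 h3 h4 h5 h6; case E: (uncol M r) => [z|]; last first.
  by case: (ltP 0 r) => _; lia.
have := ferm_scol M z; rewrite -(scolK E) => ->.
have -> : (z <= 0) = ~~ (0 < r) by rewrite leNgt [in RHS](scolK E) scol_gt0.
by case: (ltP 0 r) => _ h1 h2 h3 h4 h5 h6; lia.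
Qed.

Lemma applyw_nu W f d : applyw W f d != 0 ->
  exists2 d', f d' != 0 & exists w0, forall w k, (w0 <= w)%N -> nu (chain w) k d = nu (chain w) k d'.
Proof.
elim: W d => [|p W IH] d /=; first by exists d => //; exists 0%N.
case/E_supp => k [d1 /IH[d' fd' [w0 h]] mv]; exists d' => //.
exists (maxn w0 (maxn `|p.1| `|p.2|)) => w q hw.
rewrite (moved_nuE q mv) ?mem_chain //; [apply: h|..]; lia.
Qed.

(** The gl_n-weight of [cfg0] is not computed: some word leads from it to the good configuration
    [c], and the e_ij preserve the weight. *)
Lemma H_cfg0 w M c : (w <= M)%N -> good w c -> H lam (delta R (cfg0 M)).
Proof.
move=> wM gc; have [W [_ W2 _]] := good_leading wM gc.
have [d' /delta_supp -> [w0 hw0]] := applyw_nu W2.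
have [w1 h1] := cfg0_inW M; exists (maxn w (maxn w0 w1)); split.
- exact: fin_delta.
- by move=> d /delta_supp ->; apply: inW_le h1; lia.
- by move=> k l kl; rewrite gl_cfg0.
- move=> d /delta_supp -> k; rewrite -hw0; last lia.
  by case: gc => cW cnu _; rewrite (nu_widen k (leq_maxl _ _) cW).
Qed.

(** At each index [cfg0] uses the smallest colors, so it maximises [phi r] among configurations of
    its content. The sum of [phi r] over the window depends only on the gl_n-weight, which forces
    equality at every index. *)
Lemma cfg0_unique M w d : Hw lam w (delta R (cfg0 M)) -> inW w d ->
  (forall k, nu (chain w) k d = lam k) -> (forall r, wt r d = wt r (cfg0 M)) -> d = cfg0 M.
Proof.
move=> [_ /(_ (cfg0 M)) hW _ /(_ (cfg0 M)) hnu] dW dnu dwt.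
have d0 : delta R (cfg0 M) (cfg0 M) != 0 by rewrite /delta eqxx oner_eq0.
pose S c := \sum_(r <- chain w) phi r c.
have SE c : (forall k, nu (chain w) k c = lam k) -> S c = - \sum_(k < n) k%:Z * lam k.
  move=> hc; rewrite /S /phi sumrN exchange_big /=; congr (- _); apply: eq_bigr => k _.
  by rewrite -mulr_sumr -hc.
have le r : (forall k, charge d r k = charge (cfg0 M) r k) \/ phi r d < phi r (cfg0 M).
  case E: (uncol M r) => [z|]; last first.
    left=> k; have g0 p : charge (cfg0 M) r p = 0 by rewrite charge_cfg0 E.
    by rewrite g0; apply: wt_eq0; rewrite dwt /wt big1 // => p _; rewrite g0.
  have gd k : exists b : bool, charge d r k = b%:Z - (z <= 0)%R%:Z.
    have [h1 h2] := gvalid_charge d r k.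
    have -> : ferm r by rewrite (scolK E) ferm_scol.
    move=> h3; have -> : (z <= 0) = ~~ (0 < r) by rewrite leNgt [in RHS](scolK E) scol_gt0.
    exists (charge d r k == 1 - (~~ (0 < r))%:Z); move: h1 h2 h3.
    by case: (ltP 0 r) => _; case: eqP; lia.
  pose A := [set k | z <= lam k]%SET; pose B := [set k | charge d r k == 1 - (z <= 0)%R%:Z]%SET.
  have eA k : charge (cfg0 M) r k = (k \in A)%:Z - (z <= 0)%R%:Z by rewrite charge_cfg0 E inE.
  have eB k : charge d r k = (k \in B)%:Z - (z <= 0)%R%:Z.
    by rewrite inE; have [b ->] := gd k; case: b; case: eqP; lia.
  have sc (D : {set 'I_n}) : \sum_(k < n) (k \in D)%:Z = #|D|%:Z.
    by rewrite -sum1_card (big_morph Posz PoszD (erefl _)) [RHS]big_mkcond; apply: eq_bigr => k _; case: (k \in D).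
  have cAB : #|A| = #|B|.
    move: (dwt r); rewrite /wt; under eq_bigr do rewrite eB.
    under [in RHS]eq_bigr do rewrite eA.
    by rewrite !sumrB !sc => /addIr [].
  have ps c (D : {set 'I_n}) : (forall k, charge c r k = (k \in D)%:Z - (z <= 0)%R%:Z) ->
      phi r c = - sumk D + \sum_(k < n) k%:Z * (z <= 0)%R%:Z.
    move=> h; rewrite /phi; under eq_bigr do rewrite h mulrBr.
    rewrite sumrB opprB addrC; congr (- _ + _); rewrite /sumk [RHS]big_mkcond.
    by apply: eq_bigr => k _; case: (k \in D); rewrite ?mulr1 ?mulr0.
  case: (sumk_le cAB) => [a b|eAB|lt]; last 2 first.
  - by left=> k; rewrite eA eB eAB.
  - by right; rewrite (ps _ _ eA) (ps _ _ eB); lia.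
  rewrite inE => /andP[bB aA]; rewrite inE => /andP[bA _]; move: aA bA; rewrite !inE => aA bA.
  case: (ltngtP a b) => [//|/domlam|/val_inj ab]; first lia.
  by rewrite -ab aA in bA.
have eS : S d = S (cfg0 M) by rewrite !SE //; exact: hnu.
apply: charge_inj => r k; have [hr|hr] := leqP `|r| w; last first.
  by rewrite dW // hW.
have rC : r \in chain w by rewrite mem_chain.
case: (le r) => // lt; exfalso.
have : S d < S (cfg0 M); last by rewrite eS ltxx.
rewrite /S (bigD1_seq r rC (chain_uniq w)) [X in _ < X](bigD1_seq r rC (chain_uniq w)) /=.
apply: ltr_leD => //; apply: ler_sum => r' _.
case: (le r') => [h|/ltW //].
rewrite le_eqVlt; apply/orP; left; apply/eqP; rewrite /phi; congr (- _).
by apply: eq_bigr => p _; rewrite h.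
Qed.

Definition shiftw (W : seq (halfZ * halfZ)) (r : halfZ) : int :=
  \sum_(p <- W) ((r == p.1)%:Z - (r == p.2)%:Z).
Definition adjw (W : seq (halfZ * halfZ)) := rev [seq (p.2, p.1) | p <- W].

Lemma applyw_content W f eta : hascontent eta f ->
  hascontent (fun r => eta r + shiftw W r) (applyw W f).
Proof.
move=> hf; elim: W => [|p W IH] c /=.
  by move=> /hf h r; rewrite /shiftw big_nil addr0 h.
move=> /E_supp[k [c' /IH h mv]] r.
by rewrite (moved_wt r mv) h /shiftw big_cons; ring.
Qed.

Lemma shiftw_adj W r : shiftw (adjw W) r = - shiftw W r.
Proof.
rewrite /shiftw /adjw big_rev /= big_map -sumrN; apply: eq_bigr => p _ /=; ring.
Qed.

(** The adjoint word reverses the order and transposes each letter; the accumulated signs enter the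
    nonzero scalar [x]. *)
Lemma dot_applyw W f g : all (fun p => p.1 != p.2) W -> fin f -> fin g ->
  exists2 x : C, x != 0 & dot f (applyw W g) = x * dot (applyw (adjw W) f) g.
Proof.
elim: W f => [|p W IH] f /=; first by exists 1; rewrite ?oner_eq0 // mul1r.
move=> /andP[np nW] ff fg; have [|x x0 hx] := IH (E p.2 p.1 f) nW _ fg; first exact: fin_E.
have fW := fin_applyw W fg.
exists (ksgn R p.1 * ksgn R p.2 * x).
  have k0 r : ksgn R r != 0.
    by have := ksgn2 R r; case: eqP => // ->; rewrite mul0r => /eqP; rewrite eq_sym oner_eq0.
  by rewrite !mulf_neq0.
have -> : applyw (adjw (p :: W)) f = applyw (adjw W) (E p.2 p.1 f).
  by rewrite /adjw /= rev_cons -cats1 applyw_cat.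
rewrite -mulrA -hx dot_E 1?eq_sym // mulrA.
rewrite [X in X * _](_ : _ = (ksgn R p.1 * ksgn R p.1) * (ksgn R p.2 * ksgn R p.2)); last by ring.
by rewrite !ksgn2 !mul1r.
Qed.
End Basis.

(** * Bases of the weight spaces and irreducibility of H *)

Section Irreducible.
Variables (R : realType) (n : nat) (lam : 'I_n -> int).
Local Notation C := R[i].
Local Notation fock := (fock R n).
Local Notation conf := (conf n).
Implicit Types (f g : fock) (c d : conf).
Hypothesis domlam : forall k l : 'I_n, (k < l)%N -> lam l <= lam k.
Local Notation good := (good lam).
Local Notation cfg0 := (cfg0 lam).

Lemma neq0_supp f : f != 0 -> exists c, f c != 0.
Proof.
move=> f0; apply: contrapT => h; move/eqP: f0; apply; apply/funext => c.
by apply/eqP; apply: contrapT => /negP hc; apply: h; exists c.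
Qed.

Definition enumerates (gs : seq conf) w (eta : halfZ -> int) :=
  uniq gs /\ forall c, c \in gs <-> good w c /\ forall r, wt r c = eta r.

Lemma exists_enum w eta : exists gs, enumerates gs w eta.
Proof.
have fs : finite_set [set c | good w c /\ forall r, wt r c = eta r].
  by apply: sub_finite_set (finite_content n w eta) => c [[cW _ _] h].
exists (fset_set [set c | good w c /\ forall r, wt r c = eta r]); split; first exact: fset_uniq.
by move=> c; rewrite in_fset_set // inE.
Qed.

Lemma hascontentP eta a f g : hascontent eta f -> hascontent eta g ->
  hascontent eta (a *: f + g).
Proof.
move=> hf hg c; rewrite fockE; have [->|fc] := eqVneq (f c) 0; last by move=> _; exact: hf.
by rewrite mulr0 add0r; exact: hg.
Qed.

Lemma hascontent0 eta : hascontent eta (0 : fock).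
Proof. by move=> c; rewrite fock0 eqxx. Qed.

Lemma hascontent_sum eta I (s : seq I) (P : pred I) (a : I -> C) (F : I -> fock) :
  (forall i, hascontent eta (F i)) -> hascontent eta (\sum_(i <- s | P i) a i *: F i).
Proof.
move=> h; elim/big_rec: _ => [|i g _ hg]; first exact: hascontent0.
exact: hascontentP.
Qed.

(** The values of the words on the good configurations form a matrix which is triangular for [key]
    with nonzero diagonal, hence invertible. It yields a combination agreeing with [f] on all good
    configurations, and their difference is zero by [Hw_good]. *)
Lemma content_basis w M eta gs : (w <= M)%N -> (forall r : halfZ, (w < `|r|)%N -> eta r = 0) ->
  enumerates gs w eta ->
  exists b : 'I_(size gs) -> fock,
  [/\ forall i, exists W, all (fun p => p.1 != p.2) W /\ b i = applyw W (delta R (cfg0 M)),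
      forall i, H lam (b i) /\ hascontent eta (b i) &
      forall f, H lam f -> hascontent eta f ->
        exists! x : 'rV[C]_(size gs), f = \sum_i x 0 i *: b i].
Proof.
move=> wM eta0 [ugs hgs].
have /choice[W hW] : forall c, exists W, good w c -> leading R lam w M c W.
  move=> c; have [gc|ngc] := pselect (good w c); last by exists [::].
  by have [W hW] := good_leading R wM gc; exists W.
pose cc (i : 'I_(size gs)) := nth (cfg0 M) gs i.
have ccP i : good w (cc i) /\ forall r, wt r (cc i) = eta r by apply/hgs/mem_nth.
have cc_inj : injective cc.
  by move=> i j /eqP; rewrite nth_uniq // => /eqP; exact: val_inj.
pose b i := applyw (W (cc i)) (delta R (cfg0 M)).
have bH i : H lam (b i).
  by apply: H_applyw; apply: (H_cfg0 R domlam wM (proj1 (ccP i))).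
have bcont i : hascontent eta (b i).
  have [_ h1 _] := hW _ (proj1 (ccP i)).
  have h0 : hascontent (fun r => wt r (cfg0 M)) (delta R (cfg0 M)) by move=> c /delta_supp ->.
  by move=> c /(applyw_content h0) h r; rewrite h -(applyw_content h0 h1) (proj2 (ccP i)).
pose A := \matrix_(i, j) b i (cc j).
have sumE (x : 'rV[C]_(size gs)) j : (\sum_i x 0 i *: b i) (cc j) = (x *m A) 0 j.
  by rewrite fock_sum mxE; apply: eq_bigr => i _; rewrite mxE fockZ.
have uA : A \in unitmx.
  rewrite -row_free_unit; apply: inj_row_free => v vA; apply/eqP; apply: contraT => v0.
  have [i0 vi0] : exists i0, v 0 i0 != 0.
    apply/existsP; apply: contraNT v0; rewrite negb_exists => /forallP h.
    by apply/eqP/rowP => i; rewrite mxE; apply/eqP; rewrite -[_ == _]negbK h.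
  (* At the good configuration of smallest [key] among those with a nonzero coefficient, no other
     word of the combination contributes. *)
  case: (@arg_minP _ _ _ i0 (fun i => v 0 i != 0) (fun i => key w (cc i)) vi0) => i vi mini.
  have := sumE v i; rewrite vA mxE fock_sum (bigD1 i) //= big1 ?addr0 => [|j ji].
    by move/eqP; rewrite fockZ mulf_eq0 (negbTE vi) /=; case: (hW _ (proj1 (ccP i))) => _ /negbTE ->.
  rewrite fockZ; have [->|vj] := eqVneq (v 0 j) 0; first by rewrite mul0r.
  have [->|bj] := eqVneq (b j (cc i)) 0; first by rewrite mulr0.
  case: (hW _ (proj1 (ccP j))) => _ _ /(_ _ bj) [/cc_inj e|/prec_key]; first by rewrite e eqxx in ji.
  by rewrite ltNge mini.
exists b; split=> [i|i|f fH fc].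
- by exists (W (cc i)); case: (hW _ (proj1 (ccP i))).
- by split.
pose y := \row_j f (cc j).
exists (y *m invmx A); split=> [|x' ex']; last first.
  have -> : y = x' *m A by apply/rowP => j; rewrite mxE [in LHS]ex' sumE.
  by rewrite mulmxK.
apply/eqP; rewrite -subr_eq0; apply: contraT => g0.
set x := _ *m _ in g0.
set g := f - _ in g0.
have ge : g = -1 *: (\sum_i x 0 i *: b i) + f by rewrite scaleN1r addrC.
have gH : H lam g.
  by rewrite ge; apply: HP => //; apply: H_sum => i _; apply: HZ.
have gc : hascontent eta g by rewrite ge; apply: hascontentP => //; apply: hascontent_sum.
have gHw : Hw lam w g.
  by apply: H_Hw gH => c /gc h; apply: content_inW eta0 h.
have [c gcn0 goodc] := Hw_good gHw g0.
have cgs : c \in gs by apply/hgs; split=> // r; exact: gc.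
move: gcn0; have ei := nth_index (cfg0 M) cgs; move: (cgs); rewrite -index_mem => hi.
rewrite -ei -[index c gs]/(val (Ordinal hi)) -/(cc (Ordinal hi)) /g fockD fockN sumE /x mulmxKV //.
by rewrite mxE subrr eqxx.
Qed.

Lemma moved_wt_color c c' r k l q : moved c c' (r, k) (r, l) -> wt q c = wt q c'.
Proof.
move=> mv; rewrite /wt; under eq_bigr do rewrite mv !xpair_eqE.
have s (p : 'I_n) (b : bool) : \sum_(i < n) (b && (i == p))%:Z = b%:Z.
  by rewrite (bigD1 p) //= eqxx andbT big1 ?addr0 // => i /negbTE ->; rewrite andbF.
by rewrite sumrB big_split /= !s addrK.
Qed.

(** Moving units between colors preserves the content, so the part of one content of a vector of H
    is again in H; subtracting it shrinks the support. *)
Lemma H_decomp (P : fock -> Prop) : P 0 -> (forall a f g, P f -> P g -> P (a *: f + g)) ->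
  (forall f eta, H lam f -> hascontent eta f -> P f) -> forall f, H lam f -> P f.
Proof.
move=> P0 PP Pc f fH; have [w [[A hA] _ _ _]] := fH.
move: {2}#|`A|%fset (leqnn #|`A|%fset) => N; elim: N A f fH hA => [|N IH] A f fH hA.
  rewrite leqn0 cardfs_eq0 => /eqP A0; suff -> : f = 0 by [].
  apply/funext => c; apply/eqP; apply: contraT => /hA; rewrite A0 inE.
  by [].
move=> cA; have [->|f0] := eqVneq f 0; first by [].
have [c1 fc1] := neq0_supp f0.
pose f1 : fock := fun c => if `[< forall r, wt r c = wt r c1 >] then f c else 0.
have f1s c : f1 c != 0 -> f c != 0 /\ forall r, wt r c = wt r c1.
  by rewrite /f1; case: asboolP => //; rewrite eqxx.
have f1c : hascontent (fun r => wt r c1) f1 by move=> c /f1s[].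
have f1H : H lam f1.
  have [w' [h1 h2 h3 h4]] := fH; exists w'; split.
  - exact: fin_restrict.
  - by move=> c /f1s[/h2].
  - move=> k l kl; apply/funext => c; apply/eqP; apply: contraT => hc.
    have e : gl (chain w') k l f c = gl (chain w') k l f1 c + gl (chain w') k l (f - f1) c.
      by rewrite -fockD -linearD addrC subrK.
    have [r _ [c' /f1s[_ hc'] mv]] := gl_supp hc.
    have hcw q : wt q c = wt q c1 by rewrite (moved_wt_color q mv).
    move: e; rewrite h3 // fock0.
    have [->|] := eqVneq (gl (chain w') k l (f - f1) c) 0.
      by rewrite addr0 => e; rewrite -e eqxx in hc.
    case/gl_supp => r' _ [c2 + mv2]; rewrite fockD fockN /f1 asboolT.
      by rewrite subrr eqxx.
    by move=> q; rewrite -(moved_wt_color q mv2).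
  - by move=> c /f1s[/h4].
have f1P := Pc _ _ f1H f1c.
rewrite -(subrK f1 f) addrC -[f1]scale1r; apply: PP => //.
have fE : f - 1 *: f1 = -1 *: f1 + f by rewrite scale1r scaleN1r addrC.
rewrite fE; apply: (IH (A `\ c1)%fset); first exact: HP.
  move=> c; rewrite fockE mulN1r => hc; rewrite !inE; apply/andP; split.
    apply: contraNneq hc => ->; rewrite /f1 asboolT ?addNr //.
  apply: hA; apply: contraNneq hc => e; rewrite e addr0 oppr_eq0.
  by apply/eqP; rewrite /f1; case: asboolP.
by move: cA; rewrite (cardfsD1 c1) (hA _ fc1) add1n ltnS.
Qed.

Section Sub.
Variable N : fock -> Prop.
Hypotheses (NP : forall a f g, N f -> N g -> N (a *: f + g))
  (NE : forall i j f, N f -> N (E i j f)) (NH : forall f, N f -> H lam f).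

Lemma NZ a f : N f -> N (a *: f).
Proof.
move=> h; have N0 : N 0 by have := NP (-1) h h; rewrite scaleN1r addNr.
by rewrite -[_ *: _]addr0; exact: NP.
Qed.

Lemma N_applyw W f : N f -> N (applyw W f).
Proof. by move=> hf; elim: W => //= p W; exact: NE. Qed.

(** As long as two contents occur, [E r r] minus one of its eigenvalues removes a configuration from
    the support without killing the vector. *)
Lemma N_weight_vector f : N f -> f != 0 -> exists2 g, N g &
  exists2 c, g c != 0 & hascontent (fun r => wt r c) g.
Proof.
move=> Nf f0; have [w [[A hA] _ _ _]] := NH Nf.
move: {2}#|`A|%fset (leqnn #|`A|%fset) => q; elim: q A f Nf f0 hA => [|q IH] A f Nf f0 hA.
  rewrite leqn0 cardfs_eq0 => /eqP A0; have [c /hA] := neq0_supp f0.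
  by rewrite A0 inE.
move=> cA; have [c1 fc1] := neq0_supp f0.
have [h|h] := pselect (hascontent (fun r => wt r c1) f); first by exists f => //; exists c1.
have [c2 [fc2 [r hr]]] : exists c2, f c2 != 0 /\ exists r, wt r c2 != wt r c1.
  apply: contrapT => h'; apply: h => c fc r; apply/eqP; apply: contraT => hr.
  by case: h'; exists c; split=> //; exists r.
pose g := E r r f - (wt r c1)%:~R *: f.
have gE c : g c = (wt r c - wt r c1)%:~R * f c.
  by rewrite /g fockD fockN fockZ E_diag rmorphB /= mulrBl.
have Ng : N g.
  by rewrite /g -scaleNr addrC; apply: NP => //; exact: NE.
apply: (IH (A `\ c1)%fset g) => //.
- apply: contraNneq fc2 => /(congr1 (fun h : fock => h c2)) /=; rewrite gE fock0 => /eqP.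
  by rewrite mulf_eq0 intr_eq0 subr_eq0 (negbTE hr).
- move=> c; rewrite gE mulf_eq0 negb_or intr_eq0 subr_eq0 => /andP[hc fc].
  by rewrite !inE hA // andbT; apply: contraNneq hc => ->.
by move: cA; rewrite (cardfsD1 c1) (hA _ fc1) add1n ltnS.
Qed.

(** A weight vector [g] of [N] pairs nontrivially with some basis word, since otherwise it would be
    orthogonal to itself. The adjoint of that word sends [g] to a nonzero vector of the content of
    [cfg0], which is a multiple of the delta function by [cfg0_unique]. *)
Lemma N_cfg0 f : N f -> f != 0 -> exists w, forall M, (w <= M)%N -> N (delta R (cfg0 M)).
Proof.
move=> Nf f0; have [g Ng [c gc gcont]] := N_weight_vector Nf f0.
have [w hw] := NH Ng; exists w => M wM.
have eta0 (r : halfZ) : (w < `|r|)%N -> wt r c = 0.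
  by move=> hr; rewrite /wt big1 // => k _; case: hw => _ /(_ c gc r k hr).
have [gs hgs] := exists_enum w (fun r => wt r c).
have [b [b1 b2 b3]] := content_basis wM eta0 hgs.
have [x [ex _]] := b3 g (NH Ng) gcont.
have fing : fin g by case: hw.
have finb i : fin (b i) by case: (b2 i) => -[w' [fb _ _ _]] _.
have [i hi] : exists i, dot g (b i) != 0.
  apply: contrapT => h; have g0 : g = 0.
    apply: dot_eq0 => //; rewrite {2}ex dot_sumr // => [|i]; last exact: finZ.
    apply: big1 => i _; rewrite dotZr; have [->|hi] := eqVneq (dot g (b i)) 0.
      by rewrite mulr0.
    by case: h; exists i.
  by rewrite g0 fock0 eqxx in gc.
have [W [W1 bW]] := b1 i.
have gs0 : exists c, good w c.
  by have g0 : g != 0; [apply: contraNneq gc => ->|have [d _ hd] := Hw_good hw g0; exists d].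
have dH : H lam (delta R (cfg0 M)) by case: gs0 => d hd; apply: (H_cfg0 R domlam wM hd).
have [y y0 hy] := dot_applyw W1 fing (fin_delta R (cfg0 M)).
set h := applyw (adjw W) g in hy.
have Nh : N h by exact: N_applyw.
have c0cont : hascontent (fun r => wt r (cfg0 M)) (delta R (cfg0 M)) by move=> d /delta_supp ->.
have shW r : wt r c = wt r (cfg0 M) + shiftw W r.
  have [d hd] : exists d, b i d != 0.
    by apply: neq0_supp; apply: contraNneq hi => ->; rewrite dot0r.
  have [_ bc] := b2 i; rewrite -(bc _ hd); rewrite bW in hd.
  by rewrite (applyw_content c0cont hd).
have hcont : hascontent (fun r => wt r (cfg0 M)) h.
  by move=> d /(applyw_content gcont) e r; rewrite e shiftw_adj shW addrK.
have [w1 h1] := dH; have [w2 h2] := NH Nh; pose w3 := maxn w1 w2.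
have h13 := Hw_widen (leq_maxl w1 w2) h1; have [h21 h22 _ h24] := Hw_widen (leq_maxr w1 w2) h2.
have hsupp d : h d != 0 -> d = cfg0 M.
  move=> hd; apply: (cfg0_unique domlam h13); [exact: h22|exact: h24|exact: hcont].
have hE : h = h (cfg0 M) *: delta R (cfg0 M).
  apply/funext => d; rewrite fockZ /delta; case: eqP => [->|ne]; first by rewrite mulr1.
  by rewrite mulr0; apply/eqP; apply: contraT => /hsupp.
have hc0 : h (cfg0 M) != 0.
  apply: contraNneq hi => e; rewrite bW hy hE e scale0r dot0l mulr0 //.
suff -> : delta R (cfg0 M) = (h (cfg0 M))^-1 *: h by exact: NZ.
have := congr1 (fun z : fock => (h (cfg0 M))^-1 *: z) hE.
by rewrite /= scalerA mulVf // scale1r => ->.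
Qed.

Lemma N_full f : N f -> f != 0 -> forall g, H lam g -> N g.
Proof.
move=> Nf f0; have [w hw] := N_cfg0 Nf f0.
have N0 : N 0 by have := NP (-1) Nf Nf; rewrite scaleN1r addNr.
apply: H_decomp => // g eta gH gcont; have [->|g0] := eqVneq g 0; first by [].
have [w' hw'] := gH; have [c gc] := neq0_supp g0.
have eta0 (r : halfZ) : (w' < `|r|)%N -> eta r = 0.
  move=> hr; rewrite -(gcont c gc) /wt big1 // => k _; case: hw' => _ /(_ c gc r k hr) //.
have [gs hgs] := exists_enum w' eta.
(* A single position of the columns has to suit both the vector found in [N] and the window of
   [g]. *)
have [b [b1 b2 b3]] := content_basis (leq_maxr w w') eta0 hgs.
have [x [-> _]] := b3 g gH gcont.
elim/big_rec: _ => // i h _ hN; apply: NP => //.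
by have [W [_ ->]] := b1 i; apply: N_applyw; apply: hw; exact: leq_maxl.
Qed.
End Sub.
End Irreducible.

(** * The action of the central extension *)

Lemma fsum_seq (T : choiceType) (V : nmodType) (F : T -> V) (s : seq T) : uniq s ->
  (forall i, i \notin s -> F i = 0) -> \sum_(i \in [set: T]) F i = \sum_(i <- s) F i.
Proof.
move=> us F0; rewrite (fsbigE s) //; last by move=> i _; exact: F0.
by apply: eq_bigl => i; rewrite in_setT.
Qed.

Lemma fsum_seq2 (T T' : choiceType) (V : nmodType) (F : T * T' -> V)
    (s : seq T) (s' : seq T') : uniq s -> uniq s' ->
  (forall i j, ~~ ((i \in s) && (j \in s')) -> F (i, j) = 0) ->
  \sum_(p \in [set: T * T']) F p = \sum_(i <- s) \sum_(j <- s') F (i, j).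
Proof.
move=> us us' F0; rewrite (fsum_seq (s := [seq (i, j) | i <- s, j <- s'])).
- by rewrite big_allpairs.
- by apply: allpairs_uniq => // -[a b] [c d] _ _ /= [-> ->].
move=> [i j] h; apply: F0; apply: contra h => /andP[h1 h2].
exact: (@allpairs_f _ _ _ (fun a b => (a, b)) s s').
Qed.

Section Rho.
Variables (R : realType) (n : nat).
Local Notation C := R[i].
Local Notation fock := (fock R n).
Local Notation conf := (conf n).
Implicit Types (f g : fock) (A B : halfZ -> halfZ -> C).

Definition band (N : nat) A := forall i j : halfZ, (N < `|i - j|)%N -> A i j = 0.
Definition bounded_by (w : nat) f := forall c, f c != 0 -> inW w c.

(** Off the diagonal, both indices lie outside the support of [f], so the move must create a
    particle at [i > 0] and an antiparticle at [j <= 0]; these are more than [N] apart. *)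
Lemma E_out w N w' i j f : bounded_by w f -> (w + N <= w')%N -> (`|i - j| <= N)%N ->
  ~~ ((`|i| <= w') && (`|j| <= w'))%N -> E i j f = 0.
Proof.
move=> bf ww ijN; have [<-|nij] := eqVneq i j.
  rewrite andbb -ltnNge => iw; apply/funext => c; rewrite E_diag fock0.
  have [->|/bf cW] := eqVneq (f c) 0; first by rewrite mulr0.
  by rewrite /wt big1 ?mul0r // => k _; apply: cW; lia.
move=> out; apply/funext => c; apply/eqP; apply: contraT => /E_supp[k [c' /bf cW mv]].
have ijf : ((i, k) == (j, k)) = false by rewrite xpair_eqE (negbTE nij).
have jif : ((j, k) == (i, k)) = false by rewrite eq_sym.
have hi := mv i k; have hj := mv j k; rewrite !eqxx ijf jif !cW in hi hj; try lia.
have [h1 h2 _] := gvalid_charge c i k; have [h3 h4 _] := gvalid_charge c j k.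
have i0 : 0 < i by rewrite ltNge; apply/negP => /h2; rewrite hi.
have j0 : j <= 0 by rewrite leNgt; apply/negP => /h3; rewrite hj.
lia.
Qed.

Definition rho (x : glhat R) (f : fock) : fock :=
  \sum_(p \in [set: halfZ * halfZ]) (x.1 p.1 p.2 *: E p.1 p.2 f) + (x.2 * n%:R) *: f.

Definition wsum (w : nat) A f : fock :=
  \sum_(i <- chain w) \sum_(j <- chain w) A i j *: E i j f.

Lemma rhoE w N w' (x : glhat R) f : bounded_by w f -> band N x.1 -> (w + N <= w')%N ->
  rho x f = wsum w' x.1 f + (x.2 * n%:R) *: f.
Proof.
move=> bf bA ww; congr (_ + _).
rewrite (fsum_seq2 (s := chain w') (s' := chain w')) // => i j h.
have [ijN|/bA ->] := leqP `|i - j| N; last exact: scale0r.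
by rewrite (E_out bf ww ijN) ?scaler0 // -!mem_chain.
Qed.

Lemma glinf_band (A : glinf R) : exists N, band N A.
Proof. by have /asboolP[N h] := glinfP A; exists N. Qed.

Lemma band_le N N' A : (N <= N')%N -> band N A -> band N' A.
Proof. by move=> le h i j hij; apply: h; apply: leq_ltn_trans hij. Qed.

Lemma bounded_by_le w w' f : (w <= w')%N -> bounded_by w f -> bounded_by w' f.
Proof. by move=> le h c /h; exact: inW_le. Qed.

Lemma bounded_by_E w i j f : (`|i| <= w)%N -> (`|j| <= w)%N -> bounded_by w f -> bounded_by w (E i j f).
Proof. by move=> iw jw bf c /E_supp[k [c' /bf hc' mv]]; apply: moved_inW mv _ _ hc'. Qed.

Lemma bnddP w a f g : bounded_by w f -> bounded_by w g -> bounded_by w (a *: f + g).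
Proof.
move=> hf hg c; rewrite fockE; have [->|] := eqVneq (f c) 0; last by move/hf.
by rewrite mulr0 add0r; exact: hg.
Qed.

Lemma bndd0 w : bounded_by w 0.
Proof. by move=> c; rewrite fock0 eqxx. Qed.

Lemma bounded_by_wsum w A f : bounded_by w f -> bounded_by w (wsum w A f).
Proof.
move=> bf; rewrite /wsum big_seq; elim/big_ind: _ => [|g h bg bh|i iC]; first exact: bndd0.
  by rewrite -[g]scale1r; apply: bnddP.
rewrite big_seq; elim/big_rec: _ => [|j g jC bg]; first exact: bndd0.
by apply: bnddP => //; apply: bounded_by_E bf; rewrite -mem_chain.
Qed.

Lemma H_wsum lam w A f : H lam f -> H lam (wsum w A f).
Proof. by move=> hf; apply: H_sum => i _; apply: H_sum => j _; apply/HZ/H_E. Qed.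

Lemma H_bounded_by lam f : H lam f -> exists w, bounded_by w f.
Proof. by move=> [w [_ h _ _]]; exists w. Qed.

Lemma H_rho lam x f : H lam f -> H lam (rho x f).
Proof.
move=> hf; have [w bf] := H_bounded_by hf; have [N bN] := glinf_band x.1.
rewrite (rhoE bf bN (leqnn _)) addrC; apply: HP => //; exact: H_wsum.
Qed.

Lemma wsum_linear w A : linear (wsum w A).
Proof.
move=> a f g; rewrite /wsum scaler_sumr -big_split /=; apply: eq_bigr => i _.
rewrite scaler_sumr -big_split /=; apply: eq_bigr => j _.
by rewrite linearP scalerDr !scalerA mulrC.
Qed.
HB.instance Definition _ w A := GRing.isLinear.Build C fock fock *:%R (wsum w A)
  (wsum_linear w A).

Lemma rho_linear lam x a f g : H lam f -> H lam g ->
  rho x (a *: f + g) = a *: rho x f + rho x g.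
Proof.
move=> hf hg; have [w bf] := H_bounded_by hf; have [w' bg] := H_bounded_by hg.
have [N bN] := glinf_band x.1; pose w2 := maxn w w'.
have bf2 := bounded_by_le (leq_maxl w w') bf; have bg2 := bounded_by_le (leq_maxr w w') bg.
rewrite !(rhoE _ bN (leqnn (w2 + N))) //; last exact: bnddP.
by rewrite linearP !scalerDr addrACA !scalerA [a * _]mulrC.
Qed.

Lemma rho_linearl lam (a : C) (x y : glhat R) f : H lam f ->
  rho (a *: x + y) f = a *: rho x f + rho y f.
Proof.
move=> hf; have [w bf] := H_bounded_by hf.
have [N bN] := glinf_band x.1; have [N' bN'] := glinf_band y.1.
have [N2 bN2] := glinf_band (a *: x + y).1.
pose q := (w + N + N' + N2)%N.
rewrite (rhoE (w' := q) bf bN) ?(rhoE (w' := q) bf bN') ?(rhoE (w' := q) bf bN2); try lia.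
rewrite !scalerDr addrACA; congr (_ + _).
  rewrite /wsum scaler_sumr -big_split /=; apply: eq_bigr => i _.
  rewrite scaler_sumr -big_split /=; apply: eq_bigr => j _.
  by rewrite scalerA -scalerDl.
by rewrite scalerA -scalerDl mulrDl mulrA.
Qed.

(** The scalar term is the vacuum value of the supercommutator; summed against two matrices it
    becomes [n] times the cocycle. *)
Lemma E_E i j k l f : E i j (E k l f) = sgE R i j k l *: E k l (E i j f)
  + ((j == k)%:R *: E i l f - (sgE R i j k l * (l == i)%:R) *: E k j f)
  + ((j == k)%:R * vac R n i l - sgE R i j k l * (l == i)%:R * vac R n k j) *: f.
Proof.
set s := sgE _ _ _ _ _.
have v1 : s * vac R n i j = vac R n i j.
  rewrite /vac; case: eqP => [e|_]; last by rewrite mulr0.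
  by rewrite /s /sgE e subrr expr0 mul1r.
have v2 : s * vac R n k l = vac R n k l.
  rewrite /vac; case: eqP => [e|_]; last by rewrite mulr0.
  by rewrite /s /sgE e subrr andbF expr0 mul1r.
rewrite /E !linearB !linearZ /= Eh_Eh -/s; apply/funext => c.
rewrite !(fockD, fockN, fockZ).
set a := Eh k l (Eh i j f) c; set b := Eh i l f c; set d := Eh k j f c; set e := Eh i j f c.
set h := Eh k l f c; set z := f c.
have scE (x : C) (y : C^o) : x *: y = x * y by [].
rewrite ?scE [RHS](_ : _ = s * a - (s * vac R n i j) * h - (s * vac R n k l) * e
   + (s * vac R n i j) * vac R n k l * z + (j == k)%:R * b - s * (l == i)%:R * d); last by ring.
by rewrite v1 v2; ring.
Qed.
End Rho.

(** * Supercommutators and the cocycle *)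

Section Bracket.
Variables (R : realType) (n : nat).
Local Notation C := R[i].
Local Notation fock := (fock R n).
Implicit Types (f g : fock) (A B : halfZ -> halfZ -> C).

Definition homg (p : bool) A := forall i j : halfZ, hodd (i - j) != p -> A i j = 0.

Lemma mat_par_homg p q A : homg p A -> mat_par q A = if p == q then A else 0.
Proof.
move=> hA; apply/funext => i; apply/funext => j; rewrite /mat_par.
have [<-|ne] := eqVneq p q; first by case: eqP => // /eqP; move/hA.
by case: eqP => // e; rewrite hA // e eq_sym.
Qed.

Lemma mulmat0r A : mulmat A 0 = 0.
Proof. by apply/funext => i; apply/funext => j; rewrite /mulmat fsbig1 // => k _; exact: mulr0. Qed.
Lemma mulmat0l A : mulmat 0 A = 0.
Proof. by apply/funext => i; apply/funext => j; rewrite /mulmat fsbig1 // => k _; exact: mul0r. Qed.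

Lemma supercomm_homg p q A B : homg p A -> homg q B ->
  supercomm_mat A B = mulmat A B - (-1) ^+ (p && q) *: mulmat B A.
Proof.
move=> hA hB; rewrite /supercomm_mat !big_bool !(mat_par_homg _ hA) !(mat_par_homg _ hB).
by case: p hA; case: q hB => hB hA;
  rewrite /= !(mulmat0r, mulmat0l, scaler0, oppr0, subr0, addr0, add0r).
Qed.

Lemma mulmat_seq N w A B i l : band N A -> (`|i| + N <= w)%N ->
  mulmat A B i l = \sum_(j <- chain w) A i j * B j l.
Proof.
move=> bA iw; apply: fsum_seq => // j; rewrite mem_chain => hj.
by rewrite bA ?mul0r //; lia.
Qed.

Lemma J_comm A i j :
  supercomm_mat (@Jmat R) A i j = ((i <= 0)%R%:R - (j <= 0)%R%:R) * A i j.
Proof.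
have hJ : homg false (@Jmat R).
  by move=> a b; rewrite /Jmat; case: (a =P b) => // ->; rewrite subrr.
have JA B a b : mulmat (@Jmat R) B a b = (a <= 0)%R%:R * B a b.
  rewrite /mulmat (fsum_seq (s := [:: a])) //; last first.
    move=> k; rewrite inE /Jmat; case: (a =P k) => [->|_ _]; first by rewrite eqxx.
    exact: mul0r.
  by rewrite big_seq1 /Jmat eqxx /=; case: ifP.
have AJ B a b : mulmat B (@Jmat R) a b = (b <= 0)%R%:R * B a b.
  rewrite /mulmat (fsum_seq (s := [:: b])) //; last first.
    move=> k; rewrite inE /Jmat; case: (k =P b) => [->|_ _]; first by rewrite ?eqxx.
    exact: mulr0.
  by rewrite big_seq1 /Jmat eqxx /= mulrC; case: ifP.
rewrite /supercomm_mat !big_bool !(mat_par_homg _ hJ) /=.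
rewrite !(mulmat0r, mulmat0l, scaler0, oppr0, subr0, addr0, add0r, expr0, scale1r).
have fE (F G : halfZ -> halfZ -> C) : (F + G) i j = F i j + G i j by [].
have fN (F : halfZ -> halfZ -> C) : (- F) i j = - F i j by [].
rewrite !fE !fN !JA !AJ /mat_par.
by case: (hodd (i - j)); rewrite /= ?mulr0; ring.
Qed.

Lemma eps_abs (i : halfZ) : (-1) ^+ `|i|%N = eps R i.
Proof. by rewrite /eps /hodd signr_odd. Qed.

(** [[J, A]] keeps only the entries of [A] whose row and column lie on different sides of 0, and the
    band confines these to a bounded square. *)
Lemma cocycle_seq N w (A B : glinf R) : band N A -> (N + N <= w)%N ->
  cocycle A B = \sum_(i <- chain w) \sum_(j <- chain w)
     eps R i * ((i <= 0)%R%:R - (j <= 0)%R%:R) * A i j * B j i.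
Proof.
move=> bA Nw; rewrite /cocycle /str.
have J0 i j : (N < `|i|)%N -> supercomm_mat (@Jmat R) A i j = 0.
  move=> hi; rewrite J_comm; have [ij|/bA ->] := leqP `|i - j| N; last by rewrite mulr0.
  have -> : (j <= 0) = (i <= 0) by apply/idP/idP; lia.
  by rewrite subrr mul0r.
rewrite (fsum_seq (s := chain w)) //; last first.
  move=> i; rewrite mem_chain => hi; rewrite /mulmat fsbig1 ?mulr0 // => j _.
  by rewrite J0 ?mul0r //; lia.
apply: eq_bigr => i _; have [hi|hi] := leqP `|i| N; last first.
  rewrite /mulmat fsbig1 ?mulr0 => [|j _]; last by rewrite J0 ?mul0r.
  rewrite big1 // => j _; rewrite -!mulrA [X in eps R i * X]mulrA -J_comm J0 //.
  by rewrite mul0r mulr0.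
rewrite (@mulmat_seq N w) //; first last.
- by lia.
- by move=> a b ab; rewrite J_comm bA ?mulr0.
rewrite mulr_sumr; apply: eq_bigr => j _; rewrite J_comm eps_abs; ring.
Qed.

Lemma chain_delta (V : lmodType C) w (G : halfZ -> V) j : (`|j| <= w)%N ->
  \sum_(k <- chain w) (j == k)%:R *: G k = G j.
Proof.
rewrite -mem_chain => jw; rewrite (bigD1_seq j jw (chain_uniq w)) /= eqxx scale1r.
by rewrite big1 ?addr0 // => k; rewrite eq_sym => /negbTE ->; rewrite scale0r.
Qed.

(** The product truncated to the window, which makes the commutator a finite identity; [wsum_mulmat]
    compares it with [mulmat]. *)
Definition wmul w A B i l : C := \sum_(j <- chain w) A i j * B j l.

Lemma sum4_delta (V : lmodType C) w A B (G : halfZ -> halfZ -> V) :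
  \sum_(i <- chain w) \sum_(j <- chain w) \sum_(k <- chain w) \sum_(l <- chain w)
     (A i j * B k l) *: ((j == k)%:R *: G i l) =
  \sum_(i <- chain w) \sum_(l <- chain w) wmul w A B i l *: G i l.
Proof.
apply: eq_bigr => i _; rewrite /wmul; under [RHS]eq_bigr do rewrite scaler_suml.
rewrite [RHS]exchange_big /=; rewrite big_seq [RHS]big_seq; apply: eq_bigr => j.
rewrite mem_chain => jw; rewrite exchange_big /=; apply: eq_bigr => l _.
under eq_bigr do rewrite scalerA mulrC -scalerA.
by rewrite (chain_delta (fun k => (A i j * B k l) *: G i l)).
Qed.

Lemma sum4_swap (V : lmodType C) w (F : halfZ -> halfZ -> halfZ -> halfZ -> V) :
  \sum_(i <- chain w) \sum_(j <- chain w) \sum_(k <- chain w) \sum_(l <- chain w) F i j k l =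
  \sum_(k <- chain w) \sum_(l <- chain w) \sum_(i <- chain w) \sum_(j <- chain w) F i j k l.
Proof.
under eq_bigr do rewrite exchange_big /=.
rewrite exchange_big /=; apply: eq_bigr => k _.
under eq_bigr do rewrite exchange_big /=.
by rewrite exchange_big /=.
Qed.

Lemma wsum_wsum w A B f : wsum w A (wsum w B f) =
  \sum_(i <- chain w) \sum_(j <- chain w) \sum_(k <- chain w) \sum_(l <- chain w)
     (A i j * B k l) *: E i j (E k l f).
Proof.
apply: eq_bigr => i _; apply: eq_bigr => j _; rewrite /wsum linear_sum scaler_sumr /=.
apply: eq_bigr => k _; rewrite linear_sum scaler_sumr /=; apply: eq_bigr => l _.
by rewrite linearZ /= scalerA.
Qed.

Lemma wsum_comm w p q A B f : homg p A -> homg q B ->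
  wsum w A (wsum w B f) - (-1) ^+ (p && q) *: wsum w B (wsum w A f) =
  wsum w (wmul w A B) f - (-1) ^+ (p && q) *: wsum w (wmul w B A) f +
  ((\sum_(i <- chain w) \sum_(l <- chain w) wmul w A B i l * vac R n i l) -
    (-1) ^+ (p && q) * (\sum_(k <- chain w) \sum_(j <- chain w) wmul w B A k j * vac R n k j)) *: f.
Proof.
move=> hA hB; set s := (-1) ^+ (p && q).
rewrite !wsum_wsum [X in _ - _ *: X]sum4_swap.
transitivity (\sum_(i <- chain w) \sum_(j <- chain w) \sum_(k <- chain w) \sum_(l <- chain w)
   ((A i j * B k l) *: ((j == k)%:R *: (E i l f + vac R n i l *: f))
    - s *: ((B k l * A i j) *: ((l == i)%:R *: (E k j f + vac R n k j *: f))))).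
  rewrite scaler_sumr -sumrB; apply: eq_bigr => i _; rewrite scaler_sumr -sumrB.
  apply: eq_bigr => j _; rewrite scaler_sumr -sumrB; apply: eq_bigr => k _.
  rewrite scaler_sumr -sumrB; apply: eq_bigr => l _.
  have [A0|A0] := eqVneq (A i j) 0; first by rewrite A0 mulr0 mul0r !scale0r scaler0.
  have [B0|B0] := eqVneq (B k l) 0; first by rewrite B0 mulr0 mul0r !scale0r scaler0.
  have eA : hodd (i - j) = p by apply/eqP; apply: contraTT A0 => /hA ->; rewrite eqxx.
  have eB : hodd (k - l) = q by apply/eqP; apply: contraTT B0 => /hB ->; rewrite eqxx.
  rewrite (E_E i j) /sgE eA eB -/s; apply/funext => c; rewrite !(fockD, fockN, fockZ); ring.
under eq_bigr do under eq_bigr do under eq_bigr do rewrite sumrB.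
under eq_bigr do under eq_bigr do rewrite sumrB.
under eq_bigr do rewrite sumrB.
rewrite sumrB sum4_delta.
have -> : \sum_(i <- chain w) \sum_(j <- chain w) \sum_(k <- chain w) \sum_(l <- chain w)
    s *: ((B k l * A i j) *: ((l == i)%:R *: (E k j f + vac R n k j *: f))) =
  s *: \sum_(k <- chain w) \sum_(j <- chain w) wmul w B A k j *: (E k j f + vac R n k j *: f).
  rewrite -sum4_delta -sum4_swap scaler_sumr; apply: eq_bigr => i _.
  rewrite scaler_sumr; apply: eq_bigr => j _; rewrite scaler_sumr; apply: eq_bigr => k _.
  by rewrite scaler_sumr.
have sp A' B' : \sum_(k <- chain w) \sum_(j <- chain w) wmul w A' B' k j *: (E k j f + vac R n k j *: f)
   = wsum w (wmul w A' B') f + (\sum_(k <- chain w) \sum_(j <- chain w) wmul w A' B' k j * vac R n k j) *: f.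
  rewrite /wsum scaler_suml -big_split; apply: eq_bigr => k _ /=.
  rewrite scaler_suml -big_split; apply: eq_bigr => j _ /=.
  by rewrite scalerDr scalerA.
by rewrite !sp; apply/funext => c; rewrite !(fockD, fockN, fockZ); ring.
Qed.

(** Truncation only matters in rows near the edge of the window, and there either the product entry
    vanishes or [E i l f] does. *)
Lemma wsum_mulmat w N w' A B f : bounded_by w f -> band N A -> band N B ->
  (w + N + N + N <= w')%N -> wsum w' (wmul w' A B) f = wsum w' (mulmat A B) f.
Proof.
move=> bf bA bB ww; apply: eq_bigr => i _; apply: eq_bigr => l _.
have [h|h] := leqP `|i - l| (N + N); last first.
  have z j : A i j * B j l = 0.
    have [hij|/bA ->] := leqP `|i - j| N; last exact: mul0r.
    by rewrite bB ?mulr0 //; lia.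
  by rewrite /wmul big1 // /mulmat fsbig1.
have [hi|hi] := leqP `|i| (w + N + N); last first.
  rewrite (@E_out R n w (N + N) (w + N + N)) ?scaler0 //; first by lia.
  by rewrite negb_and -!ltnNge hi.
by rewrite (mulmat_seq _ _ bA (w := w')) //; lia.
Qed.

Lemma wsum_sub w A B (s : C) f :
  wsum w (A - s *: B) f = wsum w A f - s *: wsum w B f.
Proof.
rewrite /wsum scaler_sumr -sumrB; apply: eq_bigr => i _.
rewrite scaler_sumr -sumrB; apply: eq_bigr => j _.
by rewrite scalerA -scalerBl.
Qed.

(** Only diagonal entries have a vacuum value. The sign [(-1)^(p && q)] turns [eps j] into [eps i],
    so both products contribute with the sign of the supertrace. *)
Lemma vac_sum w p q A B : homg p A -> homg q B ->
  (\sum_(i <- chain w) \sum_(l <- chain w) wmul w A B i l * vac R n i l) -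
    (-1) ^+ (p && q) * (\sum_(k <- chain w) \sum_(j <- chain w) wmul w B A k j * vac R n k j) =
  (\sum_(i <- chain w) \sum_(j <- chain w)
     eps R i * ((i <= 0)%R%:R - (j <= 0)%R%:R) * A i j * B j i) * n%:R.
Proof.
move=> hA hB.
have diag A' B' : \sum_(i <- chain w) \sum_(l <- chain w) wmul w A' B' i l * vac R n i l =
    \sum_(i <- chain w) \sum_(j <- chain w) A' i j * B' j i * vac R n i i.
  rewrite big_seq [RHS]big_seq; apply: eq_bigr => i iw.
  rewrite (bigD1_seq i iw (chain_uniq w)) /= big1 ?addr0 => [|l li].
    by rewrite /wmul mulr_suml.
  by rewrite /vac eq_sym (negbTE li) mulr0.
rewrite !diag [X in _ - _ * X]exchange_big /= mulr_sumr -sumrB mulr_suml.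
apply: eq_bigr => i _; rewrite mulr_sumr -sumrB mulr_suml; apply: eq_bigr => j _.
have [A0|A0] := eqVneq (A i j) 0; first by rewrite A0 !(mulr0, mul0r) subrr.
have [B0|B0] := eqVneq (B j i) 0; first by rewrite B0 !(mulr0, mul0r) subrr.
have eA : hodd (i - j) = p by apply/eqP; apply: contraTT A0 => /hA ->; rewrite eqxx.
have eB : hodd (j - i) = q by apply/eqP; apply: contraTT B0 => /hB ->; rewrite eqxx.
have s_eps : (-1) ^+ (p && q) * eps R j = eps R i.
  rewrite -eA -eB !hoddD /eps; case: (hodd i); case: (hodd j); rewrite /= ?expr0 ?expr1; ring.
have vE r : vac R n r r = (r <= 0)%R%:R * eps R r * n%:R.
  by rewrite /vac eqxx /=; case: ifP; rewrite ?mul1r // !mul0r.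
rewrite !vE [X in _ - X](_ : _ = ((-1) ^+ (p && q) * eps R j) * (j <= 0)%R%:R * n%:R * A i j * B j i); last by ring.
by rewrite s_eps; ring.
Qed.

Lemma rho_bracket p q x y f lam : glhat_homog p x -> glhat_homog q y -> H lam f ->
  rho (glhat_bracket x y) f = rho x (rho y f) - (-1) ^+ (p && q) *: rho y (rho x f).
Proof.
move=> [hx x2] [hy y2] hf; have [w bf] := H_bounded_by hf.
have [N1 bN1] := glinf_band x.1; have [N2 bN2] := glinf_band y.1.
pose N := maxn N1 N2.
have bx : band N x.1 by apply: band_le bN1; rewrite leq_maxl.
have by_ : band N y.1 by apply: band_le bN2; rewrite leq_maxr.
(* One margin [N] is used up by the first operator; three are required to compare truncated and full
   products. *)
pose W := (w + N + N + N)%N.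
have rx : rho x f = wsum W x.1 f + (x.2 * n%:R) *: f by apply: (rhoE bf bx); lia.
have ry : rho y f = wsum W y.1 f + (y.2 * n%:R) *: f by apply: (rhoE bf by_); lia.
have bnd_rho (z : glhat R) : band N z.1 -> bounded_by (w + N) (rho z f).
  move=> bz; rewrite (rhoE bf bz (leqnn _)) addrC; apply: bnddP; last first.
    by apply/bounded_by_wsum/(bounded_by_le (leq_addr _ _) bf).
  exact: bounded_by_le (leq_addr _ _) bf.
rewrite (rhoE (w' := W) (bnd_rho y by_) bx) ?(rhoE (w' := W) (bnd_rho x bx) by_); try lia.
have bc : band (N + N) (glhat_bracket x y).1.
  move=> i j hij; rewrite /= (supercomm_homg hx hy).
  have z (A B : halfZ -> halfZ -> C) : band N A -> band N B -> mulmat A B i j = 0.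
    move=> bA bB; rewrite /mulmat fsbig1 // => k _.
    have [hik|/bA ->] := leqP `|i - k| N; last exact: mul0r.
    by rewrite bB ?mulr0 //; lia.
  have fE (F G : halfZ -> halfZ -> C) (a : C) : (F - a *: G) i j = F i j - a * G i j by [].
  by rewrite fE !z // mulr0 subrr.
rewrite (rhoE (w' := W) bf bc); last by rewrite /W; lia.
rewrite /= (supercomm_homg hx hy) wsum_sub.
rewrite -!(wsum_mulmat bf _ _ (leqnn _)) // -/W.
rewrite (@cocycle_seq N W) //; last by rewrite /W; lia.
rewrite -(vac_sum _ hx hy) -(wsum_comm W f hx hy) rx ry !linearD !linearZ /=.
apply/funext => c; rewrite !(fockD, fockN, fockZ).
have scE (a : C) (b : C^o) : a *: b = a * b by [].
have [pq|pq] := boolP (p && q); last by rewrite expr0 ?scE; ring.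
by case/andP: pq => /x2 -> /y2 ->; rewrite ?scE; ring.
Qed.
End Bracket.

(** * The highest weight vector *)

Definition idx (w i : nat) : halfZ := if (i <= w)%N then - i%:Z else (i - w)%N%:Z.

Lemma chain_idx w : chain w = [seq idx w i | i <- iota 0 w.*2.+1].
Proof.
have -> : w.*2.+1 = (w.+1 + w)%N by rewrite -addnn.
rewrite iotaD map_cat /chain; congr (_ ++ _).
  by apply/eq_in_map => i; rewrite mem_iota /idx => hi; rewrite ifT //; lia.
rewrite add0n -[in RHS]addn1 [in RHS]iotaDl -[in RHS]map_comp.
apply/eq_in_map => i; rewrite mem_iota => hi.
by rewrite /= /idx ifF; lia.
Qed.

Section Nu.
Variables (n : nat).
Local Notation conf := (conf n).
Implicit Types (c : conf) (k l : 'I_n).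

Definition Nu w c (i : nat) k : int := \sum_(q < i) charge c (idx w q) k.

Lemma NuS w c i k : Nu w c i.+1 k = Nu w c i k + charge c (idx w i) k.
Proof. by rewrite /Nu big_ord_recr. Qed.

Lemma Nu0 w c k : Nu w c 0 k = 0.
Proof. by rewrite /Nu big_ord0. Qed.

Lemma nu_Nu w c i k : nu [seq idx w q | q <- iota 0 i] k c = Nu w c i k.
Proof. by rewrite /nu /Nu big_map -{1}(subn0 i) -/(index_iota 0 i) big_mkord. Qed.

Lemma nu_chain w c k : nu (chain w) k c = Nu w c w.*2.+1 k.
Proof. by rewrite chain_idx nu_Nu. Qed.

Lemma good_idx w c : good_upto (chain w) c <->
  forall i, (i < w.*2.+1)%N -> step_ok (idx w i) (Nu w c i) (Nu w c i.+1).
Proof.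
rewrite chain_idx; split=> [h i hi|h ys r zs e].
  have e : [seq idx w q | q <- iota 0 w.*2.+1] = [seq idx w q | q <- iota 0 i] ++
     idx w i :: [seq idx w q | q <- iota i.+1 (w.*2 - i)].
    have -> : w.*2.+1 = (i + (w.*2 - i).+1)%N by lia.
    by rewrite iotaD map_cat add0n.
  have := h _ _ _ e => hh k l kl; have [h1 h2] := hh k l kl.
  have rc : rcons [seq idx w q | q <- iota 0 i] (idx w i) = [seq idx w q | q <- iota 0 i.+1].
    by rewrite -map_rcons -addn1 iotaD -cats1.
  by rewrite rc !nu_Nu in h1 h2; split.
have sz : (size ys < w.*2.+1)%N.
  by have := congr1 size e; rewrite size_map size_iota size_cat /= => ->; lia.
have e2 := e; have : w.*2.+1 = (size ys + (w.*2 - size ys).+1)%N by lia.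
move=> ew; rewrite ew iotaD map_cat add0n /= in e2.
have /eqP := e2; rewrite eqseq_cat ?size_map ?size_iota // eqseq_cons => /and3P[/eqP e3 /eqP e4 _].
have := h _ sz; rewrite e4 => hh k l kl; have [h1 h2] := hh k l kl.
have rc : rcons ys r = [seq idx w q | q <- iota 0 (size ys).+1].
  by rewrite -[in iota _ _]addn1 iotaD map_cat /= add0n e4 e3 cats1.
have nE k' : nu ys k' c = Nu w c (size ys) k' by rewrite -{1}e3 nu_Nu.
by rewrite rc !nu_Nu !nE; split.
Qed.

Section Bounds.
Variables (lam : 'I_n -> int) (w : nat) (c : conf).
Hypotheses (gc : good lam w c).

Let st i : (i < w.*2.+1)%N -> step_ok (idx w i) (Nu w c i) (Nu w c i.+1).
Proof. by move=> hi; case: gc => _ _ /good_idx /(_ i hi). Qed.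

Lemma Nu_total k : Nu w c w.*2.+1 k = lam k.
Proof. by case: gc => _ h _; rewrite -nu_chain. Qed.

Lemma Nu_decr i j k : (i <= j)%N -> (j <= w.+1)%N -> Nu w c j k <= Nu w c i k.
Proof.
move=> ij; elim: j ij => [|j IH]; first by rewrite leqn0 => /eqP ->.
rewrite leq_eqVlt => /orP[/eqP -> //|ij] jw.
apply: le_trans (IH ij (ltnW jw)); rewrite NuS gerDl.
by case: (gvalid_charge c (idx w j) k) => _ + _; apply; rewrite /idx; case: ifP; lia.
Qed.

Lemma Nu_incr i j k : (i <= j)%N -> (w.+1 <= i)%N -> Nu w c i k <= Nu w c j k.
Proof.
move=> ij wi; elim: j ij => [|j IH]; first by rewrite leqn0 => /eqP ->.
rewrite leq_eqVlt => /orP[/eqP -> //|ij].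
apply: le_trans (IH ij) _; rewrite NuS lerDl.
by case: (gvalid_charge c (idx w j) k) => + _ _; apply; rewrite /idx; case: ifP; lia.
Qed.

(** A fermionic step lowers a row by at most 1, and at a bosonic step row [k] stays above the
    previous row [k + 1]. So the bound drops only every other step, as long as a next row exists. *)
Lemma Nu_lower i k : (i <= w.+1)%N -> (i < (n - k).*2)%N -> - (i.+1./2)%:Z <= Nu w c i k.
Proof.
elim: i k => [|i IH] k iw ik; first by rewrite Nu0.
have ei : idx w i = - i%:Z by rewrite /idx ifT //; lia.
have := IH k (ltnW iw) (ltnW ik) => IHk.
case: (boolP (odd i)) => oi; last first.
  rewrite NuS; have [_ _] := gvalid_charge c (idx w i) k.
  rewrite ei /ferm /hodd; lia.
have kn : (k.+1 < n)%N by lia.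
have := st (i := i) _ ; rewrite ei => /(_ _ k (Ordinal kn) (ltnSn k)) [|_]; first lia.
have -> : hodd (- i%:Z) by rewrite /hodd; lia.
move=> /(_ isT); rewrite ifF; last by lia.
have := IH (Ordinal kn) (ltnW iw); rewrite /=; lia.
Qed.

(** The mirror image of [Nu_lower]: bosonic steps compare row [k] with row [k - 1]. The start is at
    most 0, because the nonpositive indices only remove boxes. *)
Lemma Nu_upper r k : (r <= w)%N -> (r < k.*2.+1)%N -> Nu w c (w.+1 + r) k <= (r./2)%:Z.
Proof.
elim: r k => [|r IH] k rw rk.
  by rewrite addn0; apply: le_trans (Nu_decr k (leq0n _) (leqnn _)) _; rewrite Nu0.
have ei : idx w (w.+1 + r) = r.+1%:Z by rewrite /idx ifF; lia.
have IHk := IH k (ltnW rw) (ltnW rk); rewrite addnS.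
case: (boolP (odd r)) => oi.
  rewrite NuS; have [_ _] := gvalid_charge c (idx w (w.+1 + r)) k.
  rewrite ei /ferm /hodd; lia.
have k0 : (k.-1 < n)%N by have := ltn_ord k; lia.
have kk : (Ordinal k0 < k)%N by rewrite /=; lia.
have := st (i := (w.+1 + r)%N) _ ; rewrite ei => /(_ _ (Ordinal k0) k kk) [|_]; first lia.
have -> : hodd r.+1%:Z by rewrite /hodd; lia.
move=> /(_ isT); rewrite /=.
have := IH (Ordinal k0) (ltnW rw); rewrite /=; lia.
Qed.
End Bounds.

Section Canonical.
Variables (lam : 'I_n -> int).
Hypothesis domlam : forall k l : 'I_n, (k < l)%N -> lam l <= lam k.

(* The rows of the tableaux of highest weight: color [k] has fermions at the first
   integral indices, up to the diagonal, and the rest of row [k] at one boson. *)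
Definition hw_charge (r : halfZ) (k : 'I_n) : int :=
  if hodd r then
    if 0 < r then (if r == k.*2.+1%:Z then Num.max (lam k - k%:Z) 0 else 0)
    else (if r == - ((n - k.+1).*2.+1)%:Z then - Num.max (- lam k - (n - k.+1)%N%:Z - 1) 0 else 0)
  else
    if 0 < r then ((r <= k.*2%:Z) && (r <= 2 * lam k))%R%:Z
    else - ((- r <= (n - k.+1).*2%:Z) && (- r + 2 <= - (2 * lam k)))%R%:Z.

Lemma hw_charge_valid : gvalid hw_charge.
Proof.
move=> r k; rewrite /hw_charge /ferm; case: (hodd r); case: (ltP 0 r) => r0;
  split=> //; do ?case: ifP => _; lia.
Qed.

Definition hw_conf : conf := conf_of hw_charge.

Lemma charge_hw_conf r k : charge hw_conf r k = hw_charge r k.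
Proof. by apply: charge_conf_of; exact: hw_charge_valid. Qed.

Lemma hw_conf_inW w : (n.*2 <= w)%N -> inW w hw_conf.
Proof.
move=> nw r k hr; have := ltn_ord k; rewrite charge_hw_conf /hw_charge => kn.
by case: (hodd r); case: (ltP 0 r) => r0; do ?case: eqP; lia.
Qed.

(* [hw_sum_neg] and [hw_sum_pos] are the partial sums of [hw_charge] along the
   nonpositive and the positive part of [chain]. *)
Definition hw_sum_neg (i : nat) (k : 'I_n) : int :=
  if ((n - k).*2 <= i)%N then Num.min 0 (lam k)
  else Num.max (Num.min 0 (lam k)) (- (i.+1./2)%:Z).
Definition hw_sum_pos (r : nat) (k : 'I_n) : int :=
  if (k.*2.+1 <= r)%N then lam k else Num.min (lam k) (r./2)%:Z.

Lemma Nu_hw_confB w i k : (i <= w.+1)%N -> Nu w hw_conf i k = hw_sum_neg i k.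
Proof.
have := ltn_ord k => kn; elim: i => [|i IH] iw.
  by rewrite Nu0 /hw_sum_neg ifF /=; lia.
rewrite NuS IH ?(ltnW iw) // charge_hw_conf /idx ifT; last lia.
by rewrite /hw_sum_neg /hw_charge /hodd; do ?case: ifP; lia.
Qed.

Lemma Nu_hw_confA w r k : (n.*2 <= w)%N -> (r <= w)%N -> Nu w hw_conf (w.+1 + r) k = hw_sum_pos r k.
Proof.
move=> nw; have := ltn_ord k => kn; elim: r => [|r IH] rw.
  by rewrite addn0 Nu_hw_confB // /hw_sum_neg /hw_sum_pos ifT /=; lia.
rewrite addnS NuS IH ?(ltnW rw) // charge_hw_conf /idx ifF; last lia.
have -> : (w.+1 + r - w)%N = r.+1 by lia.
by rewrite /hw_sum_pos /hw_charge /hodd; do ?case: ifP; lia.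
Qed.

Lemma good_hw_conf w : (n.*2 < w)%N -> good lam w hw_conf.
Proof.
move=> nw; have nw' := ltnW nw; split; first exact: hw_conf_inW.
  move=> k; have := ltn_ord k => kn; rewrite nu_chain.
  have -> : w.*2.+1 = (w.+1 + w)%N by lia.
  by rewrite Nu_hw_confA // /hw_sum_pos ifT //; lia.
apply/good_idx => i hi k l kl; have := domlam kl; have := ltn_ord l => ln dkl.
have [iw|iw] := leqP i w.
  rewrite !Nu_hw_confB ?(leqW iw) // /idx iw /hw_sum_neg; split.
    by do ?case: ifP; lia.
  by move=> /= oi; rewrite ifF; [move: oi; rewrite /hodd; do ?case: ifP; lia|lia].
have [r er] : exists r, i = (w.+1 + r)%N by exists (i - w.+1)%N; lia.
have rw : (r < w)%N by lia.
rewrite er -addnS !Nu_hw_confA ?(ltnW rw) // /idx ifF /hw_sum_pos; last lia.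
have -> : (w.+1 + r - w)%N = r.+1 by lia.
split; first by do ?case: ifP; lia.
by rewrite /= /hodd; do ?case: ifP; lia.
Qed.
End Canonical.
End Nu.

Section Counting.
Variable n : nat.

Lemma card_ord_lt m : #|[set l : 'I_n | (l < m)%N]%SET| = minn m n.
Proof.
rewrite -sum1_card big_mkcond /=.
have -> : (\sum_(i < n) (if i \in [set l : 'I_n | (l < m)%N]%SET then 1 else 0) = \sum_(i < n) (i < m))%N.
  by apply: eq_bigr => i _; rewrite inE; case: ltnP.
elim: (n) => [|q IH]; first by rewrite big_ord0 minn0.
by rewrite big_ord_recr /= IH; case: ltnP; lia.
Qed.

Lemma down_closedE (D : {set 'I_n}) : (forall k l : 'I_n, (k < l)%N -> l \in D -> k \in D) ->
  forall k, (k \in D) = (k < #|D|)%N.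
Proof.
move=> dc k; apply/idP/idP => [kD|].
  have : [set l : 'I_n | (l < k.+1)%N]%SET \subset D.
    apply/fintype.subsetP => l; rewrite inE ltnS leq_eqVlt => /orP[/eqP/val_inj -> //|lk].
    exact: dc kD.
  by move/subset_leq_card; rewrite card_ord_lt (minn_idPl (ltn_ord k)).
apply: contraLR => kD; rewrite -leqNgt.
have : D \subset [set l : 'I_n | (l < k)%N]%SET.
  apply/fintype.subsetP => l lD; rewrite inE ltnNge leq_eqVlt; apply: contra kD.
  by move=> /orP[/eqP/val_inj -> //|/dc]; apply.
move/subset_leq_card; rewrite card_ord_lt; lia.
Qed.

(** This turns the sum over colors of a fermionic charge into the truncated column length of
    [Lambda_diag]; [card_up] does the same for the columns on the left. *)
Lemma card_down (D : {set 'I_n}) m : (forall k l : 'I_n, (k < l)%N -> l \in D -> k \in D) ->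
  \sum_(k < n) ((m <= k)%N && (k \in D))%:Z = Num.max (#|D|%:Z - m%:Z) 0.
Proof.
move=> dc; under eq_bigr do rewrite (down_closedE dc).
have : (#|D| <= n)%N by have := max_card (mem D); rewrite card_ord.
elim: (n) #|D| => [|q IH] d dq; first by rewrite big_ord0; lia.
rewrite big_ord_recr /=; have [dq'|dq'] := leqP d q.
  by rewrite IH //; lia.
have -> : d = q.+1 by lia.
have -> : \sum_(i < q) ((m <= i)%N && (i < q.+1)%N)%:Z = \sum_(i < q) ((m <= i)%N && (i < q)%N)%:Z.
  by apply: eq_bigr => i _; rewrite (ltn_ord i) ltnS (ltnW (ltn_ord i)).
rewrite IH //; lia.
Qed.

Lemma card_up (D : {set 'I_n}) m : (forall k l : 'I_n, (k < l)%N -> k \in D -> l \in D) ->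
  \sum_(k < n) ((m <= n - k.+1)%N && (k \in D))%:Z = Num.max (#|D|%:Z - m%:Z) 0.
Proof.
move=> uc; pose D' := [set k | rev_ord k \in D]%SET.
have -> : #|D| = #|D'|.
  rewrite -[RHS](card_imset _ (@rev_ord_inj n)); apply: eq_card => k.
  apply/idP/finset.imsetP => [h|[l + ->]]; last by rewrite inE.
  by exists (rev_ord k); rewrite ?inE ?rev_ordK.
rewrite -card_down => [|k l kl]; last first.
  by rewrite !inE; apply: uc => /=; have := ltn_ord l; lia.
rewrite (reindex_inj (@rev_ord_inj n)) /=; apply: eq_bigr => k _; rewrite inE.
by congr ((_ && _) : nat)%:Z; have := ltn_ord k; lia.
Qed.
End Counting.

(** * Content and extremality of the canonical configuration *)

Section HighestWeight.
Variables (R : realType) (n : nat) (lam : 'I_n -> int).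
Local Notation C := R[i].
Local Notation fock := (fock R n).
Local Notation conf := (conf n).
Hypothesis domlam : forall k l : 'I_n, (k < l)%N -> lam l <= lam k.
Local Notation hw_conf := (hw_conf lam).

Lemma col_lenE (j : int) (D : {set 'I_n}) :
  (forall k, (k \in D) = ((0 < j <= lam k) || (lam k <= j < 0))) -> col_len lam j = #|D|%:Z.
Proof. by move=> h; rewrite /col_len; congr Posz; apply: eq_card => k; rewrite h. Qed.

Lemma row_len_in (k : 'I_n) (j : int) : j = k.+1%:Z -> row_len lam j = lam k.
Proof.
move=> ->; rewrite /row_len (bigD1 k) //= big1 ?addr0 // => i /andP[/eqP[e]].
by rewrite (ord_inj e) eqxx.
Qed.

Lemma row_len_out (j : int) : j <= 0 \/ n%:Z < j -> row_len lam j = 0.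
Proof.
move=> h; rewrite /row_len big_pred0 // => i; apply/negbTE/eqP; have := ltn_ord i.
by case: h; lia.
Qed.

Lemma wt_hw_conf r : wt r hw_conf = Lambda_diag lam r.
Proof.
rewrite /wt /Lambda_diag; under eq_bigr do rewrite (charge_hw_conf lam) /hw_charge.
case: (boolP (hodd r)) => hr.
  have [r0|r0] := ltP 0 r.
    rewrite ifT; last by move: hr; rewrite /hodd; lia.
    have [m em] : exists m : nat, r = m.*2.+1%:Z.
      by exists (`|r|./2); move: hr; rewrite /hodd; lia.
    have -> : (r %/ 2)%Z = m%:Z by rewrite em; lia.
    have [mn|mn] := ltnP m n.
      rewrite (@row_len_in (Ordinal mn)) /=; last by lia.
      rewrite (bigD1 (Ordinal mn)) //= em eqxx big1 ?addr0 => [|k km]; first by lia.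
      rewrite ifF //; apply/negbTE; apply: contraNneq km => h; apply/eqP/val_inj => /=; lia.
    rewrite row_len_out; last by right; lia.
    rewrite big1 => [|k _]; first by lia.
    by rewrite ifF //; have := ltn_ord k; lia.
  rewrite ifF; last by move: hr; rewrite /hodd; lia.
  have [m em] : exists m : nat, r = - (m.*2.+1%:Z).
    by exists (`|r|./2); move: hr; rewrite /hodd; lia.
  have -> : (r %/ 2)%Z = - m%:Z - 1 by rewrite em; lia.
  have [mn|mn] := ltnP m n.
    have hm : (n - m.+1 < n)%N by lia.
    rewrite (@row_len_in (Ordinal hm)) /=; last by lia.
    rewrite (bigD1 (Ordinal hm)) //= em ifT; last by lia.
    rewrite big1 ?addr0 => [|k km]; first by lia.
    have kn := ltn_ord k.
    rewrite ifF //; apply/negbTE; apply: contraNneq km => h; apply/eqP/val_inj => /=; lia.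
  rewrite row_len_out; last by left; lia.
  rewrite big1 => [|k _]; first by lia.
  by rewrite ifF //; have := ltn_ord k; lia.
have [r0|r0] := ltP 0 r.
  have [m em] : exists m : nat, r = m.*2%:Z.
    by exists (`|r|./2); move: hr; rewrite /hodd; lia.
  have -> : (r %/ 2)%Z = m%:Z by rewrite em; lia.
  rewrite ifT; last by lia.
  pose D := [set k | m%:Z <= lam k]%SET.
  rewrite (@col_lenE m%:Z D) => [|k]; last by rewrite inE; apply/idP/idP; lia.
  rewrite -(@card_down _ D m) => [|k l kl]; last by rewrite !inE; have := domlam kl; lia.
  by apply: eq_bigr => k _; rewrite inE; congr ((_ : bool) : nat)%:Z; lia.
have [m em] : exists m : nat, r = - (m.*2%:Z).
  by exists (`|r|./2); move: hr; rewrite /hodd; lia.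
have -> : (r %/ 2)%Z = - m%:Z by rewrite em; lia.
rewrite ifF; last by lia.
pose D := [set k | lam k <= - m%:Z - 1]%SET.
rewrite (@col_lenE _ D) => [|k]; last by rewrite inE; apply/idP/idP; lia.
rewrite -(@card_up _ D m) => [|k l kl]; last by rewrite !inE; have := domlam kl; lia.
rewrite sumrN; congr (- _); apply: eq_bigr => k _; rewrite inE.
by congr ((_ : bool) : nat)%:Z; lia.
Qed.

(** The position of [x] in [chain w], inverse to [idx w]. *)
Definition pos (w : nat) (x : int) : nat := if x <= 0 then `|x|%N else (w + `|x|)%N.

Lemma sum_idx w m (x : halfZ) : (m <= w.*2.+1)%N -> (`|x| <= w)%N ->
  \sum_(q < m) (idx w q == x)%:Z = (pos w x < m)%N%:Z.
Proof.
move=> mw xw; have ip q : (q < m)%N -> (idx w q == x) = (q == pos w x).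
  by move=> qm; rewrite /idx /pos; apply/eqP/eqP; do 2!case: ifP; lia.
have [h|h] := ltnP (pos w x) m.
  rewrite (bigD1 (Ordinal h)) //= ip ?eqxx // big1 ?addr0 // => q qn.
  by rewrite ip // (_ : (_ == _) = false) //; apply: contraNF qn => /eqP e; apply/eqP/val_inj.
rewrite big1 // => q _; rewrite ip // (_ : (_ == _) = false) //.
by have := ltn_ord q; lia.
Qed.

Lemma sum_Nu w c m : \sum_(k < n) Nu w c m k = \sum_(q < m) wt (idx w q) c.
Proof. by rewrite /Nu exchange_big. Qed.

(* The partial sums of the canonical configuration are extremal among the good ones,
   so an upper triangular e_ij cannot lead to a good configuration. *)
Lemma hw_content w c (i j : halfZ) : (n.*2 < w)%N -> good lam w c ->
  (`|i| <= w)%N -> (`|j| <= w)%N -> i < j ->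
  (forall r, wt r c = wt r hw_conf + (r == i)%:Z - (r == j)%:Z) -> False.
Proof.
move=> nw gc iw jw ij hc; have nw' := ltnW nw.
have SN m : (m <= w.*2.+1)%N ->
    \sum_k Nu w c m k = \sum_k Nu w hw_conf m k + (pos w i < m)%N%:Z - (pos w j < m)%N%:Z.
  move=> mw; rewrite !sum_Nu; under eq_bigr do rewrite hc.
  by rewrite sumrB big_split /= !sum_idx.
(* For [i >= 0] the partial sum ending at [i] includes [i] but not [j]; it would exceed by 1 the
   total of the canonical configuration, which is maximal. *)
have [i0|i0] := leP 0 i.
  have e := SN (w.+1 + `|i|)%N _.
  have : \sum_k Nu w c (w.+1 + `|i|)%N k <= \sum_k Nu w hw_conf (w.+1 + `|i|)%N k.
    apply: ler_sum => k _; rewrite Nu_hw_confA // /hw_sum_pos.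
    have h1 : Nu w c (w.+1 + `|i|)%N k <= lam k.
      rewrite -(Nu_total gc k); apply: Nu_incr; lia.
    by case: ifP => // h; have := Nu_upper gc (r := `|i|%N) (k := k) iw; lia.
  have {e} := e ltac:(lia).
  have -> : (pos w i < w.+1 + `|i|)%N by rewrite /pos; case: ifP; lia.
  have -> : (pos w j < w.+1 + `|i|)%N = false by rewrite /pos; case: ifP; lia.
  by move=> ->; lia.
(* For [i < 0] compare the boxes removed at the indices from [i] down to [-w]. The canonical
   configuration removes as few as possible there, yet [c] would remove one fewer. *)
have e1 := SN w.+1 ltac:(lia); have e2 := SN `|i|%N ltac:(lia).
have : \sum_k (Nu w hw_conf `|i| k - Nu w hw_conf w.+1 k) <= \sum_k (Nu w c `|i| k - Nu w c w.+1 k).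
  apply: ler_sum => k _; rewrite !Nu_hw_confB ?leqnn //; last by lia.
  have h1 : Nu w c w.+1 k <= Nu w c `|i| k by apply: Nu_decr; lia.
  have h2 : Nu w c w.+1 k <= lam k by rewrite -(Nu_total gc k); apply: Nu_incr; lia.
  have h3 : Nu w c w.+1 k <= 0 by rewrite -(Nu0 w c k); apply: Nu_decr.
  have h4 := Nu_lower gc (i := `|i|%N) (k := k) ltac:(lia).
  have kn := ltn_ord k; rewrite /hw_sum_neg [X in _ - X <= _]ifT; last by lia.
  case: ifP => h; first by lia.
  have := h4 ltac:(lia); lia.
rewrite !sumrB e1 e2.
move: (\sum_k Nu w hw_conf `|i|%N k) (\sum_k Nu w hw_conf w.+1 k) => a b.
have -> : (pos w i < w.+1)%N by rewrite /pos; case: ifP; lia.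
have -> : (pos w i < `|i|)%N = false by rewrite /pos; case: ifP; lia.
have [j0|j0] := leP j 0.
  have -> : (pos w j < w.+1)%N by rewrite /pos; case: ifP; lia.
  have -> : (pos w j < `|i|)%N by rewrite /pos; case: ifP; lia.
  by lia.
have -> : (pos w j < w.+1)%N = false by rewrite /pos; case: ifP; lia.
have -> : (pos w j < `|i|)%N = false by rewrite /pos; case: ifP; lia.
by lia.
Qed.

Lemma Lambda_diag_out (r : halfZ) : (n.*2.+1 < `|r|)%N -> Lambda_diag lam r = 0.
Proof.
move=> hr; rewrite -wt_hw_conf /wt big1 // => k _; apply: (hw_conf_inW lam (w := n.*2.+1)) => //.
Qed.

(** A nonzero [E i j f] with [i < j] would be a vector of H, hence nonzero on a good configuration
    whose content [hw_content] excludes. *)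
Lemma rho_nplus f (x : glhat R) : H lam f -> hascontent (fun r => wt r hw_conf) f -> nplus x ->
  rho x f = 0.
Proof.
move=> fH fc [x1 x2]; have [w0 bf] := H_bounded_by fH; have [N bN] := glinf_band x.1.
rewrite (rhoE bf bN (leqnn _)) x2 mul0r scale0r addr0 /wsum.
apply: big1 => i _; apply: big1 => j _.
have [ij|ij] := boolP (i < j); last by rewrite x1 ?scale0r.
suff -> : E i j f = 0 by rewrite scaler0.
apply/eqP; apply: contraT => E0; exfalso.
have [w1 hw1] := H_E i j fH; pose w := (w1 + n.*2.+1 + `|i| + `|j|)%N.
have hw : Hw lam w (E i j f) by apply: Hw_widen hw1; rewrite /w; lia.
have [c Ec gc] := Hw_good hw E0.
apply: (hw_content (w := w) (i := i) (j := j) _ gc) => //; try (rewrite /w; lia).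
move=> r; have [k [c' /fc h mv]] := E_supp Ec.
by rewrite (moved_wt r mv) h.
Qed.

Lemma rho_cartan f (x : glhat R) : H lam f -> hascontent (fun r => wt r hw_conf) f -> cartan x ->
  rho x f = Lambda lam x *: f.
Proof.
move=> fH fc hx; have [w0 bf] := H_bounded_by fH; have [N bN] := glinf_band x.1.
pose w := (w0 + N + n.*2.+1)%N.
rewrite (rhoE (w' := w) bf bN); last by rewrite /w; lia.
rewrite /Lambda scalerDl; congr (_ + _).
rewrite (fsum_seq (s := chain w)) //; last first.
  move=> r; rewrite mem_chain => hr; rewrite Lambda_diag_out ?mulr0 //; move: hr; rewrite /w -ltnNge; lia.
rewrite /wsum scaler_suml big_seq [RHS]big_seq; apply: eq_bigr => i iw.
rewrite (bigD1_seq i iw (chain_uniq w)) /= big1 ?addr0 => [|j ji]; last first.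
  by rewrite hx ?scale0r // eq_sym.
rewrite E_diag -scalerA; congr (_ *: _); apply/funext => c; rewrite fockZ.
have [->|fc0] := eqVneq (f c) 0; first by rewrite !mulr0.
by rewrite (fc c fc0) wt_hw_conf.
Qed.

Lemma exists_hw_vector : exists f : fock,
  [/\ H lam f, f != 0 & hascontent (fun r => wt r hw_conf) f].
Proof.
have gc : good lam n.*2.+1 hw_conf by apply: good_hw_conf.
have [W [W1 W2 _]] := good_leading R (leqnn n.*2.+1) gc.
exists (applyw W (delta R (cfg0 lam n.*2.+1))); split.
- by apply: H_applyw; apply: (H_cfg0 R domlam (leqnn _) gc).
- by apply: contraNneq W2 => ->.
have h0 : hascontent (fun r => wt r (cfg0 lam n.*2.+1)) (delta R (cfg0 lam n.*2.+1)).
  by move=> c /delta_supp ->.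
by move=> c hc r; rewrite (applyw_content h0 hc) (applyw_content h0 W2).
Qed.
End HighestWeight.

(** * Uniqueness *)

Section Eigen.
Variables (F : fieldType) (W : lmodType F) (P : W -> Prop) (D : W -> W).
Hypotheses (P0 : P 0) (PP : forall a u w, P u -> P w -> P (a *: u + w)).
Hypothesis Dlin : forall a u w, P u -> P w -> D (a *: u + w) = a *: D u + D w.

Lemma pred_scale a u : P u -> P (a *: u).
Proof. by move=> Pu; rewrite -[_ *: _]addr0; apply: PP. Qed.

Lemma pred_sum I (s : seq I) (Q : pred I) (q : I -> W) : (forall i, Q i -> P (q i)) ->
  P (\sum_(i <- s | Q i) q i).
Proof. by move=> h; apply: (big_ind P) => // u w Pu Pw; rewrite -[u]scale1r; apply: PP. Qed.

Lemma pred_lin0 : D 0 = 0.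
Proof. by have := Dlin (-1) P0 P0; rewrite scaler0 add0r scaleN1r addNr. Qed.

Lemma pred_linZ a u : P u -> D (a *: u) = a *: D u.
Proof. by move=> Pu; rewrite -[a *: u]addr0 Dlin // pred_lin0 addr0. Qed.

Lemma pred_lin_sum I (s : seq I) (q : I -> W) : (forall i, P (q i)) ->
  D (\sum_(i <- s) q i) = \sum_(i <- s) D (q i).
Proof.
move=> h; elim: s => [|i s IH]; first by rewrite !big_nil pred_lin0.
by rewrite !big_cons -[q i]scale1r Dlin ?IH ?scale1r //; apply: pred_sum.
Qed.

(** Linearity is only assumed on [P], because for [rho] it is established on H; the usual
    elimination of the last eigenvalue stays inside [P]. *)
Lemma eigen_indep (ev : nat -> F) M (q : nat -> W) : injective ev ->
  (forall m, P (q m)) -> (forall m, D (q m) = ev m *: q m) ->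
  \sum_(m < M) q m = 0 -> forall m, (m < M)%N -> q m = 0.
Proof.
move=> ie; elim: M q => [//|M IH] q Pq Dq e.
have h m : (m < M)%N -> q m = 0.
  move=> mM; have ne : ev m - ev M != 0 by rewrite subr_eq0 (inj_eq ie) neq_ltn mM.
  suff : (ev m - ev M) *: q m = 0 by move/eqP; rewrite scaler_eq0 (negbTE ne) => /eqP.
  move: mM; apply: (IH (fun m => (ev m - ev M) *: q m)) => [k|k|].
  - exact: pred_scale.
  - by rewrite pred_linZ // Dq !scalerA mulrC.
  have := congr1 D e; rewrite pred_lin0 pred_lin_sum // => e2.
  have : \sum_(i < M.+1) (D (q i) - ev M *: q i) = 0.
    by rewrite sumrB -scaler_sumr e e2 scaler0 subr0.
  rewrite big_ord_recr /= Dq subrr addr0 => e3; rewrite -[RHS]e3.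
  by apply: eq_bigr => i _; rewrite Dq scalerBl.
move=> m; rewrite ltnS leq_eqVlt => /orP[/eqP ->|]; last exact: h.
by move: e; rewrite big_ord_recr /= big1 ?add0r // => i _; apply: h.
Qed.
End Eigen.

(** * The grading by diagonals *)

Section Grading.
Variable R : realType.
Local Notation C := R[i].

Lemma mulmat_diagl (A B : halfZ -> halfZ -> C) i j : (forall k l, k != l -> A k l = 0) ->
  mulmat A B i j = A i i * B i j.
Proof.
move=> hA; rewrite /mulmat (fsum_seq (s := [:: i])) ?big_seq1 // => k.
by rewrite inE => ki; rewrite hA ?mul0r // eq_sym.
Qed.

Lemma mulmat_diagr (A B : halfZ -> halfZ -> C) i j : (forall k l, k != l -> A k l = 0) ->
  mulmat B A i j = A j j * B i j.
Proof.
move=> hA; rewrite /mulmat (fsum_seq (s := [:: j])) ?big_seq1 1?mulrC // => k.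
by rewrite inE => ki; rewrite hA ?mulr0.
Qed.

Lemma mat_par_diag p (A : halfZ -> halfZ -> C) : (forall k l, k != l -> A k l = 0) ->
  mat_par p A = if p then 0 else A.
Proof.
move=> hA; apply/funext => k; apply/funext => l; rewrite /mat_par.
have [->|kl] := eqVneq k l; first by rewrite subrr; case: p.
by case: p; rewrite hA // if_same.
Qed.

Lemma supercomm_diag (A B : halfZ -> halfZ -> C) i j : (forall k l, k != l -> A k l = 0) ->
  supercomm_mat A B i j = (A i i - A j j) * B i j.
Proof.
move=> hA; rewrite /supercomm_mat !big_bool !(mat_par_diag _ hA) /= !mulmat0r !mulmat0l.
rewrite !scaler0 !subr0 !expr0 !scale1r !addr0 add0r.
have fE (f g : halfZ -> halfZ -> C) : (f + g) i j = f i j + g i j by [].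
have fN (f : halfZ -> halfZ -> C) : (- f) i j = - f i j by [].
rewrite !(fE, fN) !(mulmat_diagl _ _ _ hA) !(mulmat_diagr _ _ _ hA) /mat_par.
by case: (hodd (i - j)) => /=; rewrite !mulr0 ?subr0 ?addr0 ?add0r mulrBl.
Qed.

Lemma cocycle_diag (A B : glinf R) : (forall k l, k != l -> A k l = 0) -> cocycle A B = 0.
Proof.
move=> hA; rewrite /cocycle.
have -> : supercomm_mat (@Jmat R) A = 0.
  apply/funext => i; apply/funext => j; rewrite supercomm_diag => [|k l kl].
    by have [->|/hA ->] := eqVneq i j; rewrite ?subrr ?mul0r ?mulr0.
  by rewrite /Jmat (negbTE kl).
by rewrite mulmat0l /str fsbig1 // => k _; exact: mulr0.
Qed.

Definition dmat : halfZ -> halfZ -> C := fun i j => if i == j then i%:~R else 0.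

Lemma dmat_banded : dmat \in @banded_pred R.
Proof.
apply/asboolP; exists 0%N => i j; rewrite /dmat; case: eqP => // ->.
by rewrite subrr.
Qed.

(* The grading operator, diag([2k]) in terms of half-integral indices [k]. *)
Definition degop : glhat R := (GlInf dmat_banded, 0).

Lemma degop_diag k l : k != l -> degop.1 k l = 0.
Proof. by rewrite /= /dmat => /negbTE ->. Qed.

Lemma degop_homog : glhat_homog false degop.
Proof.
split=> // i j; have [->|/degop_diag //] := eqVneq i j.
by rewrite subrr.
Qed.

Definition ddiag (e : int) (x : glhat R) :=
  (forall i j : halfZ, i - j != e -> x.1 i j = 0) /\ x.2 = 0.

Lemma ddiag_homog e x : ddiag e x -> glhat_homog (hodd e) x.
Proof. by move=> [h h2]; split=> // i j hij; apply: h; apply: contra hij => /eqP ->. Qed.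

Lemma glinf_inj (A B : glinf R) : (forall i j, A i j = B i j) -> A = B.
Proof. by move=> h; apply: val_inj; apply/funext => i; apply/funext => j; exact: h. Qed.

Lemma degop_bracket e x : ddiag e x -> glhat_bracket degop x = e%:~R *: x.
Proof.
move=> [h h2]; rewrite /glhat_bracket cocycle_diag; last exact: degop_diag.
apply/pair_equal_spec; split; last first.
  by change (0 = e%:~R *: x.2); rewrite h2 scaler0.
apply: glinf_inj => i j; rewrite /= supercomm_diag; last exact: degop_diag.
rewrite /dmat !eqxx -rmorphB /=.
change ((i - j)%:~R * x.1 i j = e%:~R * x.1 i j).
by have [->//|/h ->] := eqVneq (i - j) e; rewrite !mulr0.
Qed.

Definition band_part (P : int -> bool) (A : halfZ -> halfZ -> C) : halfZ -> halfZ -> C :=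
  fun i j => if P (i - j) then A i j else 0.

Lemma band_part_banded P (A : glinf R) : band_part P A \in @banded_pred R.
Proof.
have /asboolP[N hN] := glinfP A; apply/asboolP; exists N => i j /hN h.
by rewrite /band_part h if_same.
Qed.

Definition bpart P (A : glinf R) : glinf R := GlInf (band_part_banded P A).

(** Bandedness makes the strictly lower part a finite sum of diagonals, each an eigenvector of the
    bracket with [degop]. *)
Lemma glhat_decomp (x : glhat R) : exists (u t : glhat R) (N : nat) (y : 'I_N -> glhat R),
  [/\ nplus u, cartan t, (forall k : 'I_N, ddiag k.+1%:Z (y k)) & x = u + t + \sum_k y k].
Proof.
have [N bN] := glinf_band x.1.
exists (bpart (fun d => d < 0) x.1, 0), (bpart (fun d => d == 0) x.1, x.2), N.
exists (fun k : 'I_N => (bpart (fun d => d == k.+1%:Z) x.1, 0)); split.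
- split=> // i j ij; rewrite /= /band_part ifF //; apply/negbTE; move: ij.
  by rewrite subr_lt0.
- by move=> i j ij; rewrite /= /band_part subr_eq0 (negbTE ij).
- by move=> k; split=> // i j /negbTE h; rewrite /= /band_part h.
have sum1 (I : finType) (F : I -> glhat R) : (\sum_i F i).1 = \sum_i (F i).1.
  by rewrite (big_morph (fun z : glhat R => z.1) (id1 := 0) (op1 := +%R)).
have sum2 (I : finType) (F : I -> glhat R) : (\sum_i F i).2 = \sum_i (F i).2.
  by rewrite (big_morph (fun z : glhat R => z.2) (id1 := 0) (op1 := +%R)).
have sumij (I : finType) (F : I -> glinf R) i j : (\sum_k F k : glinf R) i j = \sum_k F k i j.
  by rewrite (big_morph (fun z : glinf R => z i j) (id1 := 0) (op1 := +%R)).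
have e2 : forall a b c : glhat R, (a + b + c).2 = a.2 + b.2 + c.2 by [].
have e1 : forall a b c : glhat R, (a + b + c).1 = a.1 + b.1 + c.1 by [].
apply: injective_projections; last by rewrite e2 sum2 big1 // addr0 add0r.
rewrite e1 sum1; apply: glinf_inj => i j.
change (x.1 i j = band_part (fun d => d < 0) x.1 i j + band_part (fun d => d == 0) x.1 i j
    + (\sum_(k < N) bpart (fun d => d == k.+1%:Z) x.1 : glinf R) i j).
rewrite sumij /= /band_part.
have [ij|ij] := ltP (i - j) 0.
  by rewrite (lt_eqF ij) addr0 big1 ?addr0 // => k _; rewrite ifF //; lia.
have [e|ne] := eqVneq (i - j) 0.
  by rewrite add0r big1 ?addr0 // => k _; rewrite ifF //; lia.
rewrite !add0r; have [ijN|/bN h] := leqP `|i - j| N; last first.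
  by rewrite h big1 // => k _; rewrite if_same.
have hk : (`|i - j|.-1 < N)%N by lia.
rewrite (bigD1 (Ordinal hk)) //= ifT; last by lia.
rewrite big1 ?addr0 // => k km; rewrite ifF //; apply/negbTE; apply: contraNneq km => h.
by apply/eqP/val_inj => /=; lia.
Qed.
End Grading.

(** * The graph of the isomorphism *)

Section Iso.
Variables (R : realType) (n : nat) (lam : 'I_n -> int).
Local Notation C := R[i].
Local Notation fock := (fock R n).
Hypothesis domlam : forall k l : 'I_n, (k < l)%N -> lam l <= lam k.

Lemma rho_elem i j (f : fock) : H lam f -> rho (elem R i j) f = E i j f.
Proof.
move=> fH; have [w bf] := H_bounded_by fH; have [N bN] := glinf_band (elem R i j).1.
rewrite (rhoE (w' := w + N + `|i| + `|j|) bf bN); last by lia.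
rewrite /= mul0r scale0r addr0 /wsum.
have ic : i \in chain (w + N + `|i| + `|j|) by rewrite mem_chain; lia.
have jc : j \in chain (w + N + `|i| + `|j|) by rewrite mem_chain; lia.
rewrite (bigD1_seq i ic (chain_uniq _)) /= (bigD1_seq j jc (chain_uniq _)) /=.
rewrite /elem_mat !eqxx scale1r big1 ?addr0 => [|k /negbTE ->]; last by rewrite andbF scale0r.
rewrite big1 ?addr0 // => k /negbTE ki; rewrite big1 // => l _.
by rewrite ki scale0r.
Qed.

Lemma glhat_parity (x : glhat R) : exists x0 x1 : glhat R,
  [/\ glhat_homog false x0, glhat_homog true x1 & x = x0 + x1].
Proof.
exists (bpart (fun d => ~~ hodd d) x.1, x.2), (bpart hodd x.1, 0); split.
- by split=> // i j; rewrite /= /band_part; case: (hodd _).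
- by split=> // i j; rewrite /= /band_part; case: (hodd _).
apply: injective_projections; last by rewrite /= addr0.
apply: glinf_inj => i j.
change (x.1 i j = band_part (fun d => ~~ hodd d) x.1 i j + band_part hodd x.1 i j).
by rewrite /band_part; case: (hodd _); rewrite ?addr0 ?add0r.
Qed.

Variables (V : glhat_module R) (v : V) (p0 : bool) (v' : fock).
Local Notation W := (V * fock)%type.
Hypotheses (irr : is_irreducible V) (v0 : v != 0) (vp : v \in gpar p0).
Hypothesis vn : forall x, nplus x -> gact x v = 0.
Hypothesis vc : forall x, cartan x -> gact x v = Lambda lam x *: v.
Hypothesis vgen : forall U : {pred V}, is_submodule U -> v \in U -> forall w : V, w \in U.
Hypotheses (vH : H lam v') (v'0 : v' != 0) (v'c : hascontent (fun r => wt r (hw_conf lam)) v').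

Definition act (x : glhat R) (p : W) : W := (gact x p.1, rho x p.2).

(* Closure under strictly lower triangular elements only is imposed, which makes the
   eigenvalues of [degop] on [Q] visible; [Q_act] gives all of the algebra. *)
Inductive Q : W -> Prop :=
| Q_gen : Q (v, v')
| Q_lin a p q : Q p -> Q q -> Q (a *: p + q)
| Q_low (k : nat) y p : ddiag k.+1%:Z y -> Q p -> Q (act y p).

Lemma Q_H p : Q p -> H lam p.2.
Proof. by elim=> //= [a q r _ h _ h'|k y q _ _ h]; [exact: HP|exact: H_rho]. Qed.

Lemma act_lin x a p q : H lam p.2 -> H lam q.2 ->
  act x (a *: p + q) = a *: act x p + act x q.
Proof.
move=> hp hq; apply/pair_equal_spec; split=> /=; first exact: gact_linearr.
exact: rho_linear hp hq.
Qed.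

Lemma act_linl a x y p : H lam p.2 -> act (a *: x + y) p = a *: act x p + act y p.
Proof.
move=> hp; apply/pair_equal_spec; split=> /=; first exact: gact_linearl.
exact: rho_linearl hp.
Qed.

Lemma act_bracket p q x y u : glhat_homog p x -> glhat_homog q y -> H lam u.2 ->
  act (glhat_bracket x y) u = act x (act y u) - (-1) ^+ (p && q) *: act y (act x u).
Proof.
move=> hx hy hu; apply/pair_equal_spec; split=> /=; first exact: gact_bracket.
exact: rho_bracket hx hy hu.
Qed.

Lemma Q0 : Q 0.
Proof. by have := Q_lin (-1) Q_gen Q_gen; rewrite scaleN1r addNr. Qed.

Lemma QZ a p : Q p -> Q (a *: p).
Proof. by move=> h; rewrite -[_ *: _]addr0; apply: Q_lin => //; exact: Q0. Qed.

Lemma QD p q : Q p -> Q q -> Q (p + q).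
Proof. by move=> h h'; rewrite -[p]scale1r; apply: Q_lin. Qed.

Lemma Q_sum I (s : seq I) (P : pred I) (F : I -> W) : (forall i, P i -> Q (F i)) ->
  Q (\sum_(i <- s | P i) F i).
Proof. by move=> h; apply: (big_ind Q) => //; [exact: Q0|exact: QD]. Qed.

Lemma actD x y p : H lam p.2 -> act (x + y) p = act x p + act y p.
Proof. by move=> hp; rewrite -[x]scale1r act_linl // !scale1r. Qed.

Lemma act0 p : H lam p.2 -> act 0 p = 0.
Proof. by move=> hp; have := act_linl (-1) 0 0 hp; rewrite scaler0 addr0 scaleN1r addNr. Qed.

Lemma act_sum (I : finType) (F : I -> glhat R) p : H lam p.2 ->
  act (\sum_i F i) p = \sum_i act (F i) p.
Proof.
move=> hp; elim/big_rec2: _ => [|i y x _ <-]; first exact: act0.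
by rewrite actD.
Qed.

(** Induction on the lowering word, for all [x] at once: [x y] is [[x, y]] up to a multiple of
    [y x], and in both terms the induction hypothesis applies to what remains. *)
Lemma Q_act x p : Q p -> Q (act x p).
Proof.
move=> hQ; elim: hQ x => [|a q r hq IHq hr IHr|k y q hy hq IH] x.
- have [u [t [N [y [hu ht hy ->]]]]] := glhat_decomp x.
  rewrite !actD // act_sum //; apply: QD; last by apply: Q_sum => k _; apply: (Q_low (hy k)); exact: Q_gen.
  have -> : act u (v, v') = 0 by rewrite /act /= vn // (rho_nplus vH).
  rewrite add0r; have -> : act t (v, v') = Lambda lam t *: (v, v'); last exact: (QZ _ Q_gen).
  by rewrite /act /= vc // (rho_cartan domlam vH).
- by rewrite act_lin; [apply: Q_lin|exact: Q_H|exact: Q_H].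
have [x0 [x1 [h0 h1 ->]]] := glhat_parity x.
rewrite actD; last by apply/H_rho/Q_H.
have hom b z : glhat_homog b z -> Q (act z (act y q)).
  move=> hz; have := act_bracket hz (ddiag_homog hy) (Q_H hq).
  move/eqP; rewrite eq_sym subr_eq => /eqP ->.
  by apply: QD; [exact: IH|apply: QZ; exact: (Q_low hy)].
by apply: QD; [exact: hom h0|exact: hom h1].
Qed.

Lemma act_degop e y p : ddiag e y -> H lam p.2 ->
  act (degop R) (act y p) = act y (act (degop R) p) + e%:~R *: act y p.
Proof.
move=> hy hp; have := act_bracket (degop_homog R) (ddiag_homog hy) hp.
rewrite (degop_bracket hy) -[_ *: y]addr0 act_linl // act0 // addr0 /= expr0 scale1r.
by move=> ->; rewrite addrC subrK.
Qed.

Definition dval (m : nat) : C := Lambda lam (degop R) + m%:R.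

Lemma dval_inj : injective dval.
Proof. by move=> i j /addrI/eqP; rewrite eqr_nat => /eqP. Qed.

(* The parity of the degree determines the Z_2-degree, since indices are doubled;
   so no parity is needed on the Fock space. *)
Definition graded_sum M (q : nat -> W) p :=
  [/\ p = \sum_(m < M) q m,
      forall m, [/\ Q (q m), act (degop R) (q m) = dval m *: q m
                  & (q m).1 \in gpar (p0 (+) odd m)],
      forall m, (M <= m)%N -> q m = 0 & exists a, q 0%N = a *: (v, v')].

Lemma graded_sum_widen M M' q p : (M <= M')%N -> graded_sum M q p -> graded_sum M' q p.
Proof.
move=> le [-> h1 h2 h3]; split=> // [|m h]; last by apply: h2; apply: leq_trans h.
rewrite -(subnKC le) big_split_ord /= [X in _ + X]big1 ?addr0 // => i _.
by apply: h2; exact: leq_addr.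
Qed.

Lemma gpar0 p : (0 : V) \in gpar p. Proof. by have [] := @gpar_submod R V p. Qed.

Lemma act_0 x : act x 0 = 0.
Proof.
have := act_lin x (-1) (p := 0) (q := 0) (H0 R lam) (H0 R lam).
by rewrite scaler0 add0r scaleN1r addNr.
Qed.

Lemma Q_graded p : Q p -> exists M q, graded_sum M q p.
Proof.
elim=> [|a p1 p2 _ [M1 [q1 h1]] _ [M2 [q2 h2]]|k y p1 hy _ [M [q [-> h1 h2 h3]]]].
- exists 1%N, (fun m => if m == 0%N then (v, v') else 0); split.
  + by rewrite big_ord_recl big_ord0 addr0.
  + move=> [|m] /=; last by rewrite act_0 scaler0; split; [exact: Q0|by []|exact: gpar0].
    split; [exact: Q_gen| |by rewrite addbF].
    have dc : cartan (degop R) by move=> i j ij; rewrite degop_diag.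
    by rewrite /dval addr0 /act /= vc // (rho_cartan domlam vH).
  + by case.
  + by exists 1; rewrite scale1r.
- have [e1 f1 g1 [a1 k1]] := graded_sum_widen (leq_addr M2 M1) h1.
  have [e2 f2 g2 [a2 k2]] := graded_sum_widen (leq_addl M1 M2) h2.
  exists (M1 + M2)%N, (fun m => a *: q1 m + q2 m); split.
  + by rewrite e1 e2 scaler_sumr -big_split.
  + move=> m; have [Q1 D1 P1] := f1 m; have [Q2 D2 P2] := f2 m; split; first exact: Q_lin.
      by rewrite act_lin ?D1 ?D2; [rewrite scalerDr !scalerA mulrC|exact: Q_H|exact: Q_H].
    by have [_ cl] := @gpar_submod R V (p0 (+) odd m); apply: cl.
  + by move=> m h; rewrite g1 // g2 // scaler0 addr0.
  by exists (a * a1 + a2); rewrite k1 k2 scalerA -scalerDl.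
exists (k.+1 + M)%N, (fun m => if (k < m)%N then act y (q (m - k.+1)%N) else 0); split.
- rewrite big_split_ord /= [X in _ = X + _]big1 ?add0r => [|i _]; last by rewrite /= ifF //; have := ltn_ord i; lia.
  rewrite (pred_lin_sum (P := fun p : W => H lam p.2) (D := act y)) //; first last.
  + by move=> i; apply: Q_H; have [] := h1 i.
  + by move=> a u w hu hw; apply: act_lin.
  + by move=> a u w hu hw; apply: HP.
  + exact: H0.
  by apply: eq_bigr => i _; rewrite leq_addr addKn.
- move=> m; case: ltnP => km; last by rewrite act_0 scaler0; split; [exact: Q0|by []|exact: gpar0].
  have [Q1 D1 P1] := h1 (m - k.+1)%N; split; first exact: Q_low hy Q1.
    rewrite (act_degop hy (Q_H Q1)) D1.
    have -> : act y (dval (m - k.+1) *: q (m - k.+1)%N) = dval (m - k.+1) *: act y (q (m - k.+1)%N).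
      rewrite -[_ *: q _]addr0 act_lin ?act_0 ?addr0 //; [exact: Q_H|exact: H0].
    rewrite -scalerDl; congr (_ *: _); rewrite /dval -addrA; congr (_ + _).
    by rewrite natrB //; rewrite -[k.+1%:~R]/(k.+1%:R) subrK.
  have := gact_par (ddiag_homog hy) P1; rewrite /= /hodd /=.
  rewrite (_ : ~~ odd k (+) (p0 (+) odd (m - k.+1)) = p0 (+) odd m) //.
  by rewrite oddB //= addbCA; congr (_ (+) _); case: (odd m); case: (odd k).
- by move=> m h; rewrite ifT ?h2 ?act_0 //; lia.
by exists 0; rewrite scale0r.
Qed.

Lemma gact0 (x : glhat R) : gact x (0 : V) = 0.
Proof. by have := gact_linearr x (-1) (0 : V) 0; rewrite scaler0 add0r scaleN1r addNr. Qed.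

Lemma gactZ (x : glhat R) a (w : V) : gact x (a *: w) = a *: gact x w.
Proof. by have := gact_linearr x a w 0; rewrite gact0 !addr0. Qed.

Lemma rho0 (x : glhat R) : rho x (0 : fock) = 0.
Proof.
have := rho_linear x (-1) (H0 R lam) (H0 R lam).
by rewrite scaler0 add0r scaleN1r addNr.
Qed.

Lemma rhoZ (x : glhat R) a f : H lam f -> rho x (a *: f) = a *: rho x f.
Proof. by move=> fH; have := rho_linear x a fH (H0 R lam); rewrite rho0 !addr0. Qed.

Lemma degop_cartan : cartan (degop R).
Proof. by move=> i j ij; rewrite degop_diag. Qed.

(** Lowering operators have positive degree, so the part of [Q] of the top eigenvalue of [degop] is
    the line through [(v, v')]. *)
Lemma Q_top x y : Q (x *: v, y *: v') -> x = y.
Proof.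
move=> hQ; have [M [q hq]] := Q_graded hQ.
have {hq}[e h1 _ [a h3]] := graded_sum_widen (leqnSn M) hq.
have hH z : H lam (z *: v') by apply: HZ.
pose u : W := (x *: v, y *: v').
have Du : act (degop R) u = dval 0 *: u.
  rewrite /act /= gactZ vc ?rhoZ ?(rho_cartan domlam vH) //; try exact: degop_cartan.
  by rewrite /dval addr0 /u; apply/pair_equal_spec; split; rewrite /= !scalerA mulrC.
suff e0 : a *: (v, v') = u.
  have z : (a - x) *: v = 0 by rewrite scalerBl; move: (congr1 fst e0) => /= <-; rewrite subrr.
  have z' : (a - y) *: v' = 0 by rewrite scalerBl; move: (congr1 snd e0) => /= <-; rewrite subrr.
  move/eqP: z; move/eqP: z'; rewrite !scaler_eq0 (negbTE v0) (negbTE v'0) !orbF !subr_eq0.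
  by move=> /eqP <- /eqP.
pose f m := q m - (if m == 0%N then u else 0).
have sf : \sum_(m < M.+1) f m = 0.
  by rewrite /f sumrB -e [X in _ - X](bigD1 ord0) //= big1 ?addr0 ?subrr // => i /negbTE; case: i => -[|i] ?.
apply/eqP; rewrite -subr_eq0 -h3; apply/eqP.
have PP (b : C) (p1 p2 : W) : H lam p1.2 -> H lam p2.2 -> H lam (b *: p1 + p2).2 by apply: HP.
have Pu m : H lam (if m == 0%N then u else 0 : W).2 by case: eqP => _; [exact: hH|exact: H0].
have Pq m : H lam (q m).2 by apply: Q_H; have [] := h1 m.
have fE m : f m = -1 *: (if m == 0%N then u else 0) + q m by rewrite scaleN1r addrC.
apply: (@eigen_indep _ _ (fun p : W => H lam p.2) (act (degop R)) _ _ _ dval M.+1 f) => //.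
- exact: H0.
- by move=> b p1 p2; exact: act_lin.
- exact: dval_inj.
- by move=> m; rewrite fE; apply: PP.
move=> m; rewrite fE act_lin //; have [_ -> _] := h1 m.
rewrite scalerDr !scaleN1r scalerN; congr (- _ + _).
by case: eqP => [->|_]; [exact: Du|rewrite act_0 scaler0].
Qed.

(** Components are grouped by the parity of their degree. A vanishing second coordinate vanishes in
    each degree, as eigenvectors are independent; this is what makes the kernel a graded
    submodule. *)
Lemma Q_parity p : Q p -> exists r : bool -> W,
  [/\ forall b, Q (r b) /\ (r b).1 \in gpar b, p = r false + r true &
      p.2 = 0 -> forall b, (r b).2 = 0].
Proof.
move=> hQ; have [M [q [e h1 _ _]]] := Q_graded hQ.
exists (fun b => \sum_(m < M | p0 (+) odd m == b) q m); split.
- move=> b; split; first by apply: Q_sum => m _; have [] := h1 m.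
  have [g0 gl] := @gpar_submod R V b.
  elim/big_ind: _ => [|x y hx hy|m /eqP <-]; first by [].
    by rewrite -[x]scale1r; apply: gl.
  by have [] := h1 m.
- rewrite e (bigID (fun m : 'I_M => p0 (+) odd m == false)) /=; congr (_ + _).
  by apply: eq_bigl => m; case: (_ (+) _).
have snd_sum (P : pred 'I_M) : (\sum_(m < M | P m) q m).2 = \sum_(m < M | P m) (q m).2.
  by rewrite (big_morph (fun z : W => z.2) (id1 := 0) (op1 := +%R)).
move=> p2 b; rewrite snd_sum big1 // => m _.
apply: (@eigen_indep _ _ (H lam) (rho (degop R)) _ _ _ dval M (fun m => (q m).2)) => //.
- exact: H0.
- by move=> c f g; exact: HP.
- by move=> c f g; exact: rho_linear.
- exact: dval_inj.
- by move=> k; apply: Q_H; have [] := h1 k.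
- by move=> k; have [_ /(congr1 snd)] := h1 k.
by rewrite -snd_sum -e.
Qed.

Lemma gpar_unique (w0 w1 u0 u1 : V) : w0 \in gpar false -> w1 \in gpar true ->
  u0 \in gpar false -> u1 \in gpar true -> w0 + w1 = u0 + u1 -> w0 = u0 /\ w1 = u1.
Proof.
move=> hw0 hw1 hu0 hu1 e; have [z [_ uz]] := gpar_decomp (w0 + w1).
have z1 := uz (w0, w1) (And3 hw0 hw1 erefl); have z2 := uz (u0, u1) (And3 hu0 hu1 e).
by move: z2; rewrite z1 => -[-> ->].
Qed.

(** The vectors related to 0 form a submodule of [V]. If it were everything it would contain [v],
    against [Q_top]. *)
Lemma Q_inj1 w : Q (w, 0) -> w = 0.
Proof.
pose K : {pred V} := fun w => `[< Q (w, 0) >].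
have sK : is_submodule K.
  split.
  - split=> [|a u z /asboolP hu /asboolP hz]; first by apply/asboolP; exact: Q0.
    apply/asboolP; have := Q_lin a hu hz.
    by rewrite (_ : _ + _ = (a *: u + z, a *: 0 + 0)) // scaler0 addr0.
  - move=> u z hu hz /asboolP /Q_parity[r [hr e e2]].
    have [hr0 g0] := hr false; have [hr1 g1] := hr true.
    have [eu ez] := gpar_unique hu hz g0 g1 (congr1 fst e).
    have rE b : r b = ((r b).1, 0) by rewrite -(e2 _ b) //; case: (r b).
    by split; apply/asboolP; rewrite ?eu ?ez -rE.
  - move=> x u /asboolP /(Q_act x) hu; apply/asboolP; move: hu.
    by rewrite /act /= rho0.
have [_ /(_ K sK)[h|h]] := irr; first by move=> hw; apply: h; apply/asboolP.
have /asboolP := h v; rewrite -[v in Q (v, _)]scale1r -[X in Q (_, X)](scale0r v').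
by move=> /Q_top /eqP; rewrite oner_eq0.
Qed.

Lemma Q_inj2 f : Q (0, f) -> f = 0.
Proof.
move=> hf; apply/eqP; apply: contraT => f0.
have : Q (0 *: v, 1 *: v').
  rewrite scale0r scale1r; apply: (N_full domlam (N := fun f => Q (0, f)) _ _ _ hf f0 vH).
  - by move=> a g h hg hh; have := Q_lin a hg hh; rewrite -[_ + _]/(_ + _, _ + _) /= scaler0 addr0.
  - move=> i j g hg; have := Q_act (elem R i j) hg.
    by rewrite /act /= gact0 rho_elem //; exact: (Q_H hg).
  - by move=> g /Q_H.
by move=> /Q_top /eqP; rewrite eq_sym oner_eq0.
Qed.

Lemma Q_surj1 w : exists f, Q (w, f).
Proof.
pose K : {pred V} := fun w => `[< exists f, Q (w, f) >].
suff sK : is_submodule K.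
  have vK : v \in K by apply/asboolP; exists v'; exact: Q_gen.
  by have /asboolP := vgen sK vK w.
split.
- split=> [|a u z /asboolP[fu hu] /asboolP[fz hz]]; first by apply/asboolP; exists 0; exact: Q0.
  by apply/asboolP; exists (a *: fu + fz); exact: (Q_lin a hu hz).
- move=> u z hu hz /asboolP[f /Q_parity[r [hr e _]]].
  have [hr0 g0] := hr false; have [hr1 g1] := hr true.
  have [eu ez] := gpar_unique hu hz g0 g1 (congr1 fst e).
  by split; apply/asboolP; [exists (r false).2|exists (r true).2]; rewrite ?eu ?ez -surjective_pairing.
- by move=> x u /asboolP[f hf]; apply/asboolP; exists (rho x f); exact: (Q_act x hf).
Qed.

Lemma Q_surj2 f : H lam f -> exists w, Q (w, f).
Proof.
apply: (N_full domlam (N := fun f => exists w, Q (w, f)) _ _ _ _ v'0).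
- by move=> a g h [w hg] [z hh]; exists (a *: w + z); exact: (Q_lin a hg hh).
- move=> i j g [w hg]; exists (gact (elem R i j) w); have := Q_act (elem R i j) hg.
  by rewrite /act /= rho_elem //; exact: (Q_H hg).
- by move=> g [w /Q_H].
by exists v; exact: Q_gen.
Qed.
End Iso.

(** A relation instead of a map, since H is a predicate on functions and carries no module structure
    as a type. The last two conjuncts are totality on both sides and injectivity on both sides. *)
Definition intertwining_graph (R : realType) (n : nat) (lam : 'I_n -> int) (V : glhat_module R)
    (G : V * fock R n -> Prop) :=
  [/\ forall a p q, G p -> G q -> G (a *: p + q),
      forall p, G p -> H lam p.2,
      forall x p, G p -> G (gact x p.1, rho x p.2),
      (forall w, exists f, G (w, f)) /\ (forall f, H lam f -> exists w, G (w, f)) &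
      (forall w, G (w, 0) -> w = 0) /\ (forall f, G (0, f) -> f = 0)].

Lemma exists_intertwining_graph (R : realType) (n : nat) (lam : 'I_n -> int) (V : glhat_module R) :
  (forall k l : 'I_n, (k < l)%N -> lam l <= lam k) ->
  is_irr_hw_module V (Lambda lam) ->
  exists G : V * fock R n -> Prop, intertwining_graph lam G.
Proof.
move=> domlam [irr [v [v0 [p0 vp] vn vc] vgen]].
have [f [fH f0 fc]] := exists_hw_vector R domlam.
exists (Q v f); split.
- by move=> a p q; exact: Q_lin.
- by move=> p; exact: Q_H.
- by move=> x p; exact: (Q_act domlam vn vc fH fc).
- split=> [w|g]; first exact: (Q_surj1 domlam v0 vp vn vc vgen fH f0 fc).
  exact: (Q_surj2 domlam vn vc fH f0 fc).
split=> [w|g]; first exact: (Q_inj1 domlam irr v0 vp vn vc fH f0 fc).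
exact: (Q_inj2 domlam v0 vp vn vc fH f0 fc).
Qed.

(** * Tableaux *)

Section Tableau.
Variables (d : Order.disp_t) (A : orderType d) (deg : A -> bool).
Implicit Types (s : seq A) (a b : A).

Definition row_rel a b := if deg a && deg b then (a < b)%O else (a <= b)%O.
Definition cle b s := count (fun x => (x <= b)%O) s.
Definition clt b s := count (fun x => (x < b)%O) s.

Lemma onth_mem s j a : onth s j = Some a -> a \in s.
Proof. by elim: s j => [|x s IH] [|j] //=; [case=> ->; exact: mem_head|rewrite inE => /IH ->; rewrite orbT]. Qed.

Lemma row_relW a b : row_rel a b -> (a <= b)%O.
Proof. by rewrite /row_rel; case: ifP => // _ /ltW. Qed.

Lemma row_pairwise s :
  (forall i j a b, onth s i = Some a -> onth s j = Some b -> (i < j)%N -> row_rel a b) <->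
  pairwise row_rel s.
Proof.
split.
  elim: s => //= x s IH h; rewrite IH ?andbT => [|i j a b ha hb ij]; last first.
    exact: (h i.+1 j.+1).
  by apply/allP => y /nthP -/(_ x)[j js <-]; apply: (h 0%N j.+1) => //=; apply/eqP; rewrite onthE (nth_map x).
elim: s => [_ i j a b|x s IH /= /andP[/allP xs ps] i j a b]; first by rewrite onth0n.
case: i j => [|i] [|j] //=; last by rewrite ltnS; exact: IH.
by move=> [<-] hb _; apply: xs; exact: onth_mem hb.
Qed.

Lemma row_pairwiseE s : pairwise row_rel s <->
  sorted <=%O s /\ forall a, deg a -> (count_mem a s <= 1)%N.
Proof.
rewrite (sorted_pairwise le_trans); elim: s => [|x s IH] /=; first by split.
split.
  move=> /andP[/allP xs /IH[ps cs]]; split.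
    by rewrite ps andbT; apply/allP => y /xs /row_relW.
  move=> a da; case: eqP => [e|_]; last by rewrite add0n; exact: cs.
  suff -> : count_mem a s = 0%N by [].
  apply/count_memPn; apply/negP => /xs; rewrite e /row_rel da /= ltxx //.
move=> [/andP[/allP xs ps] cs]; apply/andP; split; last first.
  by apply/IH; split=> // a da; apply: leq_trans (cs a da); exact: leq_addl.
apply/allP => y ys; have := xs y ys; rewrite /row_rel; case: ifP => // /andP[dx dy] xy.
rewrite lt_neqAle xy andbT; apply/eqP => e; move: ys; rewrite -e -has_pred1 has_count lt0n.
by have := cs x dx; rewrite eqxx add1n ltnS leqn0 => ->.
Qed.

Lemma onth_count s j a : sorted <=%O s ->
  (onth s j = Some a <-> (clt a s <= j < cle a s)%N).
Proof.
rewrite (sorted_pairwise le_trans) /clt /cle; elim: s j => [|x s IH] j /=.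
  by rewrite onth0n; split=> //; lia.
move=> /andP[/allP xs ps]; have [xa|ax|xa] := ltgtP x a.
- case: j => [|j] /=; first by split=> [[e]|]; [rewrite e ltxx in xa|lia].
  by rewrite (IH j ps) add1n ltnS add1n ltnS.
- have z : count (fun x => (x <= a)%O) s = 0%N.
    apply/eqP; rewrite -leqn0 leqNgt -has_count; apply/hasP => -[y /xs xy ya].
    by have := lt_le_trans ax (le_trans xy ya); rewrite ltxx.
  rewrite z; split; last by lia.
  case: j => [|j] /=; first by case=> e; rewrite e ltxx in ax.
  move=> h; have /xs xa : a \in s by exact: onth_mem h.
  by have := lt_le_trans ax xa; rewrite ltxx.
subst a; have z : count (fun y => (y < x)%O) s = 0%N.
  apply/eqP; rewrite -leqn0 leqNgt -has_count; apply/hasP => -[y /xs xy yx].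
  by have := le_lt_trans xy yx; rewrite ltxx.
rewrite z; case: j => [|j] /=; first by split.
by rewrite (IH j ps) z add1n ltnS.
Qed.

Lemma cle_size b s : (cle b s <= size s)%N. Proof. exact: count_size. Qed.

Lemma cle_clt a b s : (b < a)%O -> (cle b s <= clt a s)%N.
Proof. by move=> ba; apply: sub_count => x /= xb; exact: le_lt_trans xb ba. Qed.

Section Columns.
Variables (n : nat) (al mu : 'I_n -> nat) (T : {ffun 'I_n -> seq A}).
Hypotheses (pmu : is_part mu) (pal : is_part al) (mual : forall i, (mu i <= al i)%N).

(* In terms of the shapes [mu + cle b] formed by the letters up to [b]. *)
Definition col_ok := forall (k l : 'I_n) b, (k < l)%N ->
  (mu l + cle b (T l) <= mu k + cle b (T k))%N /\
  (~~ deg b -> (mu l + cle b (T l) <= mu k + clt b (T k))%N).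

(** The conditions on pairs of cells become conditions on the shapes filled by initial segments of
    the alphabet, which is the form in which [step_ok] is stated. *)
Lemma SST_rows : is_SST deg al mu T <->
  [/\ forall i, size (T i) = (al i - mu i)%N, forall i, pairwise row_rel (T i) & col_ok].
Proof.
have entryE i j a : sorted <=%O (T i) ->
    has_entry mu T i j a <-> (mu i + clt a (T i) <= j < mu i + cle a (T i))%N.
  by move=> st; rewrite /has_entry onth_count //; lia.
have rowE : (forall i j1 j2 a b, has_entry mu T i j1 a -> has_entry mu T i j2 b ->
        (j1 < j2)%N -> if deg a && deg b then (a < b)%O else (a <= b)%O) <->
    forall i, pairwise row_rel (T i).
  split=> [h i|h i j1 j2 a b [m1 e1] [m2 e2] j12].
    apply/row_pairwise => j1 j2 a b e1 e2 j12; apply: (h i (mu i + j1)%N (mu i + j2)%N).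
    - by split; [exact: leq_addr|rewrite addKn].
    - by split; [exact: leq_addr|rewrite addKn].
    by rewrite ltn_add2l.
  by have /row_pairwise /(_ _ _ _ _ e1 e2) := h i; apply; lia.
have srt i : pairwise row_rel (T i) -> sorted <=%O (T i) by case/row_pairwiseE.
rewrite /is_SST; split=> [[sz /rowE rw cl]|[sz rw cl]]; split=> //; last first.
- move=> k l j a b; rewrite !entryE ?srt // => h1 h2 kl.
  have [c1 c2] := cl k l b kl.
  have ab : (a <= b)%O.
    rewrite leNgt; apply/negP => ba; have := cle_clt (T k) ba; lia.
  case: ifP => // /andP[da db]; rewrite lt_neqAle ab andbT; apply/eqP => e.
  by subst b; have := c2 da; lia.
- by apply/rowE.
have ent k j : (mu k <= j < al k)%N -> exists a, has_entry mu T k j a.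
  move=> hj; have : (j - mu k < size (T k))%N by rewrite sz; lia.
  rewrite -onthTE; case e: (onth _ _) => [a|//] _; exists a; split=> //; lia.
move=> k l b kl; have hmu : (mu l <= mu k)%N by apply: pmu; lia.
have hal : (al l <= al k)%N by apply: pal; lia.
have szl := cle_size b (T l); rewrite sz in szl; have ml := mual l.
split=> [|db]; rewrite leqNgt; apply/negP => hlt.
  (* The first cell of row [k] past the letters up to [b]; if the shapes were not nested, row [l]
     would have a letter at most [b] in the same column. *)
  have [a ha] := ent k (mu k + cle b (T k))%N ltac:(lia).
  have [b' hb] := ent l (mu k + cle b (T k))%N ltac:(lia).
  have := cl _ _ _ _ _ ha hb kl; move: ha hb; rewrite !entryE ?srt // => ha hb hab.
  have : (a <= b')%O by move: hab; case: ifP => // _ /ltW.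
  apply/negP; rewrite -ltNge; apply: (@le_lt_trans _ _ b).
    by rewrite leNgt; apply/negP => /(cle_clt (T l)); lia.
  rewrite ltNge; apply/negP => ab.
  have : (cle a (T k) <= cle b (T k))%N by apply: sub_count => x /= xa; exact: le_trans xa ab.
  lia.
(* The first cell of row [k] with a letter at least [b]; row [l] would have a letter at most [b] in
   the same column, which forces two equal letters of degree 0. *)
have [a ha] := ent k (mu k + clt b (T k))%N ltac:(lia).
have [b' hb] := ent l (mu k + clt b (T k))%N ltac:(lia).
have := cl _ _ _ _ _ ha hb kl; move: ha hb; rewrite !entryE ?srt // => ha hb hab.
have bb : (b' <= b)%O by rewrite leNgt; apply/negP => /(cle_clt (T l)); lia.
have ba : (b <= a)%O.
  rewrite leNgt; apply/negP => /(cle_clt (T k)); lia.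
have ab : (a <= b')%O by move: hab; case: ifP => // _ /ltW.
have e1 : a = b by apply: le_anti; rewrite ba (le_trans ab bb).
have e2 : b' = b by apply: le_anti; rewrite bb -{1}e1 ab.
by move: hab; rewrite e1 e2 db /= ltxx.
Qed.
End Columns.
End Tableau.

Section Fill.
Variables (d : Order.disp_t) (A : orderType d).

Definition fill (L : seq A) (m : A -> nat) : seq A :=
  sort <=%O (flatten [seq nseq (m a) a | a <- L]).

Lemma fill_sorted L m : sorted <=%O (fill L m).
Proof. by apply: sort_sorted; exact: le_total. Qed.

Lemma count_fill L m a : uniq L -> (a \notin L -> m a = 0%N) -> count_mem a (fill L m) = m a.
Proof.
move=> uL hm; rewrite /fill count_sort count_flatten sumnE !big_map.
have [aL|/[dup] aL /hm ->] := boolP (a \in L).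
  rewrite (bigD1_seq a aL uL) /= count_nseq /= eqxx mul1n big1 ?addn0 // => b.
  by rewrite count_nseq /= => /negbTE ->.
rewrite big_seq big1 // => b bL; rewrite count_nseq /=; case: eqP => // e.
by rewrite -e bL in aL.
Qed.

Lemma sorted_count_eq (s s' : seq A) : sorted <=%O s -> sorted <=%O s' ->
  (forall a, count_mem a s = count_mem a s') -> s = s'.
Proof.
move=> h h' e; apply: (sorted_eq le_trans le_anti) => //.
by apply/allP => a _ /=; rewrite e.
Qed.
End Fill.

(** * Tableau pairs as good configurations *)

Section Translate.
Variables (n : nat) (lam : 'I_n -> int) (w : nat).
Hypothesis domlam : forall k l : 'I_n, (k < l)%N -> lam l <= lam k.
Local Notation conf := (conf n).
Local Notation tab := (tab_pair n halfZ_pos halfZ_npos).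
Implicit Types (c : conf) (T : tab) (a : halfZ_pos) (b : halfZ_npos).

Definition counts T c :=
  (forall k a, count_mem a (T.1 k) = c (val a) k) /\
  (forall k b, count_mem b (T.2 k) = c (val b) k).

Lemma le_pos a a' : (a <= a')%O = (val a <= val a').
Proof. by []. Qed.
Lemma lt_pos a a' : (a < a')%O = (val a < val a').
Proof. by rewrite lt_neqAle [RHS]lt_neqAle. Qed.
Lemma le_npos b b' : (b <= b')%O = (val b <= val b').
Proof. by []. Qed.
Lemma lt_npos b b' : (b < b')%O = (val b < val b').
Proof. by rewrite lt_neqAle [RHS]lt_neqAle. Qed.

Section Counts.
Variables (T : tab) (c : conf).
Hypotheses (ct : counts T c) (cW : inW w c).

Lemma inW_occ r k : (w < `|r|)%N -> c r k = 0%N.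
Proof. by move=> /(cW k); rewrite /charge; case: ifP; lia. Qed.

Lemma count_pos_Nu k (r : nat) : 
  (count (fun x : halfZ_pos => val x <= r%:Z) (T.1 k))%:Z = Nu w c (w.+1 + r) k - Nu w c w.+1 k.
Proof.
elim: r => [|r IH].
  rewrite addn0 subrr (eq_count (a2 := pred0)) ?count_pred0 // => x /=.
  by apply/negbTE; rewrite -ltNge (valP x).
have r0 : 0 < (r.+1%:Z : halfZ) by [].
pose a : halfZ_pos := exist _ (r.+1%:Z : halfZ) r0.
have -> : count (fun x : halfZ_pos => val x <= r.+1%:Z) (T.1 k)
   = addn (count (fun x : halfZ_pos => val x <= r%:Z) (T.1 k)) (count_mem a (T.1 k)).
  have key (y : int) : (y <= r.+1%:Z) = addn (y <= r%:Z)%R (y == r.+1%:Z)%R :> nat by lia.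
  by elim: (T.1 k) => //= x s ->; rewrite -addnACA; congr addn; exact: key.
have ei : idx w (w.+1 + r) = r.+1%:Z by rewrite /idx ifF; lia.
rewrite PoszD IH addnS (NuS _ _ (w.+1 + r)) /charge ei (ct.1 k a) /=; lia.
Qed.

(** The chain takes the letters of [T.2] off from the largest, 0, downwards. *)
Lemma count_neg_Nu k (i : nat) : (i <= w.+1)%N ->
  (count (fun x : halfZ_npos => - i%:Z < val x) (T.2 k))%:Z = - Nu w c i k.
Proof.
elim: i => [|i IH] iw.
  rewrite Nu0 (eq_count (a2 := pred0)) ?count_pred0 // => x /=.
  by apply/negbTE; rewrite -leNgt oppr0 (valP x).
have r0 : (- i%:Z : halfZ) <= 0 by lia.
pose b : halfZ_npos := exist _ (- i%:Z : halfZ) r0.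
have -> : count (fun x : halfZ_npos => - i.+1%:Z < val x) (T.2 k)
   = addn (count (fun x : halfZ_npos => - i%:Z < val x) (T.2 k)) (count_mem b (T.2 k)).
  have key (y : int) : (- i.+1%:Z < y) = addn (- i%:Z < y)%R (y == - i%:Z)%R :> nat by lia.
  by elim: (T.2 k) => //= x s ->; rewrite -addnACA; congr addn; exact: key.
have ei : idx w i = - i%:Z by rewrite /idx ifT.
by rewrite PoszD IH ?(ltnW iw) // (NuS _ _ i) /charge ei (ct.2 k b) ifF /=; lia.
Qed.

Lemma pos_le_w k a : a \in T.1 k -> val a <= w%:Z.
Proof.
move=> aT; rewrite leNgt; apply/negP => hx; have := ct.1 k a; rewrite inW_occ; last by lia.
by move/count_memPn; rewrite aT.
Qed.

Lemma neg_ge_w k b : b \in T.2 k -> - w%:Z <= val b.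
Proof.
move=> bT; rewrite leNgt; apply/negP => hx; have := ct.2 k b; rewrite inW_occ; last by lia.
by move/count_memPn; rewrite bT.
Qed.

Lemma size_pos_Nu k : (size (T.1 k))%:Z = Nu w c w.*2.+1 k - Nu w c w.+1 k.
Proof.
have -> : w.*2.+1 = (w.+1 + w)%N by lia.
rewrite -count_pos_Nu; congr Posz; apply/eqP; rewrite eq_sym -all_count; apply/allP => x xT; exact: pos_le_w xT.
Qed.

Lemma size_neg_Nu k : (size (T.2 k))%:Z = - Nu w c w.+1 k.
Proof.
rewrite -count_neg_Nu //; congr Posz; apply/eqP; rewrite eq_sym -all_count; apply/allP => x xT.
by apply: lt_le_trans (neg_ge_w xT); lia.
Qed.

Lemma cle_pos a k : (cle a (T.1 k))%:Z =
  Nu w c (w.+1 + minn `|val a| w) k - Nu w c w.+1 k.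
Proof.
have a0 := valP a; have [aw|aw] := leqP `|val a| w.
  rewrite -count_pos_Nu; congr Posz; apply: eq_count => x /=; rewrite le_pos.
  have key (y z : int) : 0 < z -> (y <= z) = (y <= `|z|%N%:Z) by lia.
  exact: key.
have -> : (w.+1 + w)%N = w.*2.+1 by lia.
rewrite -size_pos_Nu; congr Posz; apply/eqP; rewrite -all_count; apply/allP => x xT.
rewrite le_pos; apply: le_trans (_ : w%:Z <= _); last by lia.
by have := pos_le_w xT.
Qed.

Lemma clt_pos a k : (clt a (T.1 k))%:Z =
  Nu w c (w.+1 + minn `|val a|.-1 w) k - Nu w c w.+1 k.
Proof.
have a0 := valP a; have [aw|aw] := leqP `|val a|.-1 w.
  rewrite -count_pos_Nu; congr Posz; apply: eq_count => x /=; rewrite lt_pos.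
  have key (y z : int) : 0 < z -> (y < z) = (y <= `|z|.-1%:Z) by lia.
  exact: key.
have -> : (w.+1 + w)%N = w.*2.+1 by lia.
rewrite -size_pos_Nu; congr Posz; apply/eqP; rewrite -all_count; apply/allP => x xT.
rewrite lt_pos; apply: le_lt_trans (_ : w%:Z < _); last by lia.
by have := pos_le_w xT.
Qed.

Lemma count_le_Nu (m : nat) k : (count (fun x : halfZ_npos => val x <= - m%:Z) (T.2 k))%:Z =
  Nu w c (minn m w.+1) k - Nu w c w.+1 k.
Proof.
have [mw|mw] := leqP m w.+1.
  have -> : count (fun x : halfZ_npos => val x <= - m%:Z) (T.2 k)
     = (size (T.2 k) - count (fun x : halfZ_npos => (- m%:Z < val x)%R) (T.2 k))%N.
    rewrite -(count_predC (fun x : halfZ_npos => (- m%:Z < val x)%R)) addKn.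
    by apply: eq_count => x; rewrite [RHS]/= -leNgt.
  by rewrite -subzn ?count_size // size_neg_Nu count_neg_Nu // opprK addrC.
rewrite subrr; congr Posz; apply/eqP; rewrite -leqn0 leqNgt -has_count.
apply/hasP => -[x /neg_ge_w h1 h2]; have := le_trans h1 h2; lia.
Qed.

Lemma cle_neg b k : (cle b (T.2 k))%:Z =
  Nu w c (minn `|val b| w.+1) k - Nu w c w.+1 k.
Proof.
have b0 := valP b; rewrite -count_le_Nu; congr Posz; apply: eq_count => x /=; rewrite le_npos.
have key (y z : int) : z <= 0 -> (y <= z) = (y <= - `|z|%N%:Z) by lia.
exact: key.
Qed.

Lemma clt_neg b k : (clt b (T.2 k))%:Z =
  Nu w c (minn `|val b|.+1 w.+1) k - Nu w c w.+1 k.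
Proof.
have b0 := valP b; rewrite -count_le_Nu; congr Posz; apply: eq_count => x /=; rewrite lt_npos.
have key (y z : int) : z <= 0 -> (y < z) = (y <= - `|z|.+1%:Z) by lia.
exact: key.
Qed.
End Counts.

(** The shape filled by the letters up to a given one, in [T.1] or in [T.2], is [d] plus the partial
    sum [Nu] at the corresponding position of the chain. Hence [col_ok] for consecutive letters is
    [step_ok]. *)
Lemma SST_good T c : inW w c -> counts T c ->
  SST_pairs deg_pos deg_npos lam T <->
  [/\ good lam w c, forall k, pairwise (row_rel deg_pos) (T.1 k)
    & forall k, pairwise (row_rel deg_npos) (T.2 k)].
Proof.
move=> cW ct; split.
  move=> [d [mu [al [pmu pal ald mud [S1 S2]]]]].
  have pd : is_part (fun _ : 'I_n => d) by [].
  have mual i : (mu i <= al i)%N by have [] := mud i.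
  have mudd i : (mu i <= d)%N by have [] := mud i.
  have [sz1 rw1 c1] := (SST_rows _ _ pmu pal mual).1 S1.
  have [sz2 rw2 c2] := (SST_rows _ _ pmu pd mudd).1 S2.
  have {c1} c1 (k l : 'I_n) a : (k < l)%N -> (mu l + cle a (T.1 l) <= mu k + cle a (T.1 k))%N /\
    (~~ deg_pos a -> (mu l + cle a (T.1 l) <= mu k + clt a (T.1 k))%N) := c1 k l a.
  have {c2} c2 (k l : 'I_n) b : (k < l)%N -> (mu l + cle b (T.2 l) <= mu k + cle b (T.2 k))%N /\
    (~~ deg_npos b -> (mu l + cle b (T.2 l) <= mu k + clt b (T.2 k))%N) := c2 k l b.
  have {sz1} sz1 k : size (T.1 k) = (al k - mu k)%N := sz1 k.
  have {sz2} sz2 k : size (T.2 k) = (d - mu k)%N := sz2 k.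
  split=> //.
  have e1 k : Nu w c w.+1 k = (mu k)%:Z - d%:Z.
    by have := size_neg_Nu ct cW k; rewrite sz2; have := mudd k; lia.
  split=> // [k|].
    rewrite nu_chain; have := size_pos_Nu ct cW k; rewrite sz1 e1.
    by have := mual k; have := ald k; lia.
  apply/good_idx => i iw.
  have domB j (k l : 'I_n) : (j <= w.+1)%N -> (k < l)%N -> Nu w c j l <= Nu w c j k.
    rewrite leq_eqVlt => /orP[/eqP -> kl|jw kl].
      by rewrite !e1; have := pmu k l (ltnW kl); lia.
    have r0 : (- j%:Z : halfZ) <= 0 by lia.
    pose b : halfZ_npos := exist _ (- j%:Z : halfZ) r0.
    have [+ _] := c2 k l b kl; have := cle_neg ct cW b k; have := cle_neg ct cW b l.
    have -> : minn `|val b| w.+1 = j by rewrite /=; lia.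
    by rewrite !e1; lia.
  move=> k l kl; have [hi|hi] := leqP i w.
    split; first exact: domB.
    have r0 : (- i%:Z : halfZ) <= 0 by lia.
    pose b : halfZ_npos := exist _ (- i%:Z : halfZ) r0.
    rewrite /idx hi => ho; rewrite ifF; last by lia.
    have [_ +] := c2 k l b kl; have := clt_neg ct cW b k; have := cle_neg ct cW b l.
    have -> : minn `|val b| w.+1 = i by rewrite /=; lia.
    have -> : minn `|val b|.+1 w.+1 = i.+1 by rewrite /=; lia.
    by rewrite !e1 /deg_npos /= ho; lia.
  have [r er] : exists r, i = (w.+1 + r)%N by exists (i - w.+1)%N; lia.
  have r0 : 0 < (r.+1%:Z : halfZ) by [].
  pose a : halfZ_pos := exist _ (r.+1%:Z : halfZ) r0.
  have ei : idx w i = r.+1%:Z by rewrite /idx ifF; lia.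
  have := clt_pos ct cW a k; have := cle_pos ct cW a k; have := cle_pos ct cW a l.
  have -> : (w.+1 + minn `|val a| w)%N = i.+1 by rewrite /=; lia.
  have -> : (w.+1 + minn `|val a|.-1 w)%N = i by rewrite /=; lia.
  rewrite ei !e1 => h1 h2 h3; have [h4 h5] := c1 k l a kl.
  split=> [|ho]; first by lia.
  have h6 : (mu l + cle a (T.1 l) <= mu k + clt a (T.1 k))%N by apply: h5; rewrite /deg_pos negbK.
  by rewrite /=; lia.
move=> [gc rw1 rw2]; have [_ nuc /good_idx gi] := gc.
(* Any [d] this large works: it makes both [mu] and [al] natural numbers. *)
have [d dk] : exists d, forall k, (size (T.2 k) + `|lam k| <= d)%N.
  by exists (\sum_k (size (T.2 k) + `|lam k|))%N => k; rewrite (bigD1 k) //= leq_addr.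
have e1 k := size_neg_Nu ct cW k; have e2 k := size_pos_Nu ct cW k.
have tot k := Nu_total gc k.
have dom j (k l : 'I_n) : (j <= w.*2.+1)%N -> (k < l)%N -> Nu w c j l <= Nu w c j k.
  case: j => [|j] jw kl; first by rewrite !Nu0.
  by have [] := gi j jw k l kl.
pose mu (k : 'I_n) := (d - size (T.2 k))%N; pose al (k : 'I_n) := absz (lam k + d%:Z).
have ale k : (al k)%:Z = lam k + d%:Z by have := dk k; rewrite /al; lia.
have mue k : (mu k)%:Z = d%:Z + Nu w c w.+1 k by have := dk k; have := e1 k; rewrite /mu; lia.
have pmu : is_part mu.
  move=> k l; rewrite leq_eqVlt => /orP[/eqP/val_inj -> //|kl].
  by have := dom w.+1 k l ltac:(lia) kl; have := mue k; have := mue l; lia.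
have pal : is_part al.
  move=> k l; rewrite leq_eqVlt => /orP[/eqP/val_inj -> //|kl].
  by have := domlam kl; have := ale k; have := ale l; lia.
have mual k : (mu k <= al k)%N.
  by have := mue k; have := ale k; have := e2 k; rewrite tot; lia.
have mud k : (mu k <= d)%N by rewrite /mu; lia.
have pd : is_part (fun _ : 'I_n => d) by [].
have sz1 k : size (T.1 k) = (al k - mu k)%N.
  by have := mue k; have := ale k; have := e2 k; rewrite tot; lia.
have sz2 k : size (T.2 k) = (d - mu k)%N by have := dk k; rewrite /mu; lia.
have c1 (k l : 'I_n) a : (k < l)%N -> (mu l + cle a (T.1 l) <= mu k + cle a (T.1 k))%N /\
    (~~ deg_pos a -> (mu l + cle a (T.1 l) <= mu k + clt a (T.1 k))%N).
  move=> kl.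
  have := clt_pos ct cW a k; have := cle_pos ct cW a k; have := cle_pos ct cW a l.
  have := mue k; have := mue l; have a0 := valP a.
  have [aw|aw] := boolP (`|val a| <= w)%N.
    have [q eq] : exists q, `|val a|%N = q.+1 by exists `|val a|.-1; lia.
    have -> : (w.+1 + minn `|val a| w)%N = (w.+1 + q).+1 by lia.
    have -> : (w.+1 + minn `|val a|.-1 w)%N = (w.+1 + q)%N by lia.
    have [h1 h2] := gi (w.+1 + q)%N ltac:(lia) k l kl.
    have ei : idx w (w.+1 + q) = val a by rewrite /idx ifF; lia.
    rewrite ei a0 in h2; rewrite /deg_pos negbK => *; split; first by lia.
    by move=> /h2; lia.
  (* Beyond the window the letter [a] does not occur, and only the dominance of the final shape
     remains. *)
  have -> : (w.+1 + minn `|val a| w)%N = w.*2.+1 by lia.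
  have -> : (w.+1 + minn `|val a|.-1 w)%N = w.*2.+1 by lia.
  by have := dom w.*2.+1 k l (leqnn _) kl; lia.
have c2 (k l : 'I_n) b : (k < l)%N -> (mu l + cle b (T.2 l) <= mu k + cle b (T.2 k))%N /\
    (~~ deg_npos b -> (mu l + cle b (T.2 l) <= mu k + clt b (T.2 k))%N).
  move=> kl.
  have := clt_neg ct cW b k; have := cle_neg ct cW b k; have := cle_neg ct cW b l.
  have := mue k; have := mue l; have b0 := valP b.
  have [bw|bw] := boolP (`|val b| <= w)%N.
    have -> : minn `|val b| w.+1 = `|val b|%N by lia.
    have -> : minn `|val b|.+1 w.+1 = `|val b|.+1 by lia.
    have [_ h2] := gi `|val b|%N ltac:(lia) k l kl.
    have ei : idx w `|val b| = val b by rewrite /idx ifT; lia.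
    have h1 := dom `|val b|%N k l ltac:(lia) kl.
    rewrite ei ifF in h2; last by lia.
    rewrite /deg_npos negbK => *; split; first by lia.
    by move=> /h2; lia.
  have -> : minn `|val b| w.+1 = w.+1 by lia.
  have -> : minn `|val b|.+1 w.+1 = w.+1 by lia.
  by have := dom w.+1 k l ltac:(lia) kl; lia.
exists d, mu, al; split=> //; split.
  by apply/(SST_rows _ _ pmu pal mual); split.
by apply/(SST_rows _ _ pmu pd mud); split.
Qed.
End Translate.

(** * Counting tableau pairs of given content *)

Section CountTableaux.
Variables (n : nat) (lam : 'I_n -> int) (w : nat).
Hypothesis domlam : forall k l : 'I_n, (k < l)%N -> lam l <= lam k.
Local Notation conf := (conf n).
Local Notation tab := (tab_pair n halfZ_pos halfZ_npos).
Implicit Types (c : conf) (T : tab) (a : halfZ_pos) (b : halfZ_npos).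

Definition win_pos : seq halfZ_pos := pmap insub (chain w).
Definition win_npos : seq halfZ_npos := pmap insub (chain w).

Definition tab_of c : tab :=
  ([ffun k => fill win_pos (fun a => c (val a) k)],
   [ffun k => fill win_npos (fun b => c (val b) k)]).

Lemma counts_tab_of c : inW w c -> counts (tab_of c) c.
Proof.
move=> cW; split=> k a; rewrite ffunE count_fill ?pmap_sub_uniq ?chain_uniq //.
  by rewrite mem_pmap_sub mem_chain -ltnNge => /(inW_occ cW).
by rewrite mem_pmap_sub mem_chain -ltnNge => /(inW_occ cW).
Qed.

Lemma rows_tab_of c : inW w c ->
  (forall k, pairwise (row_rel deg_pos) ((tab_of c).1 k)) /\
  (forall k, pairwise (row_rel deg_npos) ((tab_of c).2 k)).
Proof.
move=> cW; have [c1 c2] := counts_tab_of cW; split=> k; apply/row_pairwiseE; split.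
- by rewrite ffunE; exact: fill_sorted.
- by move=> a da; rewrite c1; apply: occ_ferm.
- by rewrite ffunE; exact: fill_sorted.
by move=> b db; rewrite c2; apply: occ_ferm.
Qed.

Lemma counts_inj T c c' : counts T c -> counts T c' -> c = c'.
Proof.
move=> [h1 h2] [h1' h2']; apply: conf_eq => r k; have [r0|r0] := ltP 0 r.
  by have := h1 k (exist _ r r0); rewrite h1' /= => ->.
by have := h2 k (exist _ r r0); rewrite h2' /= => ->.
Qed.

Lemma SST_pairs_rows T : SST_pairs deg_pos deg_npos lam T ->
  (forall k, pairwise (row_rel deg_pos) (T.1 k)) /\
  (forall k, pairwise (row_rel deg_npos) (T.2 k)).
Proof.
move=> [d [mu [al [pmu pal ald mud [S1 S2]]]]].
have pd : is_part (fun _ : 'I_n => d) by [].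
have mual i : (mu i <= al i)%N by have [] := mud i.
have mudd i : (mu i <= d)%N by have [] := mud i.
have [_ rw1 _] := (SST_rows _ _ pmu pal mual).1 S1.
by have [_ rw2 _] := (SST_rows _ _ pmu pd mudd).1 S2.
Qed.

Lemma exists_counts T : (forall k, pairwise (row_rel deg_pos) (T.1 k)) ->
  (forall k, pairwise (row_rel deg_npos) (T.2 k)) -> exists c, counts T c.
Proof.
move=> rw1 rw2.
pose o (r : halfZ) k := addn (count (fun a : halfZ_pos => val a == r) (T.1 k))
  (count (fun b : halfZ_npos => val b == r) (T.2 k)).
have o1 k a : o (val a) k = count_mem a (T.1 k).
  rewrite /o [X in addn _ X](eq_count (a2 := pred0)) ?count_pred0 ?addn0 // => b /=.
  apply/negbTE/eqP => e; have : 0 < val b by rewrite (e : val b = val a) (valP a).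
  by rewrite ltNge (valP b).
have o2 k b : o (val b) k = count_mem b (T.2 k).
  rewrite /o [X in addn X _](eq_count (a2 := pred0)) ?count_pred0 // => a /=.
  apply/negbTE/eqP => e; have : 0 < val b by rewrite -(e : val a = val b) (valP a).
  by rewrite ltNge (valP b).
have oP : `[< forall r k, ferm r -> (o r k <= 1)%N >].
  apply/asboolP => r k fr; have [r0|r0] := ltP 0 r.
    rewrite (o1 k (exist _ r r0)); have /row_pairwiseE[_] := rw1 k; exact.
  rewrite (o2 k (exist _ r r0)); have /row_pairwiseE[_] := rw2 k; exact.
by exists (Conf oP); split=> k x; rewrite /= ?o1 ?o2.
Qed.

Lemma tab_of_counts T c : inW w c -> counts T c ->
  (forall k, pairwise (row_rel deg_pos) (T.1 k)) ->
  (forall k, pairwise (row_rel deg_npos) (T.2 k)) -> T = tab_of c.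
Proof.
move=> cW [c1 c2] rw1 rw2; have [d1 d2] := counts_tab_of cW.
apply: injective_projections; apply/ffunP => k; apply: sorted_count_eq.
- by have /row_pairwiseE[] := rw1 k.
- by rewrite ffunE; exact: fill_sorted.
- by move=> a; rewrite c1 d1.
- by have /row_pairwiseE[] := rw2 k.
- by rewrite ffunE; exact: fill_sorted.
by move=> a; rewrite c2 d2.
Qed.

Variables (p : halfZ_pos -> nat) (q : halfZ_npos -> nat) (eta : halfZ -> int) (gs : seq conf).
Hypotheses (etap : forall a, eta (val a) = (p a)%:Z) (etaq : forall b, eta (val b) = - (q b)%:Z).
Hypothesis eta_w : forall r : halfZ, (w < `|r|)%N -> eta r = 0.
Hypothesis enum_gs : enumerates lam gs w eta.

Lemma counts_wt T c : counts T c ->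
  (forall r, wt r c = eta r) <-> (mult T.1 =1 p /\ mult T.2 =1 q).
Proof.
move=> [c1 c2].
have w1 a : wt (val a) c = (mult T.1 a)%:Z.
  rewrite /wt /mult (big_morph Posz PoszD (erefl _)); apply: eq_bigr => k _; rewrite /charge (valP a) c1 //.
have w2 b : wt (val b) c = - (mult T.2 b)%:Z.
  rewrite /wt /mult (big_morph Posz PoszD (erefl _)) -sumrN; apply: eq_bigr => k _.
  by rewrite /charge ifF ?c2 //; have := valP b; lia.
split=> [h|[h1 h2] r].
  split=> x; first by have := h (val x); rewrite w1 etap => -[].
  by have := h (val x); rewrite w2 etaq => /oppr_inj[].
have [r0|r0] := ltP 0 r.
  by have := w1 (exist _ r r0); rewrite /= => ->; rewrite h1 -etap.
by have := w2 (exist _ r r0); rewrite /= => ->; rewrite h2 -etaq.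
Qed.

(** [tab_of] is a bijection from the good configurations of content [eta]: a sorted row is
    determined by its multiplicities. *)
Lemma Sfun_size : Sfun deg_pos deg_npos lam p q = size gs.
Proof.
have [ugs hgs] := enum_gs.
have gW c : c \in gs -> inW w c by move/hgs => [[]].
have S_eq : SST_pairs_of_content deg_pos deg_npos lam p q = [set` [seq tab_of c | c <- gs]].
  apply/seteqP; split=> T /=.
    move=> [ST [m1 m2]].
    have [rw1 rw2] := SST_pairs_rows ST.
    have [c ct] := exists_counts rw1 rw2.
    have wtc := (counts_wt ct).2 (conj m1 m2).
    have cW : inW w c.
      by move=> r k hr; apply: wt_eq0; rewrite wtc eta_w.
    apply/seq.mapP; exists c; last exact: tab_of_counts.
    by apply/hgs; split=> //; have [] := (SST_good domlam cW ct).1 ST.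
  move=> /seq.mapP[c cgs ->]; have cW := gW c cgs; have [gc wc] := (hgs c).1 cgs.
  have ct := counts_tab_of cW; have [rw1 rw2] := rows_tab_of cW.
  split; first by apply/(SST_good domlam cW ct).
  exact: (counts_wt ct).1.
rewrite /Sfun S_eq.
have -> : fset_set [set` [seq tab_of c | c <- gs]] = seq_fset tt [seq tab_of c | c <- gs].
  by apply/fsetP => x; rewrite in_fset_set ?seq_fsetE ?mem_setE //; exact: finite_seq.
rewrite size_seq_fset undup_id ?size_map // map_inj_in_uniq // => c c' cg cg' e.
by apply: (counts_inj (counts_tab_of (gW c cg))); rewrite e; exact: counts_tab_of (gW _ cg').
Qed.
End CountTableaux.

(** * Characters *)

Section Weights.
Variable R : realType.
Local Notation C := R[i].
Implicit Types (p : halfZ_pos -> nat) (q : halfZ_npos -> nat).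

Definition content p q (r : halfZ) : int :=
  match insub r : option halfZ_pos with
  | Some a => (p a)%:Z
  | None => match insub r : option halfZ_npos with Some b => - (q b)%:Z | None => 0 end
  end.

Lemma content_pos p q (a : halfZ_pos) : content p q (val a) = (p a)%:Z.
Proof. by rewrite /content valK. Qed.

Lemma content_npos p q (b : halfZ_npos) : content p q (val b) = - (q b)%:Z.
Proof. by rewrite /content insubN ?valK // -leNgt (valP b). Qed.

Definition in_window (w : nat) p q :=
  (forall a, (w < `|val a|)%N -> p a = 0%N) /\ (forall b, (w < `|val b|)%N -> q b = 0%N).

Lemma content_out w p q (r : halfZ) : in_window w p q -> (w < `|r|)%N -> content p q r = 0.
Proof.
move=> [h1 h2] hr; have [r0|r0] := ltP 0 r.
  by rewrite (content_pos p q (exist _ r r0)) h1.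
by rewrite (content_npos p q (exist _ r r0)) h2 ?oppr0.
Qed.

Lemma monomial_weightE w p q r : in_window w p q ->
  monomial_weight R p q r = (content p q r)%:~R.
Proof.
move=> [hp hq]; rewrite /monomial_weight.
rewrite (fsum_seq (s := win_pos w)); first last.
  - by move=> a; rewrite mem_pmap_sub mem_chain -ltnNge => /hp ->; rewrite mulr0n.
  - exact/pmap_sub_uniq/chain_uniq.
rewrite (fsum_seq (s := win_npos w)); first last.
  - by move=> a; rewrite mem_pmap_sub mem_chain -ltnNge => /hq ->; rewrite mulr0n.
  - exact/pmap_sub_uniq/chain_uniq.
have sumE (I : Type) (s : seq I) (F : I -> weight R) : (\sum_(i <- s) F i) r = \sum_(i <- s) F i r.
  by elim: s => [|i s IH]; rewrite ?big_nil // !big_cons -IH.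
have mulE (f : weight R) m : (f *+ m) r = f r *+ m.
  by elim: m => [|m IH]; rewrite ?mulr0n // !mulrS -IH.
change ((\sum_(a <- win_pos w) omega R (val a) *+ p a) r
  - (\sum_(b <- win_npos w) omega R (val b) *+ q b) r = (content p q r)%:~R).
rewrite !sumE; under eq_bigr do rewrite mulE; under [X in _ - X]eq_bigr do rewrite mulE.
have [r0|r0] := ltP 0 r.
  pose a : halfZ_pos := exist _ r r0.
  rewrite [X in _ - X]big1 => [|b _]; last first.
    rewrite /omega (_ : (r == val b) = false) ?mul0rn //.
    by apply/negbTE/eqP => e; have := r0; rewrite ltNge e (valP b).
  rewrite subr0 -[r]/(val a) content_pos.
  have [aw|aw] := boolP (a \in win_pos w).
    rewrite (bigD1_seq a aw) ?pmap_sub_uniq ?chain_uniq //= big1 => [|b ba].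
      by rewrite addr0 /omega eqxx.
    rewrite /omega (_ : (_ == _) = false) ?mul0rn //.
    by apply: contraNF ba => /eqP e; apply/eqP/val_inj.
  rewrite hp; last by move: aw; rewrite mem_pmap_sub mem_chain -ltnNge.
  rewrite big_seq big1 // => b bw; rewrite /omega (_ : (_ == _) = false) ?mul0rn //.
  by apply: contraNF aw => /eqP /val_inj ->.
pose b : halfZ_npos := exist _ r r0.
rewrite big1 => [|a _]; last first.
  rewrite /omega (_ : (r == val a) = false) ?mul0rn //.
  by apply/negbTE/eqP => e; have := r0; rewrite leNgt e (valP a).
rewrite sub0r -[r]/(val b) content_npos mulrNz; congr (- _).
have [bw|bw] := boolP (b \in win_npos w).
  rewrite (bigD1_seq b bw) ?pmap_sub_uniq ?chain_uniq //= big1 => [|a ba].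
    by rewrite addr0 /omega eqxx.
  rewrite /omega (_ : (_ == _) = false) ?mul0rn //.
  by apply: contraNF ba => /eqP e; apply/eqP/val_inj.
rewrite hq; last by move: bw; rewrite mem_pmap_sub mem_chain -ltnNge.
rewrite big_seq big1 // => a aw; rewrite /omega (_ : (_ == _) = false) ?mul0rn //.
by apply: contraNF bw => /eqP /val_inj ->.
Qed.

Lemma monomial_weight_inj w w' p q p' q' : in_window w p q -> in_window w' p' q' ->
  monomial_weight R p q = monomial_weight R p' q' -> (p, q) = (p', q').
Proof.
move=> h h' e.
have ce r : content p q r = content p' q' r.
  by apply: (@intr_inj C); rewrite -(monomial_weightE _ h) -(monomial_weightE _ h') e.
congr (_, _); apply/funext => x.
  by have := ce (val x); rewrite !content_pos => -[].
by have := ce (val x); rewrite !content_npos => /oppr_inj[].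
Qed.

Lemma mult_window (X : eqType) n (T : {ffun 'I_n -> seq X}) (h : X -> nat) : exists w,
  forall x, (w < h x)%N -> mult T x = 0%N.
Proof.
exists (\sum_k \sum_(x <- T k) h x)%N => x hx; rewrite /mult big1 // => k _.
apply/count_memPn; apply/negP => xT; move: hx; rewrite ltnNge => /negP; apply.
by rewrite (bigD1 k) //= (big_rem x) //= -addnA leq_addr.
Qed.

Lemma Sfun_window n (lam : 'I_n -> int) p q : Sfun deg_pos deg_npos lam p q != 0%N ->
  exists w, in_window w p q.
Proof.
rewrite /Sfun cardfs_eq0 => /fset0Pn[T].
rewrite in_fset_set; last exact: finite_SST_pairs_of_content.
rewrite in_setE => -[_ [m1 m2]].
have [w1 h1] := mult_window T.1 (fun a => `|val a|%N).
have [w2 h2] := mult_window T.2 (fun b => `|val b|%N).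
exists (maxn w1 w2); split=> x hx; rewrite -?m1 -?m2; [apply: h1|apply: h2].
  by apply: leq_ltn_trans hx; exact: leq_maxl.
by apply: leq_ltn_trans hx; exact: leq_maxr.
Qed.

(** A single exponent contributes: those of finite support are determined by their weight, and the
    others have coefficient 0. *)
Lemma Sfun_exp_window n (lam : 'I_n -> int) w p q : in_window w p q ->
  Sfun_exp lam (monomial_weight R p q) = Sfun deg_pos deg_npos lam p q.
Proof.
move=> h; rewrite /Sfun_exp fsbig_mkcond (fsum_seq (s := [:: (p, q)])) //.
  by rewrite big_seq1 /patch ifT // in_setE.
move=> [p' q']; rewrite inE => ne; rewrite /patch; case: ifP => //.
rewrite in_setE /= => e; apply/eqP; apply: contraNT ne => /Sfun_window[w' h'].
by apply/eqP; exact: monomial_weight_inj h' h e.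
Qed.

Lemma Sfun_exp0 n (lam : 'I_n -> int) (mu : weight R) :
  (forall w p q, in_window w p q -> monomial_weight R p q <> mu) -> Sfun_exp lam mu = 0%N.
Proof.
move=> h; rewrite /Sfun_exp fsbig1 // => -[p q] /= e; apply/eqP; apply: contraT.
by move=> /Sfun_window[w hw]; have := h w p q hw.
Qed.

Lemma wt_content n w (c : conf n) : inW w c ->
  exists p q, in_window w p q /\ forall r, content p q r = wt r c.
Proof.
move=> cW; exists (fun a => `|wt (val a) c|%N), (fun b => `|wt (val b) c|%N).
have out r : (w < `|r|)%N -> wt r c = 0 by move=> hr; rewrite /wt big1 // => k _; exact: cW.
split; first by split=> x /out ->.
move=> r; have [r0|r0] := ltP 0 r.
  rewrite -[r]/(val (exist _ r r0 : halfZ_pos)) content_pos /=.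
  suff : 0 <= wt r c by lia.
  by apply: sumr_ge0 => k _; have [h _ _] := gvalid_charge c r k; exact: h.
rewrite -[r]/(val (exist _ r r0 : halfZ_npos)) content_npos /=.
suff : wt r c <= 0 by lia.
by apply: sumr_le0 => k _; have [_ h _] := gvalid_charge c r k; exact: h.
Qed.
End Weights.

(** * Transport of weight spaces along the graph *)

Section Character.
Variables (R : realType) (n : nat) (lam : 'I_n -> int) (V : glhat_module R).
Local Notation C := R[i].
Local Notation fock := (fock R n).
Hypothesis domlam : forall k l : 'I_n, (k < l)%N -> lam l <= lam k.
Variable G : V * fock -> Prop.
Hypothesis hG : intertwining_graph lam G.

Let GP a v w (f g : fock) : G (v, f) -> G (w, g) -> G (a *: v + w, a *: f + g).
Proof. by case: hG => h _ _ _ _; exact: h. Qed.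

Lemma graph_eq v w f : G (v, f) -> G (w, f) -> v = w.
Proof.
move=> h1 h2; have := GP (-1) h1 h2; rewrite !scaleN1r addNr.
by case: hG => _ _ _ _ [h _] /h/eqP; rewrite addrC subr_eq0 => /eqP.
Qed.

Lemma graph_eqr v f g : G (v, f) -> G (v, g) -> f = g.
Proof.
move=> h1 h2; have := GP (-1) h1 h2; rewrite !scaleN1r addNr.
by case: hG => _ _ _ _ [_ h] /h/eqP; rewrite addrC subr_eq0 => /eqP.
Qed.

Lemma graph0 : G (0, 0).
Proof.
case: hG => _ _ _ [h _] _; have [f hf] := h 0.
by have := GP (-1) hf hf; rewrite !scaleN1r !addNr.
Qed.

Lemma graph_sum d (x : 'rV[C]_d) (v : 'I_d -> V) (f : 'I_d -> fock) :
  (forall i, G (v i, f i)) -> G (\sum_i x 0 i *: v i, \sum_i x 0 i *: f i).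
Proof.
move=> h; elim/big_rec2: _ => [|i g w _ hw]; first exact: graph0.
exact: GP.
Qed.

Lemma graph_weight v f (mu : weight R) : G (v, f) ->
  weight_space mu v <-> forall k, E k k f = mu k *: f.
Proof.
move=> hv; case: (hG) => _ GH Gact _ _; have fH := GH _ hv.
have ge k : G (gact (elem R k k) v, E k k f).
  by have := Gact (elem R k k) _ hv; rewrite /= (rho_elem k k fH).
have gm k : G (mu k *: v, mu k *: f).
  by have := GP (mu k) hv graph0; rewrite !addr0.
split=> h k; first by have := ge k; rewrite h => /graph_eqr; apply.
by have := ge k; rewrite h => /graph_eq; apply.
Qed.

Lemma hascontent_E (eta : halfZ -> int) (f : fock) :
  hascontent eta f <-> forall k, E k k f = (eta k)%:~R *: f.
Proof.
split=> [h k|h c fc r].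
  apply/funext => c; rewrite E_diag fockZ; have [->|/h ->//] := eqVneq (f c) 0.
  by rewrite !mulr0.
have := congr1 (fun g : fock => g c) (h r); rewrite E_diag fockZ.
by move=> /(mulIf fc)/intr_inj.
Qed.

Lemma weight_decomposition v : exists s : seq V,
  (forall w, w \in s -> exists mu : weight R, weight_space mu w) /\ v = \sum_(w <- s) w.
Proof.
case: (hG) => _ GH _ [sur1 sur2] _; have [f hf] := sur1 v.
pose P f := H lam f /\ forall v, G (v, f) -> exists s : seq V,
  (forall w, w \in s -> exists mu : weight R, weight_space mu w) /\ v = \sum_(w <- s) w.
suff : P f by case=> _; apply.
apply: (H_decomp (lam := lam)) (GH _ hf) => [|a g h [gH hg] [hH hh]|g eta gH geta].
- split=> [|u /graph_eq -/(_ _ graph0) ->]; first exact: H0.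
  by exists [::]; rewrite big_nil.
- split=> [|u hu]; first exact: HP.
  have [vg hvg] := sur2 g gH; have [vh hvh] := sur2 h hH.
  have [s1 [w1 e1]] := hg _ hvg; have [s2 [w2 e2]] := hh _ hvh.
  exists ([seq a *: w | w <- s1] ++ s2); split.
    move=> w; rewrite mem_cat => /orP[/seq.mapP[z /w1[mu hmu] ->]|/w2//].
    exists mu => k; rewrite -[a *: z]addr0 gact_linearr hmu.
    have -> : gact (elem R k k) (0 : V) = 0.
      by have := gact_linearr (elem R k k) (-1) (0 : V) 0; rewrite scaler0 addr0 scaleN1r addNr.
    by rewrite !addr0 !scalerA mulrC.
  rewrite big_cat big_map -scaler_sumr -e1 -e2.
  exact: graph_eq hu (GP a hvg hvh).
split=> // u hu; exists [:: u]; rewrite big_seq1; split=> // w.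
rewrite inE => /eqP ->; exists (fun k => (eta k)%:~R).
by apply/(graph_weight _ hu)/hascontent_E.
Qed.

(** The same list of good configurations indexes the basis given by [content_basis] and the tableaux
    counted by [Sfun_size]. *)
Lemma weight_dim w p q : in_window w p q ->
  has_dim (weight_space (V := V) (monomial_weight R p q)) (Sfun deg_pos deg_npos lam p q).
Proof.
move=> hw; case: (hG) => _ GH _ [sur1 sur2] _.
have [gs hgs] := exists_enum lam w (content p q).
rewrite (Sfun_size domlam (content_pos p q) (content_npos p q) _ hgs); last first.
  by move=> r; exact: content_out.
have [b [_ b1 b2]] := content_basis R domlam (leqnn w) (fun r => content_out hw) hgs.
have /choice[u hu] i : exists v, G (v, b i) by apply: sur2; have [] := b1 i.
have wE v f : G (v, f) -> weight_space (monomial_weight R p q) v <-> hascontent (content p q) f.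
  move=> hv; rewrite (graph_weight _ hv) hascontent_E.
  by split=> h k; rewrite h (monomial_weightE R _ hw).
exists u => [i|v hv]; first by apply/(wE _ _ (hu i)); have [] := b1 i.
have [f hf] := sur1 v; have [x [ex ux]] := b2 f (GH _ hf) ((wE _ _ hf).1 hv).
exists x; split; first by apply: graph_eq hf _; rewrite ex; exact: graph_sum.
move=> y ey; apply: ux; apply: graph_eqr hf _.
by rewrite ey; exact: graph_sum.
Qed.

(** A nonzero weight vector corresponds to a function with a configuration in its support, and the
    content of that configuration is an exponent of finite support with weight [mu]. *)
Lemma weight_space0 (mu : weight R) v :
  (forall w p q, in_window w p q -> monomial_weight R p q <> mu) ->
  weight_space (V := V) mu v -> v = 0.
Proof.
move=> hmu hv; case: (hG) => _ GH _ [sur1 _] _; have [f hf] := sur1 v.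
have [f0|f0] := eqVneq f 0; first by apply: graph_eq hf _; rewrite f0; exact: graph0.
have [c fc] := neq0_supp f0; have [w hw] := H_bounded_by (GH _ hf).
have [p [q [hpq e]]] := wt_content (hw c fc); exfalso; apply: (hmu w p q hpq).
apply/funext => r; rewrite (monomial_weightE R _ hpq) e.
have := congr1 (fun g : fock => g c) ((graph_weight _ hf).1 hv r).
by rewrite E_diag fockZ => /(mulIf fc).
Qed.
End Character.

Theorem theorem5p2 (R : realType) (n : nat) (lam : 'I_n -> int)
    (V : glhat_module R) :
  dominant lam ->
  is_irr_hw_module V (Lambda lam) ->
  has_character V (Sfun_exp lam).
Proof.
move=> dlam hV.
have domlam (k l : 'I_n) : (k < l)%N -> lam l <= lam k by move=> /ltnW; exact: dlam.
have [G hG] := exists_intertwining_graph domlam hV.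
split=> [v|mu]; first exact: weight_decomposition hG v.
have [[w [p [q [hw <-]]]]|nmu] := pselect (exists w p q, in_window w p q /\ monomial_weight R p q = mu).
  by rewrite (Sfun_exp_window _ _ hw); exact: weight_dim domlam _ hG _ _ _ hw.
have h0 w p q : in_window w p q -> monomial_weight R p q <> mu.
  by move=> hw e; apply: nmu; exists w, p, q.
rewrite Sfun_exp0 //; exists (fun=> 0) => [[]//|v /(weight_space0 hG h0) ->].
exists 0; split=> [|x _]; first by rewrite big_ord0.
by apply/rowP => -[].
Qed.
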